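(* Let $Y\subset\mathbb{P}^4$ be a smooth cubic hypersurface, and let $\Gamma$ be an abstract irreducible curve. Then there exists a birational map in $\mathrm{Bir}(Y)$ that contracts a surface birational to $\Gamma\times\mathbb{P}^1$.
   Context: The base field is $\mathbb{C}$. $\mathrm{Bir}(Y)$ denotes the group of birational selfmaps of $Y$. A birational map $\varphi\in\mathrm{Bir}(Y)$ contracts an irreducible surface $V\subset Y$ if the image (closure of the image of the general points of $V$) has dimension at most $1$. *)

(* Defs.v *)
(* MathComp, MathComp-Analysis (topology), multinomials, real-closed.          *)
From HB Require Import structures.
From mathcomp Require Import all_boot all_order all_algebra.
From mathcomp Require Import complex.
From mathcomp Require Import boolp classical_sets functions reals topology.
From mathcomp Require Import mpoly.

Set Implicit Arguments.
Unset Strict Implicit.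
Unset Printing Implicit Defensive.

Import GRing.Theory.
Local Open Scope classical_set_scope.
Local Open Scope ring_scope.

(* Algebraic varieties over an algebraically closed field K are treated in     *)
(* the language of spaces with functions: a topological space together with a  *)
(* sheaf of K-valued functions.  [regular_at x f] says that f is a regular     *)
(* function on some open neighbourhood of x; the values of f elsewhere are     *)
(* irrelevant, and f is a section of the sheaf over an open set U when         *)
(* [regular_at x f] holds for all x in U.                                      *)
Record funSpace (K : closedFieldType) := FunSpace {
  funSpace_top :> topologicalType;
  regular_at : funSpace_top -> set (funSpace_top -> K);
  regular_at_local : forall x f g,
    regular_at x f -> (\forall y \near x, f y = g y) ->
    \forall y \near x, regular_at y g
}.
Arguments regular_at {K f} : rename.

Definition regular_on (K : closedFieldType) (X : funSpace K) (U : set X)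
  (f : X -> K) : Prop := forall x, U x -> regular_at x f.

(* The coarsest structure on T for which, for all (D, h) in F, the set D is    *)
(* open and h is regular on D.                                                 *)
Definition generated (K : closedFieldType) (T : choiceType)
  (F : set (set T * (T -> K))) : Type := T.

Section Generated.
Variables (K : closedFieldType) (T : choiceType) (F : set (set T * (T -> K))).

HB.instance Definition _ := Choice.copy (generated F) T.
HB.instance Definition _ := @isSubBaseTopological.Build (generated F)
  (set T) [set Dh.1 | Dh in F] id.

Definition generated_regular_at (x : generated F) : set (generated F -> K) :=
  [set f | exists2 Dh, F Dh & \forall y \near x, Dh.1 y /\ f y = Dh.2 y].

Lemma generated_regular_at_local (x : generated F) (f g : generated F -> K) :
  generated_regular_at x f -> (\forall y \near x, f y = g y) ->
  \forall y \near x, generated_regular_at y g.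
Proof.
move=> [Dh FDh fx] fg.
have : \forall y \near x, Dh.1 y /\ g y = Dh.2 y.
  by apply: filterS2 fx fg => y [Dy ->] ->.
by move=> /nbhs_interior; apply: filterS => y yDh; exists Dh.
Qed.

Definition generated_space : funSpace K :=
  FunSpace generated_regular_at_local.

End Generated.

(* K^n: the open sets are generated by the D(q), and the regular functions are *)
(* locally quotients p/q of polynomials.                                       *)
Definition affine_fractions (K : closedFieldType) (n : nat) :
    set (set 'rV[K]_n * ('rV[K]_n -> K)) :=
  [set Dh | exists p q : {mpoly K[n]},
     Dh = ([set x : 'rV[K]_n | q.@[x 0] != 0],
           fun x : 'rV[K]_n => p.@[x 0] / q.@[x 0])].

Definition affine_space (K : closedFieldType) (n : nat) : funSpace K :=
  generated_space (@affine_fractions K n).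

(* The points of P^n are the lines through the origin of K^(n+1).              *)
Definition proj_point (K : closedFieldType) (n : nat) : choiceType :=
  {L : {vspace 'rV[K]_n.+1} | \dim L == 1%N}.

(* One choice of homogeneous coordinates; it is only ever used in              *)
(* scaling-invariant expressions.                                              *)
Definition hcoord (K : closedFieldType) (n : nat) (x : proj_point K n) :
  'I_n.+1 -> K := vpick (val x) 0.

Definition proj_fractions (K : closedFieldType) (n : nat) :
    set (set (proj_point K n) * (proj_point K n -> K)) :=
  [set Dh | exists d, exists p q : {mpoly K[n.+1]},
     [/\ p \is d.-homog, q \is d.-homog &
     Dh = ([set x : proj_point K n | q.@[hcoord x] != 0],
           fun x : proj_point K n => p.@[hcoord x] / q.@[hcoord x])]].

Definition projective_space (K : closedFieldType) (n : nat) : funSpace K :=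
  generated_space (@proj_fractions K n).

(* A subset A of X, with the induced topology; the regular functions are       *)
(* locally restrictions of regular functions on X.                             *)
Section Subspace.
Variables (K : closedFieldType) (X : funSpace K) (A : set X).

Definition sub_regular_at (x : set_type A) : set (set_type A -> K) :=
  [set f | exists2 g : X -> K,
     regular_at (set_val x) g & \forall y \near x, f y = g (set_val y)].

Lemma sub_regular_at_local (x : set_type A) (f g : set_type A -> K) :
  sub_regular_at x f -> (\forall y \near x, f y = g y) ->
  \forall y \near x, sub_regular_at y g.
Proof.
move=> [h hx fh] fg.
have gh : \forall y \near x, g y = h (set_val y).
  by apply: filterS2 fh fg => y <- ->.
have hnear : \forall z \near (set_val x : X), regular_at z h.
  by apply: (regular_at_local hx); apply: nearW.
have {}hnear : \forall y \near x, regular_at (set_val y : X) h.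
  exact: (@initial_continuous _ _ (set_val : set_type A -> X) x _ hnear).
move/nbhs_interior: gh => gh.
by apply: filterS2 hnear gh => y hy gy; exists h.
Qed.

Definition sub_space : funSpace K := FunSpace sub_regular_at_local.

End Subspace.

(* The product of X and Y in the category of varieties: its topology, finer    *)
(* than the product topology, and its regular functions are generated by the   *)
(* quotients of functions of the form \sum_i f_i(x) g_i(y) with f_i, g_i       *)
(* regular on open sets U, V of X, Y.                                          *)
Definition tensor_on (K : closedFieldType) (X Y : funSpace K)
    (U : set X) (V : set Y) : set (X * Y -> K) :=
  [set t | exists m (f : 'I_m -> X -> K) (g : 'I_m -> Y -> K),
     [/\ forall i, regular_on U (f i), forall i, regular_on V (g i) &
     t = fun z => \sum_(i < m) f i z.1 * g i z.2]].

Definition prod_fractions (K : closedFieldType) (X Y : funSpace K) :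
    set (set (X * Y) * (X * Y -> K)) :=
  [set Dh | exists (U : set X) (V : set Y) (s t : X * Y -> K),
     [/\ open U, open V, tensor_on U V s, tensor_on U V t &
     Dh = ((U `*` V) `&` [set z | t z != 0], fun z => s z / t z)]].

Definition prod_space (K : closedFieldType) (X Y : funSpace K) : funSpace K :=
  generated_space (@prod_fractions K X Y).

Definition morphism_at (K : closedFieldType) (X Y : funSpace K)
    (f : X -> Y) (x : X) : Prop :=
  {for x, continuous f} /\
  forall g, regular_at (f x) g -> regular_at x (g \o f).

Definition isomorphic (K : closedFieldType) (X Y : funSpace K) : Prop :=
  exists (f : X -> Y) (g : Y -> X),
    [/\ forall x, morphism_at f x, forall y, morphism_at g y,
        cancel f g & cancel g f].

Definition is_affine (K : closedFieldType) (X : funSpace K) : Prop :=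
  exists n (A : set (affine_space K n)),
    closed A /\ isomorphic X (sub_space A).

(* Abstract, not necessarily irreducible, varieties: a finite affine atlas,    *)
(* and separatedness.                                                          *)
Definition is_variety (K : closedFieldType) (X : funSpace K) : Prop :=
  (exists m (U : 'I_m -> set X),
     (forall i, open (U i) /\ is_affine (sub_space (U i))) /\
     (forall x, exists i, U i x)) /\
  closed [set z : prod_space X X | z.1 = z.2].

Definition irreducible_set (T : topologicalType) (A : set T) : Prop :=
  A !=set0 /\
  forall F G : set T, closed F -> closed G ->
    A `<=` F `|` G -> A `<=` F \/ A `<=` G.

Definition irreducible_chain (T : topologicalType) (n : nat)
    (Z : 'I_n.+1 -> set T) : Prop :=
  (forall i, closed (Z i) /\ irreducible_set (Z i)) /\
  (forall i j : 'I_n.+1, (i < j)%N -> Z i `<` Z j).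

Definition dim_le (T : topologicalType) (n : nat) : Prop :=
  forall m (Z : 'I_m.+1 -> set T), irreducible_chain Z -> (m <= n)%N.

Definition has_dim (T : topologicalType) (n : nat) : Prop :=
  dim_le T n /\ exists Z : 'I_n.+1 -> set T, irreducible_chain Z.

Definition is_irreducible_curve (K : closedFieldType) (X : funSpace K) : Prop :=
  [/\ is_variety X, irreducible_set [set: X] & has_dim X 1].

Definition is_irreducible_surface_in (K : closedFieldType) (X : funSpace K)
    (V : set X) : Prop :=
  [/\ closed V, irreducible_set V & has_dim (sub_space V) 2].

(* A representative of a rational map: a morphism on a dense open subset; the  *)
(* values of [rat_fun] outside [rat_dom] are irrelevant.                       *)
Record ratMap (K : closedFieldType) (X Y : funSpace K) := RatMap {
  rat_dom : set X;
  rat_fun :> X -> Y;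
  rat_dom_open : open rat_dom;
  rat_dom_dense : dense rat_dom;
  rat_fun_morphism : forall x, rat_dom x -> morphism_at rat_fun x
}.

Definition same_ratMap (K : closedFieldType) (X Y : funSpace K)
    (f g : ratMap X Y) : Prop :=
  exists W : set X,
    [/\ open W, dense W, W `<=` rat_dom f `&` rat_dom g &
        forall x, W x -> f x = g x].

(* g o f is the identity as a rational map.                                    *)
Definition rat_cancel (K : closedFieldType) (X Y : funSpace K)
    (f : ratMap X Y) (g : ratMap Y X) : Prop :=
  exists W : set X,
    [/\ open W, dense W, W `<=` rat_dom f `&` f @^-1` rat_dom g &
        forall x, W x -> g (f x) = x].

Definition is_birational_map (K : closedFieldType) (X Y : funSpace K)
    (f : ratMap X Y) : Prop :=
  exists g : ratMap Y X, rat_cancel f g /\ rat_cancel g f.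

Definition birational (K : closedFieldType) (X Y : funSpace K) : Prop :=
  exists f : ratMap X Y, is_birational_map f.

(* Representatives of the elements of Bir(X).                                  *)
Definition Bir (K : closedFieldType) (X : funSpace K) : set (ratMap X X) :=
  [set f | is_birational_map f].
Arguments Bir {K} X.

(* V is irreducible, so as soon as the domain of a representative of f meets   *)
(* V it contains the general points of V; the closure of their image does not  *)
(* depend on the representative.                                               *)
Definition contracts (K : closedFieldType) (X : funSpace K)
    (f : ratMap X X) (V : set X) : Prop :=
  is_irreducible_surface_in V /\
  exists g : ratMap X X,
    [/\ same_ratMap f g, V `&` rat_dom g !=set0 &
        dim_le (sub_space (closure (g @` (V `&` rat_dom g)))) 1].

(* The non-vanishing of the gradient of F along Y is the Jacobian criterion    *)
(* for the scheme F = 0; in particular F is reduced.                           *)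
Definition is_smooth_hypersurface (K : closedFieldType) (n d : nat)
    (Y : set (projective_space K n)) : Prop :=
  exists F : {mpoly K[n.+1]},
    [/\ F != 0, F \is d.-homog,
        Y = [set x : projective_space K n | F.@[hcoord x] = 0] &
        forall x, Y x -> exists i, (F^`M(i)).@[hcoord x] != 0].

(* Main.v *)
(* On a smooth cubic threefold Y choose a line l, which exists because a conic
   and a cubic of a plane always meet, and coordinates y_i, with l given by
   y_2 = y_3 = y_4 = 0, in which the polars of the points of l are combinations of
   y_2, eps y_3 and y_4.  The planes through l form a plane with affine coordinates
   (m, n) = (y_3 / y_2, y_4 / y_2).  A rational map w from that plane to l defines a
   birational involution of Y: x goes to the third point of Y on the line through
   x and w(m(x), n(x)).  If w = ps e_0 + D e_1, this line is tangent to Y at w over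
   the curve Q = ps^2 + eps ps D m + D^2 n = 0, so the involution contracts to l the
   surface that lies over that curve.  There w is a point of the conic residual to
   l in the plane spanned by l and x, so projection from w makes the surface
   birational to the product of the curve with P^1.
   On a curve with function field L over K(m), the primitive element theorem gives
   s in L such that n = -(s^2 + eps s m) generates L; writing s = ps(m, n) / D(m),
   the curve Q = 0 has a component birational to the given one.
   That any two functions on a curve are algebraically dependent is proved by
   Amitsur's trick, as the complex numbers are uncountable; the dimensions of the
   surface and of its image are bounded by counting algebraically independent
   polynomials on affine cones. *)

(* The relation n = -(s^2 + eps s m) is forced: for v with y_2 = 1 the polar value [tri v w w] is
   D^2 (s^2 + eps s m + n) with s = ps / D, so points satisfying it lie on Q = 0. For w to be
   defined on the whole (m, n)-plane, s must be a rational function of m and n; hence n, not only s,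
   has to generate the function field over K(m). The third point of Y on the line through v and w is
   (v w w) v - (v v w) w, which collapses to w where [tri v w w] vanishes and [tri v v w] does not.
   One more condition is carried along: 2 s + eps m, the derivative in s of s^2 + eps s m, must not
   vanish identically on the curve. It is the slope, in the parameter l of the residual conic, of
   the denominator of the parametrisation of the surface, so it makes that parametrisation defined
   at general points. The domain of the involution is shown to be dense in Y by moving a given point
   of Y inside planes where the cubic equation is monic in one variable. This replaces an argument
   through the irreducibility of Y. *)
From HB Require Import structures.
Require Import Defs.
From mathcomp Require Import all_boot all_order all_algebra all_field.
From mathcomp Require Import ring_quotient fraction complex ring lra zify.
From mathcomp Require Import boolp classical_sets functions cardinality reals topology.
From mathcomp Require Import mpoly.

Set Implicit Arguments.
Unset Strict Implicit.
Unset Printing Implicit Defensive.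

Import GRing.Theory.
Local Open Scope classical_set_scope.
Local Open Scope ring_scope.

(** * Uncountability of the complex numbers *)

Section Uncountable.
Variables (R : realType) (g : nat -> R).
Import Order.TTheory Num.Theory.

(** Nested closed intervals, the n-th step excluding [g n]. In the second case [g n] is at least the
    midpoint, and the cut at a quarter keeps it strictly outside. *)
Fixpoint avoid_interval (n : nat) : R * R :=
  if n isn't n'.+1 then (0, 1) else
  let: (a, b) := avoid_interval n' in
  if g n' < (a + b) / 2 then ((a + b) / 2, b) else (a, a + (b - a) / 4).

Lemma avoid_interval_step n :
  let: (a, b) := avoid_interval n in
  let: (a', b') := avoid_interval n.+1 in
  [/\ a' < b', a <= a', b' <= b & g n < a' \/ b' < g n].
Proof.
suff: (avoid_interval n).1 < (avoid_interval n).2.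
  rewrite /=; case: (avoid_interval n) => a b /= ab.
  by case: (ltP (g n)) => gn; split; rewrite ?lexx //; first [left; lra | right; lra | lra].
elim: n => [|n IH] /=. exact: ltr01.
case: (avoid_interval n) IH => a b /= ab; case: (ltP (g n)) => _ /=; lra.
Qed.

Lemma avoid_interval_sup : exists x, forall n, g n != x.
Proof.
pose A := [set (avoid_interval n).1 | n in [set: nat]].
have step n := avoid_interval_step n.
have mono1 n k : (avoid_interval n).1 <= (avoid_interval (n + k)).1.
  elim: k => [|k IH]; first by rewrite addn0.
  apply: le_trans IH _; rewrite addnS; have := step (n + k)%N.
  by case: (avoid_interval (n + k)) => a b; case: (avoid_interval _.+1) => a' b' [].
have mono2 n k : (avoid_interval (n + k)).2 <= (avoid_interval n).2.
  elim: k => [|k IH]; first by rewrite addn0.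
  apply: le_trans IH; rewrite addnS; have := step (n + k)%N.
  by case: (avoid_interval (n + k)) => a b; case: (avoid_interval _.+1) => a' b' [].
have ltab n : (avoid_interval n).1 <= (avoid_interval n).2.
  case: n => [|n]; first by rewrite /=; lra.
  have := step n; case: (avoid_interval n) => a b.
  by case: (avoid_interval _.+1) => a' b' [/ltW].
have ub n : ubound A (avoid_interval n).2.
  move=> _ [k _ <-]; apply: le_trans (mono1 k n) _.
  by apply: le_trans (ltab _) _; rewrite addnC.
have hsA : has_sup A by split; [exists (avoid_interval 0).1; exists 0%N | exists (avoid_interval 0).2; exact: ub].
exists (sup A) => n.
have l1 : (avoid_interval n.+1).1 <= sup A by apply: sup_upper_bound => //; exists n.+1.
have l2 : sup A <= (avoid_interval n.+1).2.
  by apply: ge_sup; [case: hsA | exact: ub].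
have := step n; case: (avoid_interval n) => a b; case: (avoid_interval n.+1) l1 l2 => a' b' /= l1 l2 [_ _ _].
case=> h; [rewrite lt_eqF// | rewrite gt_eqF//].
  exact: lt_le_trans h l1.
exact: le_lt_trans l2 h.
Qed.
End Uncountable.

Lemma realType_uncountable (R : realType) : ~ countable [set: R].
Proof.
case/countable_injP => f finj.
have [x Hx] := avoid_interval_sup (fun n => xget (0 : R) [set y | f y = n]).
move: (Hx (f x)); case: xgetP => [y -> fy|/(_ x)/=//].
by move/eqP; apply; apply: finj; rewrite ?inE.
Qed.

Lemma complex_uncountable (R : realType) : ~ countable [set: R[i]].
Proof.
case/countable_injP => f finj; apply: (@realType_uncountable R).
apply/countable_injP; exists (fun x : R => f (x +i* 0)%C) => x y _ _ fxy.
by have /= [] : (x +i* 0)%C = (y +i* 0)%C by apply: finj; rewrite ?inE.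
Qed.

Lemma lin_dep_fam (K : fieldType) (I J : finType) (a : I -> J -> K) :
  (#|J| < #|I|)%N ->
  exists mu : I -> K, (exists i, mu i != 0) /\ forall j, \sum_i mu i * a i j = 0.
Proof.
move=> lt; pose M : 'M[K]_(#|I|, #|J|) := \matrix_(i, j) a (enum_val i) (enum_val j).
have : kermx M != 0.
  rewrite kermx_eq0 -row_leq_rank -ltnNge.
  exact: leq_ltn_trans (rank_leq_col _) lt.
case/rowV0Pn => v /sub_kermxP vM nv.
exists (fun i => v 0 (enum_rank i)); split.
  have /rV0Pn[i vi] := nv; exists (enum_val i).
  by rewrite enum_valK.
move=> j; have /matrixP/(_ 0 (enum_rank j)) := vM.
rewrite !mxE => vMj; rewrite -[RHS]vMj [RHS](reindex enum_rank) /=; last first.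
  by exists enum_val => i _; rewrite ?enum_valK ?enum_rankK.
by apply: eq_bigr => i _; rewrite mxE !enum_rankK.
Qed.

Lemma mpoly_lin_dep (K : fieldType) n (I : finType) b (a : I -> {mpoly K[n]}) :
  (forall i, msize (a i) <= b)%N -> (#|{: 'X_{1..n < b}}| < #|I|)%N ->
  exists mu : I -> K, (exists i, mu i != 0) /\ \sum_i mu i *: a i = 0.
Proof.
move=> hb /(lin_dep_fam (fun i (m : 'X_{1..n < b}) => (a i)@_m))[mu [nz mu0]].
exists mu; split=> //; apply/mpolyP => m; rewrite mcoeff0 raddf_sum /=.
under eq_bigr => i _ do rewrite mcoeffZ.
have [lt|ge] := ltnP (mdeg m) b; first exact: (mu0 (BMultinom lt)).
rewrite big1 // => i _; suff -> : (a i)@_m = 0 by rewrite mulr0.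
apply/eqP; rewrite mcoeff_eq0; apply/negP => /msize_mdeg_lt.
by rewrite ltnNge (leq_trans (hb i) ge).
Qed.

(** The pigeonhole of Amitsur's trick: uncountably many indices c are sorted into countably many
    classes by a degree bound and the value of [e], so one class is infinite, whereas polynomials of
    bounded degree span a finite-dimensional space. The label [e] serves to make exponents equal in
    the application. *)
Lemma uncountable_lin_dep (K : fieldType) n (a : K -> {mpoly K[n]}) (e : K -> nat) :
  ~ countable [set: K] ->
  exists k (c mu : 'I_k -> K) e0,
    [/\ injective c, exists j, mu j != 0, forall j, e (c j) = e0 &
        \sum_j mu j *: a (c j) = 0].
Proof.
move=> unc.
have [[b e0] infS] : exists be, infinite_set [set c | (msize (a c) <= be.1)%N /\ e c = be.2].
  apply: contrapT => /forallNP h; apply: unc.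
  have -> : [set: K] = \bigcup_(be in [set: nat * nat]) [set c | (msize (a c) <= be.1)%N /\ e c = be.2].
    by apply/seteqP; split=> // c _; exists (msize (a c), e c).
  apply: bigcup_countable => // be _; apply: finite_set_countable.
  by move: (h be) => /contrapT.
have [B BS sB] := infinite_set_fset #|{: 'X_{1..n < b}}|.+1 infS.
pose s := finmap.enum_fset B.
pose c (j : 'I_(size s)) := tnth (in_tuple s) j.
have cS j : (msize (a (c j)) <= b)%N /\ e (c j) = e0.
  by apply: BS; exact: mem_tnth.
have [|mu [nz mu0]] := mpoly_lin_dep (fun j => proj1 (cS j)); first by rewrite card_ord.
exists (size s), c, mu, e0; split=> //; last by move=> j; case: (cS j).
move=> i j; rewrite /c => /tuple_uniqP -> //.
exact: finmap.fset_uniq.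
Qed.

(** * Prime ideals over an uncountable field *)

Section Ideals.
Variable R : comNzRingType.
Implicit Types (I J M : set R).

Definition is_ideal J :=
  [/\ J 0, forall p q, J p -> J q -> J (p + q) & forall p q, J q -> J (p * q)].

Definition is_prime J :=
  [/\ is_ideal J, ~ J 1 & forall p q, J (p * q) -> J p \/ J q].

Lemma idealB J p q : is_ideal J -> J p -> J q -> J (p - q).
Proof. by case=> _ JD JM Jp Jq; apply: JD => //; rewrite -mulN1r; apply: JM. Qed.

Lemma ideal_sum J (T : finType) (F : T -> R) : is_ideal J -> (forall i, J (F i)) -> J (\sum_i F i).
Proof. by case=> J0 JD _ JF; elim/big_ind: _. Qed.

Lemma idealMr J p q : is_ideal J -> J p -> J (p * q).
Proof. by case=> _ _ JM Jp; rewrite mulrC; apply: JM. Qed.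

Definition ideal_add J a : set R := [set q | exists r, J (q - r * a)].

Lemma ideal_add_ideal J a : is_ideal J -> is_ideal (ideal_add J a).
Proof.
move=> iJ; have [J0 JD JM] := iJ; split.
- by exists 0; rewrite mul0r subr0.
- move=> p q [r Jr] [s Js]; exists (r + s).
  by rewrite mulrDl opprD addrACA; apply: JD.
- by move=> p q [r Jr]; exists (p * r); rewrite -mulrA -mulrBr; apply: JM.
Qed.

Lemma sub_ideal_add J a : is_ideal J -> J `<=` ideal_add J a.
Proof. by move=> iJ q Jq; exists 0; rewrite mul0r subr0. Qed.

Lemma ideal_addx J a : is_ideal J -> ideal_add J a a.
Proof. by case=> J0 _ _; exists 1; rewrite mul1r subrr. Qed.

Lemma prime_avoiding I M :
  is_ideal I -> M 1 -> (forall p q, M p -> M q -> M (p * q)) -> (forall p, M p -> ~ I p) ->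
  exists P, [/\ is_prime P, I `<=` P, forall p, M p -> ~ P p &
    forall a, ~ P a -> exists m, M m /\ ideal_add P a m].
Proof.
move=> iI M1 MM MI.
pose T := {J : set R | is_ideal J /\ (I `<=` J /\ forall p, M p -> ~ J p)}.
pose sle (a b : T) := `[< sval a `<=` sval b >].
have [||||P maxP] := @Zorn T sle.
- by move=> t; apply/asboolP.
- by move=> r s t /asboolP rs /asboolP st; apply/asboolP; apply: subset_trans st.
- by move=> [s ps] [t pt] /asboolP /= st /asboolP /= ts; apply: eq_exist; apply/seteqP.
- move=> A totA; have [[t At]|/forallNP A0] := pselect (exists t, A t); last first.
    by exists (exist _ I (conj iI (conj (@subset_refl _ I) MI))) => s /A0.
  pose U := \bigcup_(J in A) sval J.
  have iU : is_ideal U.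
    split.
    - by exists t => //; case: (svalP t) => -[].
    - move=> p q [J AJ Jp] [J' AJ' Jq].
      have [/asboolP s|/asboolP s] := totA _ _ AJ AJ'.
        by exists J' => //; case: (svalP J') => -[_ JD _] _; apply: JD => //; apply: s.
      by exists J => //; case: (svalP J) => -[_ JD _] _; apply: JD => //; apply: s.
    - by move=> p q [J AJ Jq]; exists J => //; case: (svalP J) => -[_ _ JM] _; apply: JM.
  have IU : I `<=` U by move=> x Ix; exists t => //; case: (svalP t) => _ [h _]; apply: h.
  have MU p : M p -> ~ U p by move=> Mp [J _ Jp]; case: (svalP J) => _ [_ h]; apply: h Jp.
  exists (exist _ U (conj iU (conj IU MU))) => s As; apply/asboolP => x sx /=.
  by exists s.
case: (svalP P) => iP [IP MP].
have mx a : ~ sval P a -> exists m, M m /\ ideal_add (sval P) a m.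
  move=> nPa; apply: contrapT => /forallNP h.
  have iQ := ideal_add_ideal a iP.
  have IQ : I `<=` ideal_add (sval P) a := subset_trans IP (@sub_ideal_add (sval P) a iP).
  have MQ p : M p -> ~ ideal_add (sval P) a p by move=> Mp Qp; apply: (h p).
  have := maxP (exist _ _ (conj iQ (conj IQ MQ))).
  have -> : sle P (exist _ _ (conj iQ (conj IQ MQ))) by apply/asboolP; apply: sub_ideal_add.
  move=> /(_ isT) /(congr1 sval) /= e; apply: nPa; rewrite -e; exact: ideal_addx.
exists (sval P); split=> //; split=> //; first exact: MP.
have [P0 PD PM] := iP.
move=> p q Ppq; apply: contrapT => /not_orP[/mx[m [Mm [r Pm]]] /mx[m' [Mm' [r' Pm']]]].
apply: (MP (m * m')); first exact: MM.
have -> : m * m' = (m - r * p) * m' + r * p * (m' - r' * q) + r * r' * (p * q) by ring.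
by apply: (PD _ _ (PD _ _ (idealMr _ iP Pm) (PM _ _ Pm'))); apply: PM.
Qed.

Lemma prime_exp P p k : is_prime P -> P (p ^+ k) -> P p.
Proof.
by case=> _ P1 PP; elim: k => [|k IH]; [rewrite expr0 => /P1 | rewrite exprS => /PP[|/IH]].
Qed.

Lemma prime_prod P (s : seq R) : is_prime P -> P (\prod_(x <- s) x) -> exists2 x, x \in s & P x.
Proof.
case=> _ P1 PP; elim: s => [|x s IH]; first by rewrite big_nil => /P1.
rewrite big_cons => /PP[Px|/IH[y ys Py]]; first by exists x; rewrite ?mem_head.
by exists y => //; rewrite inE ys orbT.
Qed.

End Ideals.

(* Partial fractions: the polynomial [\sum_j a_j \prod_(l != j) (X - c_j)] takes
   the value [a_j \prod_(l != j) (c_j - c_l)] at [c_j]. *)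
Definition cleared_fractions (R : comNzRingType) k (c a : 'I_k -> R) : {poly R} :=
  \sum_j (a j)%:P * \prod_(l | l != j) ('X - (c l)%:P).

Lemma cleared_fractions_neq0 (R : idomainType) k (c a : 'I_k -> R) j :
  injective c -> a j != 0 -> cleared_fractions c a != 0.
Proof.
move=> cinj aj; apply: contraNneq aj => /(congr1 (horner^~ (c j))).
rewrite /cleared_fractions horner_sum horner0 (bigD1 j) //= [X in _ + X]big1 ?addr0; last first.
  move=> i ij; rewrite hornerM horner_prod (bigD1 j) 1?eq_sym //=.
  by rewrite hornerXsubC subrr mul0r mulr0.
move/eqP; rewrite hornerM hornerC mulf_eq0 horner_prod => /orP[//|].
move/prodf_eq0 => [l lj]; rewrite !hornerE subr_eq0 => /eqP/cinj e.
by rewrite e eqxx in lj.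
Qed.

(** Modulo P, [a j] plays the role of b_j / (t - c_j). A linear relation between the [a j] thus
    becomes a vanishing sum of partial fractions in t, and the conclusion is that sum with its
    denominators cleared. *)
Lemma ideal_cleared_fractions (R : comNzRingType) (P : set R) k (c m b a : 'I_k -> R) t :
  is_ideal P -> (forall j, P (b j - a j * (t - c j))) ->
  \sum_j m j * a j = 0 ->
  P (cleared_fractions c (fun j => m j * b j)).[t].
Proof.
move=> iP Pj ma; have [_ _ PM] := iP.
have -> : (cleared_fractions c (fun j => m j * b j)).[t] =
   \sum_j m j * \prod_(l | l != j) (t - c l) * (b j - a j * (t - c j)).
  transitivity (\sum_j (m j * \prod_(l | l != j) (t - c l) * (b j - a j * (t - c j))
                        + m j * a j * \prod_l (t - c l))); last first.
    by rewrite big_split /= -mulr_suml ma mul0r addr0.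
  rewrite /cleared_fractions horner_sum; apply: eq_bigr => j _.
  rewrite hornerM hornerC horner_prod [\prod_l (t - c l)](bigD1 j) //=.
  under eq_bigr => l _ do rewrite !hornerE.
  by ring.
by apply: ideal_sum => // j; apply: PM.
Qed.

(** * Amitsur's trick: the Nullstellensatz and hypersurface sections *)

Section Amitsur.
Variables (K : closedFieldType) (n : nat).
Hypothesis K_unc : ~ countable [set: K].
Local Notation MP := {mpoly K[n]}.

Lemma horner_alg_mpolyC (t : MP) c : horner_alg t c%:P = c%:MP.
Proof. by rewrite horner_algC -mul_mpolyC mulr1. Qed.

Lemma prime_horner_root (P : set MP) (g : {poly K}) (t : MP) :
  is_prime P -> g != 0 -> P (horner_alg t g) -> exists c, P (t - c%:MP).
Proof.
move=> pP g0; have [r ->] := closed_field_poly_normal g.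
rewrite linearZ /= -mul_mpolyC => Pg.
have [_ _ PP] := pP; have [iP P1 _] := pP.
have : P (\prod_(z <- r) (t - z%:MP)).
  have e : horner_alg t (\prod_(z <- r) ('X - z%:P)) = \prod_(z <- r) (t - z%:MP).
    rewrite rmorph_prod; apply: eq_bigr => z _.
    by rewrite rmorphB /= horner_algX horner_alg_mpolyC.
  rewrite -e; case: (PP _ _ Pg) => // h.
  have : P ((lead_coef g)^-1%:MP * ((lead_coef g)%:MP * 1)) by case: iP => _ _; apply.
  by rewrite mulr1 -mpolyCM mulVf ?lead_coef_eq0 // mpolyC1 => /P1.
rewrite -(big_map (fun z : K => t - z%:MP) xpredT id) => /prime_prod[] // x.
by case/mapP => z _ -> h; exists z.
Qed.

Lemma ideal_vanishing_point (P : set MP) (v : 'I_n -> K) :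
  is_ideal P -> (forall i, P ('X_i - (v i)%:MP)) -> forall q, P (q - q.@[v]%:MP).
Proof.
move=> iP Pv; have [P0 PD PM] := iP; elim/mpolyind => [|c m q _ _ IH].
  by rewrite meval0 mpolyC0 subr0.
rewrite mevalD mpolyCD opprD addrACA; apply: (PD) => //.
rewrite mevalZ mpolyCM -mul_mpolyC -mulrBr; apply: (PM) => {IH}.
rewrite mevalX mpolyXE_id.
elim/big_ind2: _ => [|a p b q' Pp Pq|i _].
- by rewrite mpolyC1 subrr.
- have -> : p * q' - (a * b)%:MP = p * (q' - b%:MP) + (p - a%:MP) * b%:MP.
    by rewrite mpolyCM; ring.
  by apply: PD; [apply: PM | apply: idealMr].
elim: (m i) => [|k IHk]; first by rewrite !expr0 mpolyC1 subrr.
have -> : 'X_i ^+ k.+1 - (v i ^+ k.+1)%:MP =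
   'X_i * ('X_i ^+ k - (v i ^+ k)%:MP) + ('X_i - (v i)%:MP) * (v i ^+ k)%:MP :> MP.
  by rewrite !exprS mpolyCM; ring.
by apply: PD; [apply: PM | apply: idealMr].
Qed.

(** Enlarge P to a prime Q maximal among the ideals missing the powers of p. If no X_i - c lay in Q,
    then each X_i - c would divide a power of p modulo Q; for uncountably many c the quotients are
    linearly dependent, and partial fractions give a nonzero g with p^e0 g(X_i) in Q. A root c of g
    then has X_i - c in Q, a contradiction. So every X_i is constant modulo Q, which defines the
    point. *)
Lemma nullstellensatz (P : set MP) p : is_prime P -> ~ P p ->
  exists v : 'I_n -> K, (forall q, P q -> q.@[v] = 0) /\ p.@[v] != 0.
Proof.
move=> pP nPp; pose M := [set q | exists k, q = p ^+ k].
have iP : is_ideal P by case: pP.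
have [|||Q [pQ PQ MQ mxQ]] := @prime_avoiding _ P M iP.
- by exists 0%N.
- by move=> _ _ [k ->] [l ->]; exists (k + l)%N; rewrite exprD.
- by move=> _ [k ->] /(prime_exp pP).
have [iQ Q1 _] := pQ.
have Qp : ~ Q p by apply: MQ; exists 1%N; rewrite expr1.
have QX i : exists c, Q ('X_i - c%:MP).
  apply: contrapT => /forallNP h.
  have /choice[e he] : forall c, exists ka : nat * MP, Q (p ^+ ka.1 - ka.2 * ('X_i - c%:MP)).
    by move=> c; case: (mxQ _ (h c)) => _ [[k ->] [r Qr]]; exists (k, r).
  have [k [c [mu [e0 [cinj [j nzj] ee sum0]]]]] :=
    @uncountable_lin_dep K n (fun c => (e c).2) (fun c => (e c).1) K_unc.
  have := @ideal_cleared_fractions _ Q k (fun j => (c j)%:MP) (fun j => (mu j)%:MP)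
    (fun j => p ^+ e0) (fun j => (e (c j)).2) 'X_i iQ.
  move=> /(_ _ _)/wrap[].
    by move=> l; rewrite -(ee l).
  by rewrite -[RHS]sum0; apply: eq_bigr => l _; rewrite mul_mpolyC.
  pose g := cleared_fractions c mu => Qg.
  have : Q (p ^+ e0 * horner_alg 'X_i g).
    suff -> : p ^+ e0 * horner_alg 'X_i g =
      (cleared_fractions (fun j => (c j)%:MP) (fun j => (mu j)%:MP * p ^+ e0)).['X_i] by [].
    rewrite /g /cleared_fractions rmorph_sum horner_sum mulr_sumr; apply: eq_bigr => l _.
    rewrite rmorphM rmorph_prod /= horner_alg_mpolyC hornerM hornerC horner_prod mulrCA mulrA.
    congr (_ * _); apply: eq_bigr => i' _.
    by rewrite rmorphB /= horner_algX horner_alg_mpolyC !hornerE.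
  have [_ _ QQ] := pQ; case/QQ => [/(prime_exp pQ)//|Qgi].
  have [c' Qc] := prime_horner_root pQ (cleared_fractions_neq0 cinj nzj) Qgi.
  exact: h Qc.
have {QX} [v Qv] := choice QX; exists v.
have Qev := ideal_vanishing_point iQ Qv.
have Qc c : Q c%:MP -> c = 0.
  move=> Qc; apply/eqP/negPn/negP => c0; apply: Q1.
  have -> : 1 = (c^-1)%:MP * c%:MP :> MP by rewrite -mpolyCM mulVf.
  by case: iQ => _ _; apply.
split.
  move=> q /PQ Qq; apply: Qc.
  by have := idealB iQ Qq (Qev q); rewrite opprB addrC subrK.
apply: contra_notN Qp => /eqP pv.
by have := Qev p; rewrite pv mpolyC0 subr0.
Qed.

(** If f and g are algebraically independent modulo P, then g stays transcendental on some section f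
    = c. Otherwise every c gives a nonzero h_c with h_c(g) a multiple of f - c modulo P; a linear
    relation between the cofactors turns the sum of the h_c(g) / (f - c) into an algebraic relation
    between f and g. *)
Lemma independent_prime (P : set MP) (f g : MP) :
  is_prime P ->
  (forall H : {poly {poly K}}, H != 0 -> ~ P (map_poly (horner_alg g) H).[f]) ->
  exists c J, [/\ is_prime J, P `<=` J, J (f - c%:MP) &
    forall h : {poly K}, h != 0 -> ~ J (horner_alg g h)].
Proof.
move=> pP ind; have [iP P1 PP] := pP; apply: contrapT => /forallNP h.
have /choice[e he] : forall c, exists ha : {poly K} * MP, ha.1 != 0 /\
    P (horner_alg g ha.1 - ha.2 * (f - c%:MP)).
  move=> c; apply: contrapT => /forallNP nh.
  pose M := [set q | exists2 h : {poly K}, h != 0 & q = horner_alg g h].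
  have [||||Q [pQ PQ MQ mxQ]] := @prime_avoiding _ (ideal_add P (f - c%:MP)) M.
  - exact: ideal_add_ideal.
  - by exists 1; rewrite ?oner_neq0 // rmorph1.
  - move=> _ _ [h1 h10 ->] [h2 h20 ->]; exists (h1 * h2); first by rewrite mulf_neq0.
    by rewrite rmorphM.
  - by move=> _ [h1 h10 ->] [r Pr]; apply: (nh (h1, r)).
  apply: (h c); exists Q; split=> //.
  - by move=> x Px; apply: PQ; apply: sub_ideal_add.
  - by apply: PQ; apply: ideal_addx.
  - by move=> h1 h10; apply: MQ; exists h1.
have [k [c [mu [_ [cinj [j nzj] _ sum0]]]]] :=
    @uncountable_lin_dep K n (fun c => (e c).2) (fun=> 0%N) K_unc.
pose H := cleared_fractions (fun j => (c j)%:P) (fun j => (mu j)%:P * (e (c j)).1).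
have H0 : H != 0.
  apply: (@cleared_fractions_neq0 _ _ _ _ j); first by move=> a b /polyC_inj /cinj.
  by rewrite mulf_neq0 ?polyC_eq0 //; case: (he (c j)).
apply: (ind H H0).
have := @ideal_cleared_fractions _ P k (fun j => (c j)%:MP) (fun j => (mu j)%:MP)
    (fun j => horner_alg g (e (c j)).1) (fun j => (e (c j)).2) f iP.
move=> /(_ _ _)/wrap[].
- by move=> l; case: (he (c l)).
- by rewrite -[RHS]sum0; apply: eq_bigr => l _; rewrite mul_mpolyC.
congr (P _); rewrite /H /cleared_fractions rmorph_sum !horner_sum; apply: eq_bigr => l _.
rewrite [in RHS]rmorphM [in RHS]rmorph_prod /= map_polyC /= !hornerM !hornerC !horner_prod.
rewrite rmorphM /= horner_alg_mpolyC; congr (_ * _); apply: eq_bigr => i' _.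
by rewrite rmorphB /= map_polyX map_polyC /= horner_alg_mpolyC !hornerE.
Qed.

End Amitsur.

(** * Plane models of curves *)

Lemma fraction_numden (R : idomainType) (z : {fraction R}) : exists a b : R,
  b != 0 /\ z = FracField.tofrac a / FracField.tofrac b.
Proof.
elim/quotW: z => x; exists (frac x).1, (frac x).2; have d0 := denom_ratioP x; split=> //.
apply: (mulIf (x := FracField.tofrac (frac x).2)); first by rewrite tofrac_eq0.
rewrite divfK ?tofrac_eq0 // !piE; apply/eqmodP.
by rewrite /= FracField.equivfE !numden_Ratio ?(oner_eq0, mulf_neq0, d0) // !mulr1 mulrC.
Qed.

Section ResidueField.
Variables (R : comNzRingType) (P : set R).
Hypothesis primeP : is_prime P.

Definition ideal_mem : pred R := fun p => `[< P p >].

Fact ideal_mem_idealr : idealr_closed ideal_mem.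
Proof.
have [[P0 PD PM] P1 _] := primeP; split.
- exact/asboolP.
- by apply/asboolP.
by move=> a u v /asboolP Pu /asboolP Pv; apply/asboolP; apply: (PD) => //; apply: PM.
Qed.

Fact ideal_mem_prime : prime_idealr_closed ideal_mem.
Proof.
have [_ _ PP] := primeP; move=> u v /asboolP /PP[] h; apply/orP; [left|right]; exact/asboolP.
Qed.

Lemma residue_fieldP : exists (L : fieldType) (pi : {rmorphism R -> L}),
  (forall p, P p <-> pi p = 0) /\
  forall z, exists p q, pi q != 0 /\ z = pi p / pi q.
Proof.
pose IaM := GRing.isZmodClosed.Build _ ideal_mem (idealr_closedB ideal_mem_idealr).
pose IpM := isProperIdeal.Build _ ideal_mem (idealr_closed_nontrivial ideal_mem_idealr).
pose IcM := isPrimeIdealrClosed.Build _ ideal_mem ideal_mem_prime.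
pose Iid : prime_idealr _ := HB.pack ideal_mem IaM IpM IcM.
pose E : comNzRingType := {ideal_quot Iid}.
pose RtoE : {rmorphism R -> E} := \pi_E%qT.
have RtoE0 p : P p <-> RtoE p = 0.
  split=> [Pp|e].
    by apply/eqP; rewrite piE Quotient.equivE subr0; apply/asboolP.
  by move/eqP: e; rewrite piE Quotient.equivE subr0 => /asboolP.
(* The field of fractions is built over an [idomainType], which includes decidable units and an
   inverse; both are supplied by classical choice. *)
pose unitE : {pred E} := fun x => `[< exists y, y * x = 1 >].
pose invE (x : E) := xget x [set y | y * x = 1].
have mulVE : {in unitE, left_inverse 1 invE *%R}.
  by move=> x /asboolP[y yx]; rewrite /invE; case: xgetP => [z -> //|/(_ y)]; case.
have unitEP (x y : E) : y * x = 1 -> unitE x by move=> yx; apply/asboolP; exists y.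
have invE_out : {in [predC unitE], invE =1 id}.
  move=> x /negP nx; rewrite /invE; case: xgetP => // y _ yx.
  by case: nx; apply: (unitEP _ y).
pose Mu := GRing.ComNzRing_hasMulInverse.Build E mulVE unitEP invE_out.
pose Eu : comUnitRingType := HB.pack E Mu.
have Edom : GRing.integral_domain_axiom Eu := @Quotient.rquot_IdomainAxiom _ Iid.
pose Mi := GRing.ComUnitRing_isIntegral.Build Eu Edom.
pose Ei : idomainType := HB.pack Eu Mi.
pose pif (p : R) : {fraction Ei} := FracField.tofrac (RtoE p : Ei).
have pifB : zmod_morphism pif.
  move=> p q; rewrite /pif rmorphB; exact: (tofracB (R := Ei)).
have pifM : monoid_morphism pif.
  split; first by rewrite /pif rmorph1; exact: (tofrac1 Ei).
  by move=> p q; rewrite /pif rmorphM; exact: (tofracM (R := Ei)).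
pose MB := GRing.isZmodMorphism.Build R {fraction Ei} pif pifB.
pose MM := GRing.isMonoidMorphism.Build R {fraction Ei} pif pifM.
exists {fraction Ei}, (HB.pack pif MB MM : {rmorphism R -> {fraction Ei}}); split.
  move=> p; rewrite RtoE0; change (RtoE p = 0 <-> FracField.tofrac (RtoE p : Ei) = 0).
  split=> [e|]; first by rewrite e; exact: (tofrac0 Ei).
  by move/eqP; rewrite (tofrac_eq0 (R := Ei)) => /eqP.
move=> z; have [a [b [b0 ->]]] := fraction_numden z.
exists (repr (a : E)), (repr (b : E)); rewrite /= /pif /RtoE /= !reprK; split=> //.
by rewrite (tofrac_eq0 (R := Ei)).
Qed.
End ResidueField.

Section FracImage.
Variables (R : comNzRingType) (L : fieldType) (ev : {rmorphism R -> L}).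

Definition frac_image : {pred L} := fun z => `[< exists a b, ev b != 0 /\ z = ev a / ev b >].

Fact frac_image_divring : divring_closed frac_image.
Proof.
split.
- by apply/asboolP; exists 1, 1; rewrite rmorph1 divr1 oner_neq0.
- move=> _ _ /asboolP[a [b [b0 ->]]] /asboolP[c [d [d0 ->]]]; apply/asboolP.
  exists (a * d - c * b), (b * d); rewrite rmorphM mulf_neq0 //; split=> //.
  by rewrite rmorphB !rmorphM; field; rewrite b0 d0.
- move=> _ _ /asboolP[a [b [b0 ->]]] /asboolP[c [d [d0 ->]]]; apply/asboolP.
  have [->|c0] := eqVneq (ev c) 0.
    by exists 0, 1; rewrite rmorph0 rmorph1 !mul0r invr0 mulr0 oner_neq0.
  exists (a * d), (b * c); rewrite rmorphM mulf_neq0 //; split=> //.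
  by rewrite !rmorphM; field; rewrite b0 c0.
Qed.

HB.instance Definition _ := GRing.isDivringClosed.Build L frac_image frac_image_divring.

Record frac_field := FracFieldElt { frac_val :> L; _ : frac_val \in frac_image }.
HB.instance Definition _ := [isSub for frac_val].
HB.instance Definition _ := [Choice of frac_field by <:].
HB.instance Definition _ := [SubChoice_isSubIntegralDomain of frac_field by <:].
HB.instance Definition _ := [SubIntegralDomain_isSubField of frac_field by <:].
End FracImage.


(** Used with [ev] sending K[t] to L by t -> x: it gives K(x) as a field type of its own, the base
    field that the primitive element theorem asks for. *)
Lemma subfield_of_fractions (R : comNzRingType) (L : fieldType) (ev : {rmorphism R -> L}) :
  exists (F : fieldType) (iota : {rmorphism F -> L}),
   (forall a, exists f, iota f = ev a) /\
   forall f, exists a b, ev b != 0 /\ iota f = ev a / ev b.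
Proof.
exists (frac_field ev), (val : {rmorphism frac_field ev -> L}); split.
  move=> a; have h : ev a \in frac_image ev.
    by apply/asboolP; exists a, 1; rewrite rmorph1 divr1 oner_neq0.
  by exists (FracFieldElt h).
by case=> z h; have /asboolP := h.
Qed.

Section Generators.
Variables (K : closedFieldType) (F L : fieldType) (iota : {rmorphism F -> L}).
Local Notation "p ^ f" := (map_poly f p) : ring_scope.

(** Membership of w in F[z]; for z algebraic over F this ring is the field F(z). *)
Definition generated_by (z w : L) := exists q, (q ^ iota).[z] = w.

Lemma generated_by_trans x y z : generated_by z y -> generated_by y x -> generated_by z x.
Proof.
move=> [p <-] [q <-]; exists (q \Po p).
by rewrite map_comp_poly horner_comp.
Qed.

Lemma generated_by_id z : generated_by z z.
Proof. by exists 'X; rewrite map_polyX hornerX. Qed.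

Lemma generated_by_cst z c : generated_by z (iota c).
Proof. by exists c%:P; rewrite map_polyC hornerC. Qed.

Lemma generated_by_sub z x y : generated_by z x -> generated_by z y -> generated_by z (x - y).
Proof. by move=> [p <-] [q <-]; exists (p - q); rewrite rmorphB hornerD hornerN. Qed.

Variables (R : idomainType) (ev : {rmorphism R -> L}).
Hypothesis iotaE : forall f, exists a b, ev b != 0 /\ iota f = ev a / ev b.

Lemma clear_denominators1 z w : generated_by z w ->
  exists D p, ev D != 0 /\ ev D * w = (p ^ ev).[z].
Proof.
case=> q <-; elim/poly_ind: q => [|q c [D [p [D0 IH]]]].
  by exists 1, 0; rewrite !rmorph0 rmorph1 horner0 mulr0 oner_neq0.
have [a [b [b0 cE]]] := iotaE c.
exists (D * b), (b *: (p * 'X) + (D * a)%:P); rewrite rmorphM mulf_neq0 //; split=> //.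
rewrite [(_ + c%:P) ^ _]rmorphD rmorphM /= map_polyX map_polyC /= !hornerE cE.
rewrite rmorphD /= linearZ_LR /= rmorphM /= map_polyX map_polyC /= !hornerE -IH rmorphM /=.
by field.
Qed.

Lemma clear_denominators z (T : finType) (w : T -> L) : (forall i, generated_by z (w i)) ->
  exists D (p : T -> {poly R}), ev D != 0 /\ forall i, ev D * w i = (p i ^ ev).[z].
Proof.
move=> hw; have /choice[e he] : forall i, exists Dp : R * {poly R},
  ev Dp.1 != 0 /\ ev Dp.1 * w i = (Dp.2 ^ ev).[z].
  by move=> i; have [D [p h]] := clear_denominators1 (hw i); exists (D, p).
exists (\prod_i (e i).1), (fun i => (\prod_(j | j != i) (e j).1) *: (e i).2); split.
  by rewrite rmorph_prod; apply/prodf_neq0 => i _; case: (he i).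
move=> i; rewrite linearZ_LR /= hornerZ -(he i).2 (bigD1 i) //= rmorphM /=; ring.
Qed.

End Generators.

Section PlaneModel.
Variables (K : closedFieldType) (n : nat).
Hypothesis K_char0 : [pchar K] =i pred0.
Local Notation MP := {mpoly K[n]}.
Local Notation "p ^ f" := (map_poly f p) : ring_scope.
Variables (P : set MP) (x : MP).
Hypothesis primeP : is_prime P.
Hypothesis x_transcendental : forall h : {poly K}, h != 0 -> ~ P (horner_alg x h).
Hypothesis algebraic_over_x : forall p : MP,
  exists2 H : {poly {poly K}}, H != 0 & P (H ^ horner_alg x).[p].

(* [s] is a primitive element of the function field over [K(x)], shifted by a
   constant so that the quadratic expression [y] in [s] is primitive too. *)
Lemma plane_model (eps : K) : exists (s : MP) (D : {poly K}) (ps : {poly {poly K}})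
    (pc : 'I_n -> {poly {poly K}}),
  let y := - (s ^+ 2 + eps *: (s * x)) in
  [/\ D != 0,
      forall i, P (horner_alg x D * 'X_i - (pc i ^ horner_alg x).[y]),
      P (horner_alg x D * s - (ps ^ horner_alg x).[y]) &
      ~ P (s *+ 2 + eps *: x)].
Proof.
have [L [pi [Ppi fracL]]] := residue_fieldP primeP.
pose ev : {rmorphism {poly K} -> L} := pi \o horner_alg x.
have [F [iota [evF iotaE]]] := subfield_of_fractions ev.
have ev_inj h : ev h = 0 -> h = 0.
  move=> e; apply/eqP/negPn/negP => /x_transcendental; apply; exact/Ppi.
have alg_pi p : algebraicOver iota (pi p).
  have [H H0 PH] := algebraic_over_x p.
  (* [emb] lifts coefficients from K[t] to F = K(x). It sends only 0 to 0 because x is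
     transcendental, so the relation H stays nonzero over F. *)
  have [emb embE] := choice evF.
  have emb0 a : (emb a == 0) = (a == 0).
    rewrite -(fmorph_eq0 iota) embE; apply/eqP/eqP => [/ev_inj//|->].
    exact: rmorph0.
  exists (\poly_(i < size H) emb H`_i).
    apply/eqP => /polyP e; have sz : (0 < size H)%N by rewrite size_poly_gt0.
    move: (e (size H).-1); rewrite coef_poly coef0 prednK // leqnn => /eqP.
    by rewrite emb0 -lead_coefE lead_coef_eq0 (negPf H0).
  rewrite rootE; apply/eqP; move/Ppi: PH.
  rewrite -horner_map -map_poly_comp => <-; congr (_.[_]).
  apply/polyP => i; rewrite coef_map [RHS]coef_map coef_poly.
  case: ltnP => [_|ge]; first exact: embE.
  by rewrite nth_default // !raddf0.
have algL z : algebraicOver iota z.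
  by have [p [q [_ ->]]] := fracL z; apply: algebraic_div.
have F_char0 : [pchar F] =i pred0.
  apply/pcharf0P => k; rewrite -(fmorph_eq0 iota) rmorph_nat.
  rewrite -(rmorph_nat (pi \o @mpolyC n K : {rmorphism _ -> _})) fmorph_eq0.
  by move/pcharf0P: K_char0 => ->.
have two0 : (2 : K) != 0 by move/pcharf0P: K_char0 => /(_ 2%N) ->.
have PET (a b : L) : exists N, generated_by iota (b *+ N - a) a /\ generated_by iota (b *+ N - a) b.
  have [p p0 pa] := algL a; have [q q0 qb] := algL b.
  exact: (pchar0_PET p0 pa q0 qb F_char0).
have [s0 gen_s0] : exists s0 : MP, forall i, generated_by iota (pi s0) (pi 'X_i).
  suff /(_ n)[s0 h] : forall k, exists s0 : MP, forall i : 'I_n, (i < k)%N -> generated_by iota (pi s0) (pi 'X_i).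
    by exists s0 => i; apply: h; exact: ltn_ord.
  elim=> [|k [s IH]]; first by exists 0.
  have [kn|nk] := ltnP k n; last first.
    by exists s => i _; apply: IH; apply: leq_trans (ltn_ord i) nk.
  have [N [gx gs]] := PET (pi 'X_(Ordinal kn)) (pi s).
  exists (s *+ N - 'X_(Ordinal kn)) => i; rewrite rmorphB rmorphMn ltnS leq_eqVlt => /orP[/eqP ik|/IH].
    by have -> : i = Ordinal kn by apply: val_inj.
  exact: generated_by_trans.
have [s [gen_s nondeg]] : exists s : MP, let y := pi (- (s ^+ 2 + eps *: (s * x))) in
    (generated_by iota y (pi s) /\ forall i, generated_by iota y (pi 'X_i)) /\ ~ P (s *+ 2 + eps *: x).
  (* If the generator already lies in K(x), then everything does, and s = 1 is enough: 2 + eps x is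
     nonzero because the polynomial 2 + eps t takes the value 2 at t = 0. *)
  have [[f fE]|ns0] := pselect (exists f, iota f = pi s0).
    exists 1; split; [split|].
    - rewrite rmorph1 -(rmorph1 iota); exact: generated_by_cst.
    - move=> i; have [q <-] := gen_s0 i; rewrite -fE horner_map; exact: generated_by_cst.
    pose h : {poly K} := 2%:P + eps%:P * 'X.
    have -> : 1 *+ 2 + eps *: x = horner_alg x h.
      by rewrite /h (rmorphD (horner_alg x)) (rmorphM (horner_alg x)) /= horner_algX !horner_alg_mpolyC mpolyC_nat mul_mpolyC.
    apply: x_transcendental; apply/eqP => /(congr1 (horner^~ 0)).
    by rewrite /h hornerD hornerC hornerM hornerX mulr0 addr0 horner0 => /eqP; rewrite (negPf two0).
  have [g gE] : exists g, iota g = pi x.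
    by have [g gE] := evF 'X; exists g; rewrite gE /= horner_algX.
  have mC (a : K) : exists g, iota g = pi a%:MP.
    by have [g' gE'] := evF a%:P; exists g'; rewrite gE' /= horner_alg_mpolyC.
  (* The theorem makes N s0 + s0^2 + eps s0 x a generator for some N. Completing the square with c =
     N / 2 and s = s0 + c, this is s^2 + eps s x up to the element c^2 + eps c x of K(x), so y
     generates as well. *)
  have [N [_ gen]] := PET (pi (- (s0 ^+ 2 + eps *: (s0 * x)))) (pi s0).
  have [c cE] : exists c : K, c * 2%:R = N%:R by exists (N%:R / 2); rewrite divfK.
  have [e eE] : exists e, iota e = pi (c%:MP ^+ 2 + eps *: (c%:MP * x)).
    have [a aE] := mC c; have [b bE] := mC eps.
    exists (a * a + b * (a * g)); by rewrite -mul_mpolyC expr2 !(rmorphD, rmorphM) /= aE bE gE.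
  exists (s0 + c%:MP); split.
    set y := pi (- _).
    have gs0 : generated_by iota y (pi s0).
      apply: generated_by_trans gen.
      suff -> : pi s0 *+ N - pi (- (s0 ^+ 2 + eps *: (s0 * x))) = iota (- e) - y.
        by apply: generated_by_sub; [apply: generated_by_cst|apply: generated_by_id].
      rewrite [iota _]rmorphN eE /y -rmorphMn -(rmorphB pi) -(rmorphN pi (_ + _)) -(rmorphB pi); congr (pi _).
      have -> : s0 *+ N = (c%:MP * 2%:R) * s0.
        have <- : (c * 2%:R)%:MP = c%:MP * 2%:R :> MP by rewrite mpolyCM mpolyC_nat.
        by rewrite cE mpolyC_nat mulr_natl.
      by rewrite -!mul_mpolyC; ring.
    split; last by move=> i; apply: generated_by_trans gs0 (gen_s0 i).
    rewrite rmorphD; have [a <-] := mC c.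
    rewrite -[iota a]opprK -rmorphN; apply: generated_by_sub => //; exact: generated_by_cst.
  (* If 2 s + eps x vanished, s0 would equal -(eps x + 2 c) / 2, an element of K(x). *)
  move=> /Ppi h; apply: ns0.
  have [a aE] := mC c; have [b bE] := mC eps; have [t tE] := mC (2^-1).
  exists (- t * (b * g + a *+ 2)).
  have h2 : pi 2%:MP * pi (2^-1)%:MP = 1 by rewrite -rmorphM -mpolyCM divff // mpolyC1 rmorph1.
  have h3 : pi 2%:MP = 2%:R by rewrite mpolyC_nat rmorph_nat.
  have aux (u c' ex q : L) : 2%:R * q = 1 -> (u + c' + (u + c')) + ex = 0 -> - q * (ex + c' *+ 2) = u.
    move=> q2 hu; have -> : ex = - (u + c' + (u + c')) by apply/eqP; rewrite -addr_eq0 addrC hu.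
    by transitivity (2%:R * q * u); [ring | rewrite q2 mul1r].
  have -> : iota (- t * (b * g + a *+ 2)) = - pi (2^-1)%:MP * (pi eps%:MP * pi x + pi c%:MP *+ 2).
    by rewrite (rmorphM iota) (rmorphN iota) (rmorphD iota) (rmorphM iota b) (rmorphMn iota) aE bE gE tE.
  apply: aux; first by rewrite -h3 h2.
  by move: h; rewrite -mul_mpolyC (rmorphD pi) (rmorphMn pi) (rmorphD pi s0) (rmorphM pi) mulr2n.
(* [None] stands for s, so that one common denominator D serves s and all the coordinates. *)
pose w (o : option 'I_n) := if o is Some i then pi 'X_i else pi s.
have gen_w o : generated_by iota (pi (- (s ^+ 2 + eps *: (s * x)))) (w o).
  by case: gen_s o => gs gX [i|]; [exact: gX|exact: gs].
have [D [p [D0 pE]]] := clear_denominators iotaE gen_w.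
exists s, D, (p None), (fun i => p (Some i)).
move=> y; have piE o : ev D * w o = pi (p o ^ horner_alg x).[y].
  by rewrite pE -horner_map -map_poly_comp.
split=> //.
- by apply: contraNneq D0 => ->; rewrite rmorph0.
- by move=> i; apply/Ppi; rewrite rmorphB rmorphM -(piE (Some i)) subrr.
- by apply/Ppi; rewrite rmorphB rmorphM -(piE None) subrr.
Qed.
End PlaneModel.

(** * Spaces with functions *)

Section RingSpace.
Variable K : closedFieldType.

Lemma regular_near (X : funSpace K) (x : X) (f : X -> K) :
  regular_at x f -> \forall y \near x, regular_at y f.
Proof. by move=> fx; apply: (regular_at_local fx); apply: nearW. Qed.

Lemma regular_near_eq (X : funSpace K) (x : X) (f g : X -> K) :
  regular_at x f -> (\forall y \near x, f y = g y) -> regular_at x g.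
Proof. by move=> fx fg; apply: nbhs_singleton (regular_at_local fx fg). Qed.

(** The axioms of [funSpace] ask only for locality. These ring properties are established for affine
    and projective spaces, subspaces, products, and finally for varieties through their charts. *)
Record ring_space (X : funSpace K) : Prop := RingSpace {
  regularC : forall (x : X) c, regular_at x (fun=> c);
  regularD : forall (x : X) f g,
    regular_at x f -> regular_at x g -> regular_at x (fun y => f y + g y);
  regularM : forall (x : X) f g,
    regular_at x f -> regular_at x g -> regular_at x (fun y => f y * g y);
  regularV : forall (x : X) f,
    regular_at x f -> f x != 0 -> regular_at x (fun y => (f y)^-1);
  regular_neq0 : forall (x : X) f,
    regular_at x f -> f x != 0 -> \forall y \near x, f y != 0 }.

Section Ops.
Variables (X : funSpace K) (rX : ring_space X) (x : X).

Lemma regularN f : regular_at x f -> regular_at x (fun y => - f y).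
Proof.
move=> fx; have := regularM rX (regularC rX x (-1)) fx.
by move/regular_near_eq; apply; apply: nearW => y; rewrite mulN1r.
Qed.

Lemma regularB f g : regular_at x f -> regular_at x g -> regular_at x (fun y => f y - g y).
Proof. by move=> fx gx; apply: (regularD rX) => //; apply: regularN. Qed.

Lemma regular_div f g : regular_at x f -> regular_at x g -> g x != 0 ->
  regular_at x (fun y => f y / g y).
Proof. by move=> fx gx g0; apply: (regularM rX) => //; apply: (regularV rX). Qed.

Lemma regular_sum (I : Type) (r : seq I) (F : I -> X -> K) :
  (forall i, regular_at x (F i)) -> regular_at x (fun y => \sum_(i <- r) F i y).
Proof.
move=> Fx; elim: r => [|i r IH].
  by apply: regular_near_eq (regularC rX x 0) _; apply: nearW => y; rewrite big_nil.
apply: regular_near_eq (regularD rX (Fx i) IH) _; apply: nearW => y.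
by rewrite big_cons.
Qed.

Lemma regular_prod (I : Type) (r : seq I) (F : I -> X -> K) :
  (forall i, regular_at x (F i)) -> regular_at x (fun y => \prod_(i <- r) F i y).
Proof.
move=> Fx; elim: r => [|i r IH].
  by apply: regular_near_eq (regularC rX x 1) _; apply: nearW => y; rewrite big_nil.
apply: regular_near_eq (regularM rX (Fx i) IH) _; apply: nearW => y.
by rewrite big_cons.
Qed.

Lemma regularX f k : regular_at x f -> regular_at x (fun y => f y ^+ k).
Proof.
move=> fx; elim: k => [|k IH].
  by apply: regular_near_eq (regularC rX x 1) _; apply: nearW.
by apply: regular_near_eq (regularM rX fx IH) _; apply: nearW => y; rewrite exprS.
Qed.

Lemma regular_meval n (p : {mpoly K[n]}) (c : X -> 'rV[K]_n) :
  (forall i, regular_at x (fun y => c y 0 i)) -> regular_at x (fun y => p.@[c y 0]).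
Proof.
move=> cx.
have /regular_near_eq : regular_at x
    (fun y => \sum_(m <- msupp p) p@_m * \prod_(i <- index_enum 'I_n) c y 0 i ^+ m i).
  apply: regular_sum => m; apply: (regularM rX); first exact: regularC.
  by apply: regular_prod => i; apply: regularX.
by apply; apply: nearW => y; rewrite mevalE.
Qed.

Lemma regular_horner (p : {poly K}) f : regular_at x f -> regular_at x (fun y => p.[f y]).
Proof.
move=> fx; elim/poly_ind: p => [|p c IH].
  by apply: regular_near_eq (regularC rX x 0) _; apply: nearW => y; rewrite horner0.
apply: regular_near_eq (regularD rX (regularM rX IH fx) (regularC rX x c)) _.
by apply: nearW => y; rewrite hornerMXaddC.
Qed.

Lemma regular_horner2 (p : {poly {poly K}}) f g : regular_at x f -> regular_at x g ->
  regular_at x (fun y => p.[(g y)%:P].[f y]).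
Proof.
move=> fx gx; elim/poly_ind: p => [|p c IH].
  by apply: regular_near_eq (regularC rX x 0) _; apply: nearW => y; rewrite !horner0.
apply: regular_near_eq (regularD rX (regularM rX IH gx) (regular_horner c fx)) _.
by apply: nearW => y; rewrite hornerMXaddC hornerD hornerM hornerC.
Qed.

End Ops.

Section GeneratedRing.
Variables (T : choiceType) (F : set (set T * (T -> K))).

Definition closed_under_op (op : K -> K -> K) := forall D h D' h', F (D, h) -> F (D', h') ->
  exists2 h'', F (D `&` D', h'') & forall x, D x -> D' x -> h'' x = op (h x) (h' x).

(** These closure properties make the sets D a basis of the generated topology instead of a
    subbasis, so that neighbourhoods and regular functions are each described by a single pair (D,
    h). *)
Record fraction_family : Prop := FractionFamily {
  fractionC : forall c, F (setT, fun=> c);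
  fractionD : closed_under_op +%R;
  fractionM : closed_under_op *%R;
  fractionV : forall D h, F (D, h) -> exists2 h', F (D `&` [set x | h x != 0], h') &
    forall x, D x -> h x != 0 -> h' x = (h x)^-1 }.

Hypothesis FF : fraction_family.

Lemma open_generated D h : F (D, h) -> open (D : set (generated F)).
Proof.
move=> FD; exists [set D : set T]; last by rewrite bigcup_set1.
move=> _ ->; exists (finmap.fset1 (D : set T)).
  by move=> D'; rewrite finmap.inE => /eqP ->; apply/mem_set; exists (D, h).
by apply/seteqP; split=> [x /(_ D)|x Dx D' /=]; rewrite /= finmap.inE ?eqxx; [apply|move/eqP->].
Qed.

Lemma nbhs_generatedP (x : generated F) (O : set (generated F)) :
  nbhs x O <-> exists D h, [/\ F (D, h), D x & D `<=` O].
Proof.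
split; last first.
  by move=> [D [h [FD Dx DO]]]; apply: filterS DO _; apply: open_nbhs_nbhs; split=> //; apply: open_generated FD.
rewrite nbhsE => -[U [[B BF <-] [V BV Vx]] UO].
have [G GF GV] := BF V BV.
suff [D [h [FD Dx DV]]] : exists D h, [/\ F (D, h), D x & D `<=` V].
  by exists D, h; split=> // y /DV Vy; apply: UO; exists V.
rewrite -GV in Vx *.
have {GV BV BF UO} : forall s : seq (set T), (forall D, D \in s -> [set Dh.1 | Dh in F] D /\ D x) ->
   exists D h, [/\ F (D, h), D x & forall y, D y -> forall D', D' \in s -> D' y].
  elim=> [_|D s IH hs]; first by exists setT, (fun=> 0); split=> //; apply: fractionC.
  have [|D' [h' [FD' D'x D's]]] := IH; first by move=> E Es; apply: hs; rewrite inE Es orbT.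
  have [[[D0 h] FD /= e] Dx] := hs D (mem_head _ _); rewrite {}e in FD.
  have [h'' Fh _] := fractionD FF FD FD'.
  exists (D `&` D'), h''; split=> // y [Dy D'y] E; rewrite inE => /orP[/eqP->//|].
  exact: D's.
move=> /(_ (finmap.enum_fset G))[].
  by move=> D DG; split; [apply/set_mem; exact: GF | exact: Vx].
by move=> D [h [FD Dx DG]]; exists D, h; split=> // y Dy E EG; apply: DG.
Qed.

Lemma regular_generatedP (x : generated_space F) (f : generated_space F -> K) :
  regular_at x f <-> exists D h, [/\ F (D, h), D x & forall y, D y -> f y = h y].
Proof.
split.
  move=> [[D h] FD /nbhs_generatedP[D' [h' [FD' D'x sD]]]].
  have [k Fk k0] := fractionM FF FD' (fractionC FF 0).
  have [h'' Fh hE] := fractionD FF FD Fk.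
  exists (D `&` (D' `&` setT)), h''; split=> //; first by have [] := sD _ D'x.
  by move=> y [Dy [D'y _]]; have [_ ->] := sD _ D'y; rewrite hE // k0 // mulr0 addr0.
move=> [D [h [FD Dx fh]]]; exists (D, h) => //.
by apply/nbhs_generatedP; exists D, h; split=> // y Dy; split=> //; apply: fh.
Qed.

Lemma generated_ring_space : ring_space (generated_space F).
Proof.
split.
- by move=> x c; apply/regular_generatedP; exists setT, (fun=> c); split=> //; apply: fractionC.
- move=> x f g /regular_generatedP[D [h [FD Dx fh]]] /regular_generatedP[D' [h' [FD' D'x gh]]].
  have [h'' Fh hE] := fractionD FF FD FD'.
  apply/regular_generatedP; exists (D `&` D'), h''; split=> // y [Dy D'y].
  by rewrite hE // fh // gh.
- move=> x f g /regular_generatedP[D [h [FD Dx fh]]] /regular_generatedP[D' [h' [FD' D'x gh]]].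
  have [h'' Fh hE] := fractionM FF FD FD'.
  apply/regular_generatedP; exists (D `&` D'), h''; split=> // y [Dy D'y].
  by rewrite hE // fh // gh.
- move=> x f /regular_generatedP[D [h [FD Dx fh]]] fx0.
  have [h' Fh hE] := fractionV FF FD.
  apply/regular_generatedP; exists (D `&` [set x | h x != 0]), h'; split=> //.
    by split=> //=; rewrite -fh.
  by move=> y [Dy hy]; rewrite hE // fh.
- move=> x f /regular_generatedP[D [h [FD Dx fh]]] fx0.
  have [h' Fh hE] := fractionV FF FD.
  apply/nbhs_generatedP; exists (D `&` [set x | h x != 0]), h'; split=> //.
    by split=> //=; rewrite -fh.
  by move=> y [Dy hy] /=; rewrite fh.
Qed.

Lemma morphism_generated (X : funSpace K) (f : X -> generated_space F) (x : X) :
  (forall D h, F (D, h) -> D (f x) -> (\forall y \near x, D (f y)) /\ regular_at x (h \o f)) ->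
  morphism_at f x.
Proof.
move=> hf; have cf : {for x, continuous f}.
  move=> O /nbhs_generatedP[D [h [FD Dx DO]]].
  by have [nD _] := hf _ _ FD Dx; apply: filterS nD => y; apply: DO.
split=> // g /regular_generatedP[D [h [FD Dx gh]]].
have [nD hr] := hf _ _ FD Dx.
by apply: regular_near_eq hr _; apply: filterS nD => y Dy; rewrite /= gh.
Qed.

Lemma regular_fraction (x : generated_space F) D h : F (D, h) -> D x ->
  @regular_at K (generated_space F) x h.
Proof. by move=> FD Dx; apply/regular_generatedP; exists D, h. Qed.

End GeneratedRing.

Section AffineRing.
Variable n : nat.

Lemma affine_fraction_family : fraction_family (@affine_fractions K n).
Proof.
split.
- move=> c; exists c%:MP, 1; congr pair; last by apply/funext => x; rewrite mevalC meval1 divr1.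
  by apply/seteqP; split=> // x _; rewrite /= meval1 oner_neq0.
- move=> _ _ _ _ [p [q [-> ->]]] [p' [q' [-> ->]]].
  exists (fun x : 'rV[K]_n => (p * q' + p' * q).@[x 0] / (q * q').@[x 0]).
    exists (p * q' + p' * q), (q * q'); congr pair.
    by apply/seteqP; split=> x /=; rewrite mevalM mulf_eq0 negb_or => /andP.
  by move=> x /= qx q'x; rewrite mevalD !mevalM; field; rewrite qx q'x.
- move=> _ _ _ _ [p [q [-> ->]]] [p' [q' [-> ->]]].
  exists (fun x : 'rV[K]_n => (p * p').@[x 0] / (q * q').@[x 0]).
    exists (p * p'), (q * q'); congr pair.
    by apply/seteqP; split=> x /=; rewrite mevalM mulf_eq0 negb_or => /andP.
  by move=> x /= qx q'x; rewrite !mevalM; field; rewrite qx q'x.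
- move=> _ _ [p [q [-> ->]]].
  exists (fun x : 'rV[K]_n => (q * q).@[x 0] / (p * q).@[x 0]).
    exists (q * q), (p * q); congr pair; apply/seteqP; split=> x /=.
      by move=> [qx]; rewrite mevalM !mulf_eq0 invr_eq0 (negPf qx) orbF => /negPf ->.
    by rewrite mevalM !mulf_eq0 invr_eq0 negb_or => /andP[/negPf-> /[dup] /negPf->].
  move=> x /= qx; rewrite mulf_eq0 invr_eq0 (negPf qx) orbF => px.
  by rewrite !mevalM; field; rewrite qx px.
Qed.

Definition affine_ring_space := generated_ring_space affine_fraction_family.

Lemma morphism_affine (X : funSpace K) (rX : ring_space X) (c : X -> 'rV[K]_n) (x : X) :
  (forall i, regular_at x (fun y => c y 0 i)) -> morphism_at (c : X -> affine_space K n) x.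
Proof.
move=> cx; apply: (morphism_generated affine_fraction_family) => _ _ [p [q [-> ->]]] /= qx.
have rq := regular_meval rX q cx; split; first exact: (regular_neq0 rX rq).
exact: (regular_div rX (regular_meval rX p cx)).
Qed.

Lemma regular_affine_coord (x : affine_space K n) i :
  @regular_at K (affine_space K n) x (fun y : 'rV[K]_n => y 0 i).
Proof.
have := @regular_fraction _ _ affine_fraction_family x setT (fun y : 'rV[K]_n => ('X_i : {mpoly K[n]}).@[y 0] / 1.@[y 0]).
have -> : (fun y : 'rV[K]_n => ('X_i : {mpoly K[n]}).@[y 0] / 1.@[y 0]) = (fun y : 'rV[K]_n => y 0 i).
  by apply/funext => y; rewrite mevalXU meval1 divr1.
apply=> //; exists 'X_i, 1; congr pair.
  by apply/seteqP; split=> // y _; rewrite /= meval1 oner_neq0.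
by apply/funext => y; rewrite mevalXU meval1 divr1.
Qed.

End AffineRing.

Section SubRing.
Variables (X : funSpace K) (A : set X).

Lemma continuous_val : continuous (set_val : sub_space A -> X).
Proof. exact: initial_continuous. Qed.

Lemma morphism_val (x : sub_space A) : morphism_at (set_val : sub_space A -> X) x.
Proof.
split; first exact: continuous_val.
move=> g gx; exists g; first exact: gx.
exact: filterE.
Qed.

Lemma nbhs_subP (x : sub_space A) (O : set (sub_space A)) :
  nbhs x O <-> exists U : set X, nbhs (set_val x) U /\ (forall y : sub_space A, U (set_val y) -> O y).
Proof.
split; last first.
  move=> [U [nU UO]]; apply: filterS UO _; exact: continuous_val nU.
rewrite nbhsE => -[V [[W oW <-] Wx] VO].
exists W; split; first exact: open_nbhs_nbhs.
by move=> y Wy; apply: VO.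
Qed.

Lemma sub_ring_space : ring_space X -> ring_space (sub_space A).
Proof.
move=> rX; split.
- by move=> x c; exists (fun=> c); [exact: regularC | exact: filterE].
- move=> x f g [f' f'x ff'] [g' g'x gg'].
  exists (fun y => f' y + g' y); first exact: (regularD rX).
  by apply: filterS2 ff' gg' => y -> ->.
- move=> x f g [f' f'x ff'] [g' g'x gg'].
  exists (fun y => f' y * g' y); first exact: (regularM rX).
  by apply: filterS2 ff' gg' => y -> ->.
- move=> x f [f' f'x ff'] fx0; exists (fun y => (f' y)^-1).
    by apply: (regularV rX) => //; rewrite -(nbhs_singleton ff').
  by apply: filterS ff' => y ->.
- move=> x f [f' f'x ff'] fx0.
  have f'0 : f' (set_val x) != 0 by rewrite -(nbhs_singleton ff').
  by apply: filterS2 ff' (continuous_val (regular_neq0 rX f'x f'0)) => y ->.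
Qed.

Lemma morphism_sub (Z : funSpace K) (f : Z -> sub_space A) (z : Z) :
  morphism_at (set_val \o f : Z -> X) z -> morphism_at f z.
Proof.
move=> [cf rf]; have cf' : {for z, continuous f}.
  move=> O /nbhs_subP[U [nU UO]].
  change (nbhs z (f @^-1` O)).
  by apply: filterS (cf U nU : nbhs z ((set_val \o f) @^-1` U)) => y /= Uy; apply: UO.
split=> // g [G Gx gG].
have h : \forall y \near z, g (f y) = G (set_val (f y)) := cf' _ gG.
by apply: regular_near_eq (rf G Gx) _; apply: filterS h => y /= ->.
Qed.

End SubRing.

Lemma morphism_comp (X Y Z : funSpace K) (f : X -> Y) (g : Y -> Z) x :
  morphism_at f x -> morphism_at g (f x) -> morphism_at (g \o f) x.
Proof.
move=> [cf rf] [cg rg]; split; first exact: continuous_comp.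
by move=> h hx; apply: (rf _ (rg _ hx)).
Qed.

Lemma morphism_near_eq (X Y : funSpace K) (f g : X -> Y) x :
  morphism_at f x -> (\forall y \near x, f y = g y) -> morphism_at g x.
Proof.
move=> [cf rf] fg; have fgx := nbhs_singleton fg; split.
  move=> O; rewrite -fgx => /cf nO.
  by apply: filterS2 fg nO => y /= ->.
move=> h; rewrite -fgx => /rf hf.
by apply: regular_near_eq hf _; apply: filterS fg => y /= ->.
Qed.

Lemma regular_open_sub (X : funSpace K) (U : set X) (x : sub_space U) (f : X -> K) :
  open U -> regular_at x (f \o set_val : sub_space U -> K) -> regular_at (set_val x) f.
Proof.
move=> oU [g gx /nbhs_subP[W [nW fg]]].
apply: regular_near_eq gx _.
have nU : nbhs (set_val x) U by apply: open_nbhs_nbhs; split=> //; exact: set_valP.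
apply: filterS2 nW nU => y Wy Uy.
by rewrite -(fg (exist _ y (mem_set Uy)) Wy).
Qed.

Lemma ring_space_local (X : funSpace K) :
  (forall x, exists2 U : set X, open U /\ U x & ring_space (sub_space U)) -> ring_space X.
Proof.
move=> loc; split.
- move=> x c; have [U [oU Ux] rU] := loc x.
  apply: (@regular_open_sub _ U (exist _ x (mem_set Ux))) => //; exact: (regularC rU).
- move=> x f g fx gx; have [U [oU Ux] rU] := loc x.
  pose x' : sub_space U := exist _ x (mem_set Ux).
  apply: (@regular_open_sub _ U x') => //.
  by apply: (regularD rU (f := f \o set_val) (g := g \o set_val)); apply: (morphism_val x').2.
- move=> x f g fx gx; have [U [oU Ux] rU] := loc x.
  pose x' : sub_space U := exist _ x (mem_set Ux).
  apply: (@regular_open_sub _ U x') => //.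
  by apply: (regularM rU (f := f \o set_val) (g := g \o set_val)); apply: (morphism_val x').2.
- move=> x f fx f0; have [U [oU Ux] rU] := loc x.
  pose x' : sub_space U := exist _ x (mem_set Ux).
  apply: (@regular_open_sub _ U x') => //.
  by apply: (regularV rU (f := f \o set_val)) => //; apply: (morphism_val x').2.
- move=> x f fx f0; have [U [oU Ux] rU] := loc x.
  pose x' : sub_space U := exist _ x (mem_set Ux).
  have /nbhs_subP[W [nW Wf]] := regular_neq0 rU (x := x') ((morphism_val x').2 _ fx) f0.
  have nU : nbhs x U by apply: open_nbhs_nbhs; split.
  by apply: filterS2 nW nU => y Wy Uy; apply: (Wf (exist _ y (mem_set Uy))).
Qed.

Lemma ring_space_iso (X Y : funSpace K) : isomorphic X Y -> ring_space Y -> ring_space X.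
Proof.
move=> [f [g [mf mg fg gf]]] rY.
have pull x (h : X -> K) : regular_at x h -> regular_at (f x) (h \o g).
  by move=> hx; apply: (mg (f x)).2; rewrite fg.
have push x (h : X -> K) : regular_at (f x) (h \o g) -> regular_at x h.
  move=> /(mf x).2 /regular_near_eq; apply; apply: nearW => y /=; by rewrite fg.
split.
- by move=> x c; apply: push; apply: (regularC rY).
- move=> x h k /pull hx /pull kx; apply: push; exact: (regularD rY hx kx).
- move=> x h k /pull hx /pull kx; apply: push; exact: (regularM rY hx kx).
- move=> x h /pull hx h0; apply: push; apply: (regularV rY hx); by rewrite /= fg.
- move=> x h /pull hx h0; have h0' : (h \o g) (f x) != 0 by rewrite /= fg.
  apply: filterS ((mf x).1 _ (regular_neq0 rY hx h0') : nbhs x (f @^-1` [set y | (h \o g) y != 0])).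
  by move=> y /=; rewrite fg.
Qed.

Lemma variety_ring_space (X : funSpace K) : is_variety X -> ring_space X.
Proof.
move=> [[m [U [hU cov]]] _]; apply: ring_space_local => x.
have [i Ux] := cov x; have [oU [n [A [_ iso]]]] := hU i.
exists (U i) => //; apply: ring_space_iso iso _; apply: sub_ring_space; exact: affine_ring_space.
Qed.

End RingSpace.

(** * Projective spaces and products *)

Section Proj.
Variables (K : closedFieldType) (n : nat).
Implicit Types (v : 'rV[K]_n.+1) (x : proj_point K n).

Definition hvec (x : proj_point K n) : 'rV[K]_n.+1 := vpick (val x).

Lemma hcoordE x : hcoord x = hvec x 0. Proof. by []. Qed.

Lemma hvec_neq0 x : hvec x != 0.
Proof. by rewrite vpick0 -dimv_eq0; case: x => L /= /eqP ->. Qed.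

Lemma vline_proj_point v : v != 0 -> \dim <[v]>%VS == 1%N.
Proof. by rewrite dim_vline => ->. Qed.

Lemma delta0_neq0 : delta_mx 0 0 != 0 :> 'rV[K]_n.+1.
Proof. by apply/eqP => /rowP/(_ 0)/eqP; rewrite !mxE !eqxx oner_eq0. Qed.

(** The default of [insubd] is reached only at v = 0. *)
Definition pt v : proj_point K n :=
  insubd (exist _ <[(delta_mx 0 0 : 'rV[K]_n.+1)%R]>%VS (vline_proj_point delta0_neq0)) <[v]>%VS.

Lemma val_pt v : v != 0 -> val (pt v) = <[v]>%VS.
Proof. by move=> v0; rewrite /pt val_insubd vline_proj_point. Qed.

Lemma hvec_pt v : v != 0 -> exists2 a, a != 0 & hvec (pt v) = a *: v.
Proof.
move=> v0; have : hvec (pt v) \in <[v]>%VS by rewrite /hvec val_pt // memv_pick.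
case/vlineP => a e; exists a => //; apply: contraNneq (hvec_neq0 (pt v)) => a0.
by rewrite e a0 scale0r.
Qed.

Lemma pt_hvec x : pt (hvec x) = x.
Proof.
apply: val_inj; rewrite val_pt ?hvec_neq0 //; apply/eqP.
rewrite eqEdim -memvE memv_pick dim_vline hvec_neq0.
by case: x => L /= /eqP ->.
Qed.

Lemma pt_scale a v : a != 0 -> pt (a *: v) = pt v.
Proof.
move=> a0; have [->|v0] := eqVneq v 0; first by rewrite scaler0.
have av0 : a *: v != 0 by rewrite scaler_eq0 negb_or a0.
apply: val_inj; rewrite !val_pt //; apply/eqP.
rewrite eqEdim -memvE memvZ ?memv_line //= !dim_vline av0 v0 //.
Qed.

Lemma meval_homog d (p : {mpoly K[n.+1]}) a v : p \is d.-homog ->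
  p.@[(a *: v) 0] = a ^+ d * p.@[v 0].
Proof.
move=> /dhomogP hp; rewrite !mevalE mulr_sumr; apply: eq_big_seq => m /hp md.
have {md} <- : mdeg m = d := md.
rewrite mulrCA; congr (_ * _); rewrite mdegE -prodrXr -big_split /=.
by apply: eq_bigr => i _; rewrite mxE exprMn.
Qed.

Lemma meval_pt d (p : {mpoly K[n.+1]}) v : p \is d.-homog -> v != 0 ->
  (p.@[hcoord (pt v)] == 0) = (p.@[v 0] == 0).
Proof.
move=> hp v0; have [a a0 e] := hvec_pt v0.
by rewrite hcoordE e (meval_homog _ _ hp) mulf_eq0 expf_eq0 (negPf a0) andbF.
Qed.

Lemma proj_fraction_family : fraction_family (@proj_fractions K n).
Proof.
split.
- move=> c; exists 0%N, c%:MP, 1; split; [by rewrite -[c%:MP]mulr1 mul_mpolyC dhomogZ ?dhomog1 | by rewrite dhomog1 |].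
  congr pair; last by apply/funext => x; rewrite mevalC meval1 divr1.
  by apply/seteqP; split=> // x _; rewrite /= meval1 oner_neq0.
- move=> _ _ _ _ [d [p [q [hp hq [-> ->]]]]] [d' [p' [q' [hp' hq' [-> ->]]]]].
  exists (fun x : proj_point K n => (p * q' + p' * q).@[hcoord x] / (q * q').@[hcoord x]).
    exists (d + d')%N, (p * q' + p' * q), (q * q').
    split; [apply: dhomogD; [exact: dhomogM | by rewrite addnC; exact: dhomogM] | exact: dhomogM |].
    congr pair.
    by apply/seteqP; split=> x /=; rewrite mevalM mulf_eq0 negb_or => /andP.
  by move=> x /= qx q'x; rewrite mevalD !mevalM; field; rewrite qx q'x.
- move=> _ _ _ _ [d [p [q [hp hq [-> ->]]]]] [d' [p' [q' [hp' hq' [-> ->]]]]].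
  exists (fun x : proj_point K n => (p * p').@[hcoord x] / (q * q').@[hcoord x]).
    exists (d + d')%N, (p * p'), (q * q'); split; try exact: dhomogM.
    congr pair.
    by apply/seteqP; split=> x /=; rewrite mevalM mulf_eq0 negb_or => /andP.
  by move=> x /= qx q'x; rewrite !mevalM; field; rewrite qx q'x.
- move=> _ _ [d [p [q [hp hq [-> ->]]]]].
  exists (fun x : proj_point K n => (q * q).@[hcoord x] / (p * q).@[hcoord x]).
    exists (d + d)%N, (q * q), (p * q); split; try exact: dhomogM.
    congr pair; apply/seteqP; split=> x /=.
      by move=> [qx]; rewrite mevalM !mulf_eq0 invr_eq0 (negPf qx) orbF => /negPf ->.
    by rewrite mevalM !mulf_eq0 invr_eq0 negb_or => /andP[/negPf-> /[dup] /negPf->].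
  move=> x /= qx; rewrite mulf_eq0 invr_eq0 (negPf qx) orbF => px.
  by rewrite !mevalM; field; rewrite qx px.
Qed.

Definition proj_ring_space := generated_ring_space proj_fraction_family.

Lemma morphism_proj (X : funSpace K) (rX : ring_space X) (c : X -> 'rV[K]_n.+1) (x : X) :
  (forall i, regular_at x (fun y => c y 0 i)) -> c x != 0 ->
  morphism_at (pt \o c : X -> projective_space K n) x.
Proof.
move=> cx c0; have nc0 : \forall y \near x, c y != 0.
  have /rV0Pn[i ci] := c0; apply: filterS (regular_neq0 rX (cx i) ci) => y.
  by apply: contraNneq => ->; rewrite mxE.
apply: (morphism_generated proj_fraction_family) => _ _ [d [p [q [hp hq [-> ->]]]]] /= qx.
have rq := regular_meval rX q cx; have rp := regular_meval rX p cx.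
have q0 : q.@[c x 0] != 0 by rewrite -(meval_pt hq).
have nq0 := regular_neq0 rX rq q0; split.
  by apply: filterS2 nc0 nq0 => y cy0; rewrite (meval_pt hq).
apply: regular_near_eq (regular_div rX rp rq q0) _.
apply: filterS2 nc0 nq0 => y cy0 qy0 /=; have [a a0 e] := hvec_pt cy0.
by rewrite hcoordE e !(meval_homog _ _ hp, meval_homog _ _ hq) -mulf_div divff ?mul1r // expf_neq0.
Qed.

Lemma regular_proj_fraction (x : projective_space K n) d (p q : {mpoly K[n.+1]}) :
  p \is d.-homog -> q \is d.-homog -> q.@[hcoord x] != 0 ->
  @regular_at K (projective_space K n) x (fun y => p.@[hcoord y] / q.@[hcoord y]).
Proof.
by move=> hp hq qx; apply: (regular_fraction proj_fraction_family) qx; exists d, p, q.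
Qed.

Lemma nbhs_projP (x : projective_space K n) (O : set (projective_space K n)) :
  nbhs x O <-> exists d q, [/\ q \is d.-homog, q.@[hcoord x] != 0 &
    forall y : projective_space K n, q.@[hcoord y] != 0 -> O y].
Proof.
split=> [/(nbhs_generatedP proj_fraction_family)[D [h [[d [p [q [hp hq [eD _]]]]] Dx DO]]]|].
  by exists d, q; split=> // [|y qy]; [move: Dx; rewrite eD | apply: DO; rewrite eD].
move=> [d [q [hq qx qO]]]; apply/(nbhs_generatedP proj_fraction_family).
exists [set y : proj_point K n | q.@[hcoord y] != 0], (fun y => q.@[hcoord y] / q.@[hcoord y]).
by split=> //; exists d, q, q.
Qed.

End Proj.

Section Prod.
Variables (K : closedFieldType) (X Y : funSpace K).

Lemma tensor_fin (I : finType) (U : set X) (V : set Y) (f : I -> X -> K) (g : I -> Y -> K) :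
  (forall i, regular_on U (f i)) -> (forall i, regular_on V (g i)) ->
  tensor_on U V (fun z => \sum_i f i z.1 * g i z.2).
Proof.
move=> rf rg; exists #|I|, (fun i => f (enum_val i)), (fun i => g (enum_val i)).
split=> //; apply/funext => z; rewrite (reindex enum_rank) /=.
  by apply: eq_bigr => i _; rewrite enum_rankK.
by exists enum_val => i _; rewrite ?enum_valK ?enum_rankK.
Qed.

Lemma tensor_sub (U U' : set X) (V V' : set Y) t : U' `<=` U -> V' `<=` V ->
  tensor_on U V t -> tensor_on U' V' t.
Proof.
move=> sU sV [m [f [g [rf rg ->]]]]; exists m, f, g; split=> // i x.
  by move/sU; apply: rf.
by move/sV; apply: rg.
Qed.

Lemma tensorD U V s t : tensor_on U V s -> tensor_on U V t ->
  tensor_on U V (fun z : X * Y => s z + t z).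
Proof.
move=> [m [f [g [rf rg ->]]]] [m' [f' [g' [rf' rg' ->]]]].
pose F (i : 'I_m + 'I_m') := match i with inl i => f i | inr i => f' i end.
pose G (i : 'I_m + 'I_m') := match i with inl i => g i | inr i => g' i end.
rewrite (_ : (fun z => _) = (fun z : X * Y => \sum_i F i z.1 * G i z.2)).
  by apply: tensor_fin => -[].
by apply/funext => z; rewrite big_sumType.
Qed.

Lemma tensor_cst U V c : ring_space X -> ring_space Y -> tensor_on U V (fun _ : X * Y => c).
Proof.
move=> rX rY; exists 1%N, (fun _ _ => c), (fun _ _ => 1); split.
- by move=> _ x _; apply: regularC.
- by move=> _ x _; apply: regularC.
by apply/funext => z; rewrite big_ord1 mulr1.
Qed.

Lemma tensorM U V s t : ring_space X -> ring_space Y ->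
  tensor_on U V s -> tensor_on U V t -> tensor_on U V (fun z : X * Y => s z * t z).
Proof.
move=> rX rY [m [f [g [rf rg ->]]]] [m' [f' [g' [rf' rg' ->]]]].
pose F (i : 'I_m * 'I_m') x := f i.1 x * f' i.2 x.
pose G (i : 'I_m * 'I_m') x := g i.1 x * g' i.2 x.
rewrite (_ : (fun z => _) = (fun z : X * Y => \sum_i F i z.1 * G i z.2)).
  apply: tensor_fin => -[i j] x Ux; first by apply: (regularM rX); [apply: rf|apply: rf'].
  by apply: (regularM rY); [apply: rg|apply: rg'].
apply/funext => z; rewrite big_distrlr /= pair_big /=.
by apply: eq_bigr => -[i j] _; rewrite /F /G /=; ring.
Qed.

Hypotheses (rX : ring_space X) (rY : ring_space Y).

Lemma prod_fraction_op (op : K -> K -> K) (num : (X * Y -> K) -> (X * Y -> K) -> (X * Y -> K) -> (X * Y -> K) -> X * Y -> K) :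
  (forall U V s t s' t', tensor_on U V s -> tensor_on U V t -> tensor_on U V s' ->
     tensor_on U V t' -> tensor_on U V (num s t s' t')) ->
  (forall s t s' t' z, t z != 0 -> t' z != 0 ->
     num s t s' t' z / (t z * t' z) = op (s z / t z) (s' z / t' z)) ->
  closed_under_op (@prod_fractions K X Y) op.
Proof.
move=> hT hE _ _ _ _ [U [V [s [t [oU oV sT tT [-> ->]]]]]] [U' [V' [s' [t' [oU' oV' sT' tT' [-> ->]]]]]].
exists (fun z => num s t s' t' z / (t z * t' z)); last first.
  by move=> z /= [_ tz] [_ t'z]; exact: hE.
exists (U `&` U'), (V `&` V'), (num s t s' t'), (fun z => t z * t' z).
have sub (W : set X) (W' : set Y) r : tensor_on W W' r -> forall U2 V2, tensor_on (W `&` U2) (W' `&` V2) r.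
  by move=> h U2 V2; apply: tensor_sub h; exact: subIsetl.
have sub' (W : set X) (W' : set Y) r : tensor_on W W' r -> forall U2 V2, tensor_on (U2 `&` W) (V2 `&` W') r.
  by move=> h U2 V2; apply: tensor_sub h; exact: subIsetr.
split; try exact: openI.
- by apply: hT; [exact: sub|exact: sub|exact: sub'|exact: sub'].
- by apply: tensorM => //; [exact: sub|exact: sub'].
congr pair; apply/seteqP; split=> -[x y] /=; rewrite mulf_eq0 negb_or.
  by move=> [[[Ux Vy] tz] [[U'x V'y] t'z]]; rewrite tz t'z.
by move=> [[[Ux U'x] [Vy V'y]] /andP[tz t'z]].
Qed.

Lemma prod_fraction_family : fraction_family (@prod_fractions K X Y).
Proof.
split.
- move=> c; exists setT, setT, (fun=> c), (fun=> 1).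
  split; try exact: openT; try exact: tensor_cst.
  congr pair; last by apply/funext => z; rewrite divr1.
  by apply/seteqP; split=> // z _; split=> //=; rewrite oner_neq0.
- apply: (prod_fraction_op (num := fun s t s' t' z => s z * t' z + s' z * t z)).
    by move=> U V s t s' t' hs ht hs' ht'; apply: tensorD; apply: tensorM.
  by move=> s t s' t' z tz t'z; field; rewrite tz t'z.
- apply: (prod_fraction_op (num := fun s t s' t' z => s z * s' z)).
    by move=> U V s t s' t' hs ht hs' ht'; apply: tensorM.
  by move=> s t s' t' z tz t'z; field; rewrite tz t'z.
move=> _ _ [U [V [s [t [oU oV sT tT [-> ->]]]]]].
exists (fun z => (t z * t z) / (s z * t z)); last first.
  move=> z /= [_ tz]; rewrite mulf_eq0 invr_eq0 (negPf tz) orbF => sz.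
  by field; rewrite tz sz.
exists U, V, (fun z => t z * t z), (fun z => s z * t z); split=> //; try exact: tensorM.
congr pair; apply/seteqP; split=> z /=; rewrite !mulf_eq0 invr_eq0 !negb_or.
  by move=> [[UV tz] /andP[sz _]]; rewrite sz tz.
by move=> [UV /andP[sz tz]]; rewrite sz tz.
Qed.

Definition prod_ring_space := generated_ring_space prod_fraction_family.

Lemma morphism_fst (z : prod_space X Y) : morphism_at (fst : prod_space X Y -> X) z.
Proof.
have open1 (U : set X) : open U -> U z.1 -> nbhs (z : prod_space X Y) [set w | U w.1].
  move=> oU Uz; apply/(nbhs_generatedP prod_fraction_family).
  exists ((U `*` setT) `&` [set w | (1 : K) != 0]), (fun=> 1 / 1); split.
  - exists U, setT, (fun=> 1), (fun=> 1); split=> //; try exact: tensor_cst.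
    exact: openT.
  - by split=> //; exact: oner_neq0.
  - by move=> w [[]].
split.
  move=> O; rewrite nbhsE => -[U [oU Uz] UO].
  by apply: filterS (open1 U oU Uz) => w /= Uw; apply: UO.
move=> g gz; have : nbhs z.1 [set y | regular_at y g] := regular_near gz.
rewrite nbhsE => -[U [oU Uz] Ug].
apply/(regular_generatedP prod_fraction_family).
exists ((U `*` setT) `&` [set w | (1 : K) != 0]), (fun w => g w.1 / 1); split.
- exists U, setT, (fun w => g w.1), (fun=> 1); split=> //; try exact: tensor_cst.
    exact: openT.
  exists 1%N, (fun _ => g), (fun _ _ => 1); split.
  + by move=> _ x /Ug.
  + by move=> _ x _; apply: regularC.
  by apply/funext => w; rewrite big_ord1 mulr1.
- by split=> //; exact: oner_neq0.
- by move=> w _ /=; rewrite divr1.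
Qed.

Lemma morphism_snd (z : prod_space X Y) : morphism_at (snd : prod_space X Y -> Y) z.
Proof.
have open1 (U : set Y) : open U -> U z.2 -> nbhs (z : prod_space X Y) [set w | U w.2].
  move=> oU Uz; apply/(nbhs_generatedP prod_fraction_family).
  exists ((setT `*` U) `&` [set w | (1 : K) != 0]), (fun=> 1 / 1); split.
  - exists setT, U, (fun=> 1), (fun=> 1); split=> //; try exact: tensor_cst.
    exact: openT.
  - by split=> //; exact: oner_neq0.
  - by move=> w [[]].
split.
  move=> O; rewrite nbhsE => -[U [oU Uz] UO].
  by apply: filterS (open1 U oU Uz) => w /= Uw; apply: UO.
move=> g gz; have : nbhs z.2 [set y | regular_at y g] := regular_near gz.
rewrite nbhsE => -[U [oU Uz] Ug].
apply/(regular_generatedP prod_fraction_family).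
exists ((setT `*` U) `&` [set w | (1 : K) != 0]), (fun w => g w.2 / 1); split.
- exists setT, U, (fun w => g w.2), (fun=> 1); split=> //; try exact: tensor_cst.
    exact: openT.
  exists 1%N, (fun _ _ => 1), (fun _ => g); split.
  + by move=> _ x _; apply: regularC.
  + by move=> _ x /Ug.
  by apply/funext => w; rewrite big_ord1 mul1r.
- by split=> //; exact: oner_neq0.
- by move=> w _ /=; rewrite divr1.
Qed.

Lemma morphism_pair (Z : funSpace K) (rZ : ring_space Z) (f : Z -> X) (g : Z -> Y) (z : Z) :
  morphism_at f z -> morphism_at g z ->
  morphism_at ((fun w => (f w, g w)) : Z -> prod_space X Y) z.
Proof.
move=> [cf rf] [cg rg]; apply: (morphism_generated prod_fraction_family).
move=> _ _ [U [V [s [t [oU oV sT tT [-> ->]]]]]] /= [[/= Uf Vg] tz].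
have reg r : tensor_on U V r -> regular_at z (fun w => r (f w, g w)).
  move=> [m [a [b [ra rb ->]]]]; apply: (regular_sum rZ) => i.
  by apply: (regularM rZ); [apply: rf; apply: ra | apply: rg; apply: rb].
split; last exact: (regular_div rZ (reg _ sT) (reg _ tT)).
have nU : \forall w \near z, U (f w) := cf _ (open_nbhs_nbhs (conj oU Uf)).
have nV : \forall w \near z, V (g w) := cg _ (open_nbhs_nbhs (conj oV Vg)).
have nt : \forall w \near z, t (f w, g w) != 0 := regular_neq0 rZ (reg _ tT) tz.
by apply: filterS3 nU nV nt.
Qed.

End Prod.

(** * Irreducible sets *)

Section Irreducible.
Variables (T : topologicalType).
Implicit Types (A U V : set T).

Lemma irreducible_openP A : irreducible_set A <->
  A !=set0 /\ forall U V, open U -> open V -> A `&` U !=set0 -> A `&` V !=set0 ->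
    A `&` U `&` V !=set0.
Proof.
split=> -[A0 h]; split=> //.
  move=> U V oU oV [x [Ax Ux]] [y [Ay Vy]]; apply/set0P/negP => /eqP e.
  have [||] := h (~` U) (~` V) (open_closedC oU) (open_closedC oV).
  - move=> z Az; have [Uz|nUz] := pselect (U z); last by left.
    by right=> Vz; have : (A `&` U `&` V) z by []; rewrite e.
  - by move=> /(_ _ Ax).
  - by move=> /(_ _ Ay).
move=> F G cF cG AFG; apply: contrapT => /not_orP[/existsNP[x /not_implyP[Ax Fx]] /existsNP[y /not_implyP[Ay Gy]]].
have [||z [[Az Fz] Gz]] := h (~` F) (~` G) (closed_openC cF) (closed_openC cG).
- by exists x.
- by exists y.
- by case: (AFG z Az).
Qed.

Lemma irreducible_open A U : irreducible_set A -> open U -> A `&` U !=set0 -> irreducible_set (A `&` U).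
Proof.
move=> /irreducible_openP[_ h] oU AU; apply/irreducible_openP; split=> // V W oV oW [x [[Ax Ux] Vx]] [y [[Ay Uy] Wy]].
have [||z [[Az [Uz Vz]] Wz]] := h (U `&` V) W (openI oU oV) oW.
- by exists x.
- by exists y.
- by exists z.
Qed.

Lemma irreducible_closure A : irreducible_set A -> irreducible_set (closure A).
Proof.
move=> [[x Ax] h]; split; first by exists x; exact: subset_closure.
move=> F G cF cG sFG.
have [|AF|AG] := h F G cF cG; first exact: subset_trans (@subset_closure _ A) sFG.
  by left=> y cy; apply: cF => U /cy[z [Az Uz]]; exists z; split=> //; exact: AF.
by right=> y cy; apply: cG => U /cy[z [Az Uz]]; exists z; split=> //; exact: AG.
Qed.

Lemma irreducible_dense U : irreducible_set [set: T] -> open U -> U !=set0 -> dense U.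
Proof.
move=> /irreducible_openP[_ h] oU U0 V V0 oV.
by have := h V U oV oU; rewrite !setTI; apply.
Qed.

Lemma irreducible_set1 (x : T) : irreducible_set [set x].
Proof.
split; first by exists x.
by move=> F G _ _ /(_ x erefl)[]; [left|right] => _ ->.
Qed.

End Irreducible.

Lemma irreducible_image (S T : topologicalType) (f : S -> T) (A : set S) :
  irreducible_set A -> (forall x, A x -> {for x, continuous f}) -> irreducible_set (f @` A).
Proof.
move=> /irreducible_openP[[a Aa] h] cf; apply/irreducible_openP; split; first by exists (f a), a.
move=> U V oU oV [_ [[x Ax <-] Ux]] [_ [[y Ay <-] Vy]].
have opn W z : open W -> A z -> W (f z) -> exists2 O, open O & O z /\ O `<=` f @^-1` W.
  move=> oW Az Wz; have : nbhs z (f @^-1` W) by apply: (cf z Az); exact: open_nbhs_nbhs.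
  by rewrite nbhsE => -[O [oO Oz] sO]; exists O.
have [O oO [Ox sO]] := opn U x oU Ax Ux; have [O' oO' [Oy sO']] := opn V y oV Ay Vy.
have [||z [[Az Oz] O'z]] := h O O' oO oO'; [by exists x|by exists y|].
exists (f z); split; last exact: sO'.
by split; [exists z | exact: sO].
Qed.

Section FunSpaceIrreducible.
Variable K : closedFieldType.

Lemma irreducible_sub (X : funSpace K) (A : set X) :
  irreducible_set A <-> irreducible_set [set: sub_space A].
Proof.
split; last first.
  move=> iA; have -> : A = set_val @` [set: sub_space A].
    apply/seteqP; split=> [x Ax|_ [x _ <-]]; last exact: set_valP.
    by exists (exist _ x (mem_set Ax)).
  by apply: irreducible_image iA _ => x _; apply: continuous_val.
move=> /irreducible_openP[[a Aa] h]; apply/irreducible_openP; split; first by exists (exist _ a (mem_set Aa)).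
move=> U V [U' oU' <-] [V' oV' <-] [x [_ Ux]] [y [_ Vy]].
have [||z [[Az Uz] Vz]] := h U' V' oU' oV'.
- by exists (set_val x); split=> //; exact: set_valP.
- by exists (set_val y); split=> //; exact: set_valP.
by exists (exist _ z (mem_set Az)).
Qed.

Lemma morphism_cst (X Y : funSpace K) (rX : ring_space X) (y : Y) (x : X) :
  morphism_at (fun _ : X => y) x.
Proof.
split; first exact: cst_continuous.
by move=> g _; exact: (regularC rX).
Qed.

Lemma morphism_id (X : funSpace K) (x : X) : morphism_at (id : X -> X) x.
Proof. by split. Qed.

(** Slices are continuous. Irreducibility of Y, applied to the vertical slices through a point of U
    and a point of V, finds y whose horizontal slice meets both; irreducibility of X on that slice
    finishes. *)
Lemma irreducible_prod (X Y : funSpace K) : ring_space X -> ring_space Y ->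
  irreducible_set [set: X] -> irreducible_set [set: Y] -> irreducible_set [set: prod_space X Y].
Proof.
move=> rX rY /irreducible_openP[[x0 _] hX] /irreducible_openP[[y0 _] hY].
apply/irreducible_openP; split; first by exists (x0, y0).
move=> U V oU oV [[x1 y1] [_ U1]] [[x2 y2] [_ V2]].
have cX y : continuous (fun x : X => (x, y) : prod_space X Y).
  move=> x; apply: (morphism_pair rX rY rX (morphism_id x) (morphism_cst rX y x)).1.
have cY x : continuous (fun y : Y => (x, y) : prod_space X Y).
  move=> y; apply: (morphism_pair rX rY rY (morphism_cst rY x y) (morphism_id y)).1.
have /continuousP oY1 := cY x1; have /continuousP oY2 := cY x2.
have [||y [[_ Uy] Vy]] := hY _ _ (oY1 _ oU) (oY2 _ oV); [by exists y1|by exists y2|].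
have /continuousP oX := cX y.
have [||x [[_ Ux] Vx]] := hX _ _ (oX _ oU) (oX _ oV); [by exists x1|by exists x2|].
by exists (x, y).
Qed.

Lemma mmap_eval n (S : comNzRingType) (iota : K -> S) (e : {rmorphism S -> K})
    (c : 'I_n -> S) (p : {mpoly K[n]}) :
  (forall a, e (iota a) = a) -> e (mmap iota c p) = p.@[fun i => e (c i)].
Proof.
move=> eK; rewrite mevalE rmorph_sum; apply: eq_bigr => m _.
rewrite rmorphM eK rmorph_prod; congr (_ * _).
by apply: eq_bigr => i _; rewrite rmorphXn.
Qed.

Lemma line_poly n (p : {mpoly K[n]}) (u v : 'rV[K]_n) :
  exists P : {poly K}, forall t, P.[t] = p.@[(u + t *: v) 0].
Proof.
exists (mmap polyC (fun i => (u 0 i)%:P + (v 0 i) *: 'X) p) => t.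
transitivity (horner_eval t (mmap polyC (fun i => (u 0 i)%:P + (v 0 i) *: 'X) p)) => //.
rewrite (mmap_eval (e := horner_eval t)); last by move=> a; exact: hornerC.
by apply: meval_eq => i; rewrite /= ?horner_evalE !hornerE !mxE mulrC.
Qed.

Lemma poly_nonroot (p : {poly K}) : p != 0 -> exists t, p.[t] != 0.
Proof. by move/closed_nonrootP. Qed.

Lemma irreducible_proj n : irreducible_set [set: projective_space K n].
Proof.
apply/irreducible_openP; split; first by exists (pt (delta_mx 0 0)).
move=> U V oU oV [x [_ Ux]] [y [_ Vy]].
have /nbhs_projP[d [q [hq qx qU]]] : nbhs x U by exact: open_nbhs_nbhs.
have /nbhs_projP[d' [q' [hq' qy qV]]] : nbhs y V by exact: open_nbhs_nbhs.
have /rV0Pn[i xi] := hvec_neq0 x.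
pose u := hvec x; pose v := hvec y - hvec x.
have [P PE] := line_poly q u v; have [P' PE'] := line_poly q' u v.
(* A coordinate not zero at x: it keeps the chosen vector of the line away from 0. *)
have [P2 PE2] := line_poly ('X_i) u v.
have ne0 (G : {poly K}) (t : K) : G.[t] != 0 -> G != 0.
  by apply: contraNneq => ->; rewrite horner0.
have P0 : P != 0 by apply: (ne0 _ 0); rewrite PE scale0r addr0.
have P20 : P2 != 0 by apply: (ne0 _ 0); rewrite PE2 scale0r addr0 mevalXU.
have P'0 : P' != 0 by apply: (ne0 _ 1); rewrite PE' scale1r addrC subrK.
have [|t] := @poly_nonroot (P * P2 * P'); first by rewrite !mulf_neq0.
rewrite !hornerM !mulf_eq0 !negb_or PE PE2 PE' mevalXU => /andP[/andP[Pt P2t] P't].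
have w0 : u + t *: v != 0 by apply: contraNneq P2t => ->; rewrite mxE.
exists (pt (u + t *: v)); split; [split=> //; apply: qU | apply: qV].
  by rewrite (meval_pt hq).
by rewrite (meval_pt hq').
Qed.

End FunSpaceIrreducible.

(** * Algebraic dependence and dimension *)

Section AlgDep.
Variable K : closedFieldType.

Lemma muni_eval k (P : {mpoly K[k.+1]}) (w : 'I_k.+1 -> K) :
  (map_poly (meval (fun i : 'I_k => w (widen_ord (leqnSn k) i))) (muni P)).[w ord_max] = P.@[w].
Proof.
rewrite muniE rmorph_sum horner_sum mevalE; apply: eq_bigr => m _.
rewrite -mul_polyC rmorphM /= map_polyC map_polyXn hornerM hornerC hornerXn /= mevalZ mevalX big_ord_recr /= mulrA.
congr (_ * _ * _); apply: eq_bigr => i _.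
by rewrite mnmE; congr (_ ^+ m _); apply: val_inj.
Qed.

Lemma muni_neq0 k (P : {mpoly K[k.+1]}) : P != 0 -> muni P != 0.
Proof.
apply: contraNneq => P0; apply/eqP/mpolyP => m; rewrite mcoeff0.
pose m' := [multinom m (widen_ord (leqnSn k) i) | i < k].
have := congr1 (fun q : {poly {mpoly K[k]}} => (q`_(m ord_max))@_m') P0.
rewrite /= coef0 mcoeff0 muniE coef_sum raddf_sum /=.
have eqm (m1 : 'X_{1..k.+1}) : [multinom m1 (widen_ord (leqnSn k) i) | i < k] = m' -> m1 ord_max = m ord_max -> m1 = m.
  move=> /mnmP e1 e2; apply/mnmP => i; have [ik|ki] := ltnP i k.
    have := e1 (Ordinal ik); rewrite !mnmE; congr (m1 _ = m _); exact: val_inj.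
  by have -> : i = ord_max by apply: val_inj; apply/eqP; rewrite eqn_leq ki -ltnS ltn_ord.
have term (m1 : 'X_{1..k.+1}) : m1 != m ->
  ((P@_m1 *: 'X_[[multinom m1 (widen_ord (leqnSn k) i) | i < k]] *: 'X^(m1 ord_max) : {poly {mpoly K[k]}})`_(m ord_max))@_m' = 0.
  move=> ne; rewrite coefZ coefXn; case: eqP => [e|_]; last by rewrite mulr0 mcoeff0.
  rewrite mulr1 mcoeffZ mcoeffX; case: eqP => [e'|_]; last by rewrite mulr0.
  by rewrite (eqm m1) ?eqxx in ne.
have [mP|] := boolP (m \in msupp P); last by move/memN_msupp_eq0.
rewrite (bigD1_seq m) //= big1 ?addr0; last by move=> m1 /term.
by rewrite coefZ coefXn eqxx mulr1 mcoeffZ mcoeffX eqxx mulr1.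
Qed.

Variable n : nat.
Implicit Types (S Z : set 'rV[K]_n).

(** For nonempty S this stands for dimension less than k, in place of a transcendence degree. *)
Definition alg_dep k S := forall f : 'I_k -> {mpoly K[n]}, exists2 P : {mpoly K[k]},
  P != 0 & forall v, S v -> P.@[fun i => (f i).@[v 0]] = 0.

(** Irreducibility as seen by polynomials alone, for plain sets of vectors such as cones, on which
    no topology is put. *)
Definition prime_vanishing S := forall p q : {mpoly K[n]},
  (forall v, S v -> p.@[v 0] * q.@[v 0] = 0) ->
  (forall v, S v -> p.@[v 0] = 0) \/ (forall v, S v -> q.@[v 0] = 0).

Lemma alg_dep_sub k S S' : S' `<=` S -> alg_dep k S -> alg_dep k S'.
Proof. by move=> s h f; have [P P0 hP] := h f; exists P => // v /s; apply: hP. Qed.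

Lemma alg_dep0 S v : S v -> ~ alg_dep 0 S.
Proof.
move=> Sv /(_ (fun=> 0))[P P0 /(_ v Sv) e]; move: P0; apply/negP; rewrite negbK.
by move: e; rewrite [P]nvar0_mpolyC mevalC => ->; rewrite mpolyC0.
Qed.

(** The dimension drops on a proper closed subset of an irreducible set. Take a relation on Z
    between g and the k given polynomials, as a polynomial in g. Since g does not vanish on Z,
    powers of g can be divided out until the constant coefficient is nonzero; on Z', where g = 0,
    that coefficient is the desired relation. *)
Lemma alg_dep_drop k Z Z' (g : {mpoly K[n]}) : prime_vanishing Z -> Z' `<=` Z ->
  (forall v, Z' v -> g.@[v 0] = 0) -> (exists2 v, Z v & g.@[v 0] != 0) ->
  alg_dep k.+1 Z -> alg_dep k Z'.
Proof.
move=> pZ sZ gZ' [v0 Zv0 gv0] dZ f.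
pose f' (i : 'I_k.+1) := if unlift ord_max i is Some j then f j else g.
have [P P0 hP] := dZ f'.
pose ev (v : 'rV[K]_n) := meval (fun i : 'I_k => (f i).@[v 0]).
have : exists2 Q : {poly {mpoly K[k]}}, Q != 0 & forall v, Z v -> (map_poly (ev v) Q).[g.@[v 0]] = 0.
  exists (muni P); first exact: muni_neq0.
  move=> v /hP; rewrite -muni_eval /f' unlift_none => <-; congr (_.[_]).
  apply: eq_map_poly => q; apply: meval_eq => i; rewrite /=.
  case: unliftP => [j /(congr1 val) /= | /(congr1 val) /= e].
    by rewrite /bump leqNgt ltn_ord add0n => e; congr (f _).@[_]; apply: val_inj.
  by have := ltn_ord i; rewrite e ltnn.
case=> Q; move: {2}(size Q) (leqnn (size Q)) => s.
elim: s Q => [Q|s IH Q sQ Q0 hQ]; first by rewrite leqn0 size_poly_eq0 => /eqP ->; rewrite eqxx.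
have [q0|q0] := eqVneq Q`_0 0; last first.
  exists Q`_0 => // v Z'v; rewrite -[RHS](hQ v (sZ _ Z'v)) (gZ' _ Z'v) horner_coef0.
  by rewrite coef_map.
have QE : Q = drop_poly 1 Q * 'X.
  by apply/polyP => -[|i]; rewrite coefMX ?coef_drop_poly ?addn1.
have Q10 : drop_poly 1 Q != 0 by apply: contraNneq Q0 => e; rewrite QE e mul0r.
apply: (IH (drop_poly 1 Q)) => //; first by rewrite size_drop_poly leq_subLR add1n.
pose h := (map_poly (mmap (@mpolyC n K) f) (drop_poly 1 Q)).[g].
have hE (v : 'rV[K]_n) : h.@[v 0] = (map_poly (ev v) (drop_poly 1 Q)).[g.@[v 0]].
  rewrite /h -horner_map -map_poly_comp_id0 ?raddf0 //; congr (_.[_]).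
  by apply: eq_map_poly => q /=; rewrite (mmap_eval (e := meval (v 0))) //= => a; rewrite mevalC.
have [|hZ v Zv|gZ] := pZ h g.
- by move=> v Zv; rewrite hE -[RHS](hQ v Zv) {2}QE rmorphM /= map_polyX hornerM hornerX.
- by rewrite -hE hZ.
by move: gv0; rewrite gZ // eqxx.
Qed.


Lemma msize_mul_le (p q : {mpoly K[n]}) : (msize (p * q) <= (msize p + msize q).-1)%N.
Proof.
have [->|p0] := eqVneq p 0; first by rewrite mul0r mmeasure0.
have [->|q0] := eqVneq q 0; first by rewrite mulr0 mmeasure0.
by rewrite msizeM.
Qed.

Lemma msize_prod_exp (I : finType) (f : I -> {mpoly K[n]}) (e : I -> nat) D M :
  (forall i, msize (f i) <= D.+1)%N -> (forall i, e i <= M)%N ->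
  (msize (\prod_i f i ^+ e i) <= (#|I| * M * D).+1)%N.
Proof.
move=> hf he.
have powM (g : {mpoly K[n]}) j : (msize g <= D.+1)%N -> (msize (g ^+ j) <= (j * D).+1)%N.
  move=> hg; elim: j => [|j IH]; first by rewrite expr0 mmeasure1.
  rewrite exprS; apply: leq_trans (msize_mul_le _ _) _.
  by move: hg IH; lia.
have : (msize (\prod_i f i ^+ e i) <= (\sum_(i : I) M * D).+1)%N.
  elim/big_ind2: _ => [|p a q b hp hq|i _]; first by rewrite mmeasure1.
    apply: leq_trans (msize_mul_le _ _) _.
    by move: hp hq; lia.
  by apply: leq_trans (powM _ _ (hf i)) _; rewrite ltnS leq_mul2r he orbT.
by rewrite sum_nat_const mulnA.
Qed.

Lemma card_bmultinom b : (#|{: 'X_{1..n < b}}| <= b ^ n)%N.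
Proof.
have lt (m : 'X_{1..n < b}) i : (m i < b)%N.
  by apply: leq_ltn_trans (bmdeg m); rewrite mdegE (bigD1 i) //= leq_addr.
pose g (m : 'X_{1..n < b}) : {ffun 'I_n -> 'I_b} := [ffun i => Ordinal (lt m i)].
rewrite -[X in (_ <= X ^ _)%N]card_ord -[X in (_ <= _ ^ X)%N]card_ord -card_ffun.
apply: (leq_card g) => m m' /ffunP h; apply: val_inj; apply/mnmP => i.
by have := h i; rewrite !ffunE => -[].
Qed.

(* With [n + 1] polynomials of degree at most [D], the [M^(n+1)] monomials with
   exponents smaller than [M] live in a space of dimension [O(M^n)]. *)
Lemma alg_dep_all : alg_dep n.+1 [set: 'rV[K]_n].
Proof.
move=> f; pose D := (\max_i msize (f i))%N.
(* The products have [msize] at most b, b is at most C M, and M exceeds C^n; hence b^n <= (C M)^n <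
   M^(n+1), the number of products. *)
pose C := (n.+1 * D).+2; pose M := (C ^ n).+1; pose b := (n.+1 * M * D).+1.
pose I := {ffun 'I_n.+1 -> 'I_M}.
pose a (e : I) := \prod_i f i ^+ e i.
have lt : (#|{: 'X_{1..n < b}}| < #|I|)%N.
  apply: leq_ltn_trans (card_bmultinom b) _.
  rewrite card_ffun !card_ord expnS.
  have bM : (b <= C * M)%N.
    by rewrite /b /C; have : (0 < M)%N by []; nia.
  have expl (x y k : nat) : (x <= y -> x ^ k <= y ^ k)%N by case: k => // k; rewrite leq_exp2r.
  apply: leq_ltn_trans (expl _ _ n bM) _.
  by rewrite expnMn ltn_mul2r expn_gt0 ltnS leqnn.
have [|mu [[e0 mu0] sum0]] := @mpoly_lin_dep K n I b a _ lt.
  move=> e; have := @msize_prod_exp _ f (fun i => e i : nat) D M.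
  rewrite card_ord; apply=> i; last exact: ltnW.
  by apply: leqW; exact: (leq_bigmax (F := fun i => msize (f i))).
pose mon (e : I) : 'X_{1..n.+1} := [multinom (e i : nat) | i < n.+1].
have mon_inj : injective mon.
  by move=> e e' /mnmP h; apply/ffunP => i; apply: val_inj; have := h i; rewrite !mnmE.
exists (\sum_e mu e *: 'X_[mon e]).
  apply/eqP => /mpolyP/(_ (mon e0)); rewrite mcoeff0 raddf_sum /= (bigD1 e0) //=.
  rewrite mcoeffZ mcoeffX eqxx mulr1 big1 ?addr0; first by move/eqP; rewrite (negPf mu0).
  move=> e ne; rewrite mcoeffZ mcoeffX (inj_eq mon_inj) (negPf ne) mulr0 //.
move=> v _; rewrite rmorph_sum /=.
have := congr1 (meval (v 0)) sum0; rewrite meval0 rmorph_sum /= => e; rewrite -[RHS]e.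
apply: eq_bigr => e1 _; rewrite !mevalZ mevalX rmorph_prod; congr (_ * _).
by apply: eq_bigr => i _; rewrite rmorphXn mnmE.
Qed.


End AlgDep.

Section Param.
Variable K : closedFieldType.

(* [A] is irreducible and [x t a] is polynomial both along lines in [t] and in [a]. *)
Lemma prime_vanishing_image m r n (A : set 'rV[K]_m) (x : 'rV[K]_r -> 'rV[K]_m -> 'rV[K]_n) :
  prime_vanishing A ->
  (forall t u a (p : {mpoly K[n]}), exists P : {poly K}, forall s, P.[s] = p.@[(x (t + s *: u) a) 0]) ->
  (forall t (p : {mpoly K[n]}), exists q : {mpoly K[m]}, forall a : 'rV[K]_m, q.@[a 0] = p.@[(x t a) 0]) ->
  prime_vanishing [set v | exists t a, A a /\ v = x t a].
Proof.
move=> pA polt pola p q pq0; apply: contrapT => /not_orP[].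
move=> /existsNP[_ /not_implyP[[t [a [Aa ->]] /eqP pt]]].
move=> /existsNP[_ /not_implyP[[t' [a' [Aa' ->]] /eqP qt]]].
have [P PE] := polt t (t' - t) a p; have [Q QE] := polt t (t' - t) a' q.
have P0 : P != 0.
  by apply: contraNneq pt => e; rewrite -[t]addr0 -(scale0r (t' - t)) -PE e horner0.
have Q0 : Q != 0.
  apply: contraNneq qt => e; have := QE 1; rewrite scale1r addrC subrK e horner0.
  by move=> <-.
have [|s] := @poly_nonroot _ (P * Q); first by rewrite mulf_neq0.
rewrite hornerM mulf_eq0 negb_or PE QE => /andP[ps qs].
have [p' p'E] := pola (t + s *: (t' - t)) p; have [q' q'E] := pola (t + s *: (t' - t)) q.
have [|h|h] := pA p' q'.
- by move=> b Ab; rewrite p'E q'E; apply: pq0; exists (t + s *: (t' - t)), b.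
- by move: ps; rewrite -p'E h // eqxx.
- by move: qs; rewrite -q'E h // eqxx.
Qed.

End Param.

(** * Affine cones and upper bounds for dimensions *)

Section Cones.
Variables (K : closedFieldType) (n : nat).

Lemma scaled_meval (p : {mpoly K[n.+1]}) (v : 'rV[K]_n.+1) t :
  p.@[(t *: v) 0] = (\poly_(d < msize p) (pihomog mdeg d p).@[v 0]).[t].
Proof.
rewrite horner_poly {1}(pihomog_partitionE (mf := mdeg) (leqnn _) : p = _) rmorph_sum /=.
by apply: eq_bigr => d _; rewrite (meval_homog _ _ (pihomogP _ _ _)) mulrC.
Qed.

Lemma scaled_meval_eq0 (p : {mpoly K[n.+1]}) (v : 'rV[K]_n.+1) :
  (forall t, p.@[(t *: v) 0] = 0) <-> forall d, (pihomog mdeg d p).@[v 0] = 0.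
Proof.
split=> [h d|h t]; last first.
  by rewrite scaled_meval horner_poly big1 // => d _; rewrite h mul0r.
have p0 : \poly_(d < msize p) (pihomog mdeg d p).@[v 0] = 0.
  by apply/eqP/negPn/negP => /poly_nonroot[t]; rewrite -scaled_meval h eqxx.
have [lt|ge] := ltnP d (msize p); first by have /polyP/(_ d) := p0; rewrite coef_poly lt coef0.
rewrite pihomogE big_seq_cond big1 ?meval0 // => m /andP[mp /eqP e].
by have := msize_mdeg_lt mp; rewrite [mdeg m]e ltnNge ge.
Qed.

(** All multiples of the chosen representatives, so that the choice in [hvec] disappears. The origin
    belongs to every nonempty cone; [dim_le_cone] uses it as the last term of a chain. *)
Definition cone (B : set (projective_space K n)) : set 'rV[K]_n.+1 :=
  [set v | exists t x, B x /\ v = t *: hvec x].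

Lemma cone_vanishing B (p : {mpoly K[n.+1]}) :
  (forall v, cone B v -> p.@[v 0] = 0) <->
  forall x d, B x -> (pihomog mdeg d p).@[hcoord x] = 0.
Proof.
split=> [h x d Bx|h v [t [x [Bx ->]]]].
  by apply: (scaled_meval_eq0 p (hvec x)).1 => t; apply: h; exists t, x.
by apply: (scaled_meval_eq0 p (hvec x)).2 => d; apply: h.
Qed.

(** The topology of T is the one induced by h, expressed through forms. This covers subspaces of
    subspaces of projective space without composing the embeddings into a single subset. *)
Definition separating (T : topologicalType) (h : T -> projective_space K n) :=
  continuous h /\ forall (Z : set T) z, closed Z -> ~ Z z ->
    exists d (g : {mpoly K[n.+1]}), [/\ g \is d.-homog, g.@[hcoord (h z)] != 0 &
      forall y, Z y -> g.@[hcoord (h y)] = 0].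

Lemma separating_id : separating (id : projective_space K n -> projective_space K n).
Proof.
split; first by move=> x; exact: cvg_id.
move=> Z z cZ nZz; have : nbhs z (~` Z) by apply: open_nbhs_nbhs; split=> //; exact: closed_openC.
move=> /nbhs_projP[d [q [hq qz qZ]]]; exists d, q; split=> // y Zy.
by apply/eqP/negPn/negP => /qZ; apply.
Qed.

Lemma separating_val (X : funSpace K) (h : X -> projective_space K n) (A : set X) :
  separating h -> separating (h \o set_val : sub_space A -> projective_space K n).
Proof.
move=> [ch sh]; split.
  by move=> x; apply: continuous_comp; [exact: continuous_val | exact: ch].
move=> Z z cZ nZz; have : nbhs z (~` Z) by apply: open_nbhs_nbhs; split=> //; exact: closed_openC.
move=> /nbhs_subP[U [nU UZ]]; move: nU; rewrite nbhsE => -[W [oW Wz] WU].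
have [|d [g [hg gz gW]]] := sh (~` W) (set_val z) (open_closedC oW); first by apply.
exists d, g; split=> // y Zy; apply: gW => Wy.
exact: (UZ y (WU _ Wy)).
Qed.

Lemma open_homog_neq0 d (q : {mpoly K[n.+1]}) : q \is d.-homog ->
  open [set x : projective_space K n | q.@[hcoord x] != 0].
Proof.
move=> hq; rewrite openE => x qx; apply/nbhs_projP; by exists d, q.
Qed.

Section Dim.
Variables (T : topologicalType) (h : T -> projective_space K n).
Hypothesis sep_h : separating h.
Implicit Types Z : set T.

Lemma open_preimage_neq0 d (q : {mpoly K[n.+1]}) : q \is d.-homog ->
  open [set z | q.@[hcoord (h z)] != 0].
Proof.
by move=> hq; have [/continuousP ch _] := sep_h; exact: (ch _ (open_homog_neq0 hq)).
Qed.

Lemma prime_vanishing_cone Z : irreducible_set Z -> prime_vanishing (cone (h @` Z)).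
Proof.
move=> /irreducible_openP[_ iZ] p q pq0; apply: contrapT => /not_orP[].
move=> /cone_vanishing/existsNP[_ /existsNP[d /not_implyP[[z Zz <-] /eqP pz]]].
move=> /cone_vanishing/existsNP[_ /existsNP[d' /not_implyP[[z' Zz' <-] /eqP qz]]].
have [||y [[Zy py] qy]] := iZ _ _ (open_preimage_neq0 (pihomogP mdeg d p))
    (open_preimage_neq0 (pihomogP mdeg d' q)).
- by exists z.
- by exists z'.
have nz (r : {mpoly K[n.+1]}) e : (pihomog mdeg e r).@[hcoord (h y)] != 0 ->
    \poly_(d < msize r) (pihomog mdeg d r).@[hcoord (h y)] != 0.
  move=> ry; apply: contraNneq ry => r0; apply/eqP.
  apply: (scaled_meval_eq0 r (hvec (h y))).1 => t.
  by rewrite scaled_meval r0 horner0.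
have [|t] := @poly_nonroot _ (\poly_(d < msize p) (pihomog mdeg d p).@[hcoord (h y)] *
   \poly_(d < msize q) (pihomog mdeg d q).@[hcoord (h y)]).
  by rewrite mulf_neq0 // (nz _ _ py, nz _ _ qy).
rewrite hornerM hcoordE -!scaled_meval => /eqP; apply; apply: pq0.
by exists t, (h y); split=> //; exists y.
Qed.

(** The hypothesis bounds the dimension of the cone by k + 1. Going down a chain of length m costs
    one unit of [alg_dep] at each of its m steps, and one more from the cone over the smallest
    member to the origin, where [alg_dep 0] still fails; so m is at most k. *)
Lemma dim_le_cone k : alg_dep k.+2 (cone (range h)) -> dim_le T k.
Proof.
move=> depT m Z [irrZ ltZ].
have cone_sub Z1 Z2 : Z1 `<=` Z2 -> cone (h @` Z1) `<=` cone (h @` Z2).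
  by move=> s _ [t [_ [[z Zz <-] ->]]]; exists t, (h z); split=> //; exists z => //; exact: s.
have cone_ne Z1 : irreducible_set Z1 -> exists v, cone (h @` Z1) v.
  by move=> [[z Zz] _]; exists (0 *: hvec (h z)), 0, (h z); split=> //; exists z.
have step (i : 'I_m.+1) : exists2 r, alg_dep r (cone (h @` Z i)) & (r + (m - i) = k.+2)%N.
  have : forall j, (j <= m)%N -> forall i : 'I_m.+1, (i + j = m)%N ->
      exists2 r, alg_dep r (cone (h @` Z i)) & (r + j = k.+2)%N.
    elim=> [_ i0 _|j IH jm i0 ij].
      exists k.+2; last by rewrite addn0.
      by apply: alg_dep_sub depT; apply: cone_sub.
    have im : (i0.+1 < m.+1)%N by move: ij jm; lia.
    have [|r dr rj] := IH (ltnW jm) (Ordinal im); first by rewrite /= addSnnS.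
    have [iZ1 iZ2] := irrZ (Ordinal im); have [iZ3 iZ4] := irrZ i0.
    case: r dr rj => [d0 _|r dr rj]; first by have [v /alg_dep0] := cone_ne _ iZ2; case.
    exists r; last by rewrite addnS -addSn.
    have lt := ltZ i0 (Ordinal im) (ltnSn _).
    have sub : Z i0 `<=` Z (Ordinal im) := lt.1.
    have /existsNP[z /not_implyP[Zz nZz]] : ~ (Z (Ordinal im) `<=` Z i0) := lt.2.
    have [d [g [hg gz gZ]]] := sep_h.2 (Z i0) z iZ3 nZz.
    apply: (alg_dep_drop (prime_vanishing_cone iZ2) (cone_sub _ _ sub) (g := g) _ _ dr).
      move=> _ [t [_ [[y Zy <-] ->]]]; rewrite (meval_homog _ _ hg) -hcoordE gZ ?mulr0 //.
    exists (hvec (h z)) => //; exists 1, (h z); rewrite scale1r; split=> //; by exists z.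
  by move=> /(_ (m - i)%N (leq_subr _ _) i); apply; rewrite subnKC // -ltnS.
have [r dr rm] := step ord0; rewrite subn0 in rm.
have [iZ1 iZ2] := irrZ ord0; have [[z Zz] _] := iZ2.
case: r dr rm => [d0 _|r dr rm]; first by have [v /alg_dep0] := cone_ne _ iZ2; case.
(* The additional drop, from the cone over [Z ord0] to its vertex. *)
have /rV0Pn[i zi] := hvec_neq0 (h z).
have : alg_dep r [set 0 : 'rV[K]_n.+1].
  apply: (alg_dep_drop (prime_vanishing_cone iZ2) (g := 'X_i) _ _ _ dr).
  - by move=> _ ->; exists 0, (h z); rewrite scale0r; split=> //; exists z.
  - by move=> _ ->; rewrite mevalXU mxE.
  - by exists (hvec (h z)); [exists 1, (h z); rewrite scale1r; split=> //; exists z | rewrite mevalXU].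
case: r {dr} rm => [_ d0|r rm _]; last by lia.
by have := alg_dep0 (erefl : [set (0 : 'rV[K]_n.+1)] 0) d0.
Qed.

Lemma vanishing_closure Z (p : {mpoly K[n.+1]}) :
  (forall v, cone (h @` Z) v -> p.@[v 0] = 0) ->
  forall v, cone (h @` closure Z) v -> p.@[v 0] = 0.
Proof.
move=> /cone_vanishing hp; apply/cone_vanishing => _ d [z cz <-].
apply/eqP/negPn/negP => pz.
have [|y [Zy py]] := cz [set z | (pihomog mdeg d p).@[hcoord (h z)] != 0].
  by apply: open_nbhs_nbhs; split=> //; apply: open_preimage_neq0; exact: pihomogP.
by move: py; rewrite /= hp ?eqxx //; exists y.
Qed.

Lemma alg_dep_closure k Z : alg_dep k (cone (h @` Z)) -> alg_dep k (cone (h @` closure Z)).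
Proof.
move=> dZ f; have [P P0 hP] := dZ f; exists P => //.
pose q := mmap (@mpolyC n.+1 K) f P.
have qE (v : 'rV[K]_n.+1) : q.@[v 0] = P.@[fun i => (f i).@[v 0]].
  by rewrite /q (mmap_eval (e := meval (v 0))) //= => a; rewrite mevalC.
by move=> v cv; rewrite -qE; apply: vanishing_closure cv => w /hP; rewrite qE.
Qed.

End Dim.
End Cones.

(** Taking closures of the images keeps the inclusions of a chain strict, since by hypothesis no new
    point of the image of j is added. *)
Lemma dim_le_embedding (S T : topologicalType) (j : S -> T) k :
  continuous j -> (forall (Z : set S) u, closed Z -> closure (j @` Z) (j u) -> Z u) ->
  dim_le T k -> dim_le S k.
Proof.
move=> cj hj dT m Z [irrZ ltZ]; apply: (dT m (fun i => closure (j @` Z i))); split.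
  move=> i; have [cZ iZ] := irrZ i; split; first exact: closed_closure.
  by apply: irreducible_closure; apply: irreducible_image iZ _ => x _; exact: cj.
move=> a b /ltZ lt; split.
  by apply: closureS; apply: image_subset; exact: lt.1.
move=> s; apply: lt.2 => u Zu; apply: hj; first by case: (irrZ a).
by apply: s; apply: subset_closure; exists u.
Qed.

(** * Affine charts of curves *)

Section Curve.
Variable K : closedFieldType.
Hypothesis K_unc : ~ countable [set: K].

Lemma affine_closedP n (A : set (affine_space K n)) (v : affine_space K n) : closed A -> ~ A v ->
  exists q : {mpoly K[n]}, q.@[(v : 'rV[K]_n) 0] != 0 /\ forall w : 'rV[K]_n, A w -> q.@[w 0] = 0.
Proof.
move=> cA nAv; have : nbhs v (~` A) by apply: open_nbhs_nbhs; split=> //; exact: closed_openC.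
move=> /(nbhs_generatedP (affine_fraction_family K n))[D [h [[p [q [eD _]]] Dv DA]]].
exists q; move: Dv; rewrite eD; split=> // w Aw; apply/eqP/negPn/negP => qw.
by apply: (DA w) => //; rewrite eD.
Qed.

Lemma affine_open_neq0 n (q : {mpoly K[n]}) : open [set v : affine_space K n | q.@[(v : 'rV[K]_n) 0] != 0].
Proof.
rewrite openE => v qv; apply/(nbhs_generatedP (affine_fraction_family K n)).
exists [set x : 'rV[K]_n | q.@[x 0] != 0], (fun x : 'rV[K]_n => q.@[x 0] / q.@[x 0]).
by split=> //; exists q, q.
Qed.

Lemma affine_closed_eq0 n (I : set {mpoly K[n]}) :
  closed [set v : affine_space K n | forall q, I q -> q.@[(v : 'rV[K]_n) 0] = 0].
Proof.
rewrite -openC openE => v /existsNP[q /not_implyP[Iq /eqP qv]].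
apply: filterS (open_nbhs_nbhs (conj (affine_open_neq0 q) qv)) => w /= /eqP qw h.
by apply: qw; apply: h.
Qed.

Definition vanishing_ideal n (A : set 'rV[K]_n) : set {mpoly K[n]} :=
  [set p | forall v, A v -> p.@[v 0] = 0].

Lemma vanishing_ideal_prime n (A : set (affine_space K n)) : irreducible_set A ->
  is_prime (vanishing_ideal (A : set 'rV[K]_n)).
Proof.
move=> /irreducible_openP[[a Aa] irrA]; split.
- split.
  + by move=> v _; rewrite meval0.
  + by move=> p q Pp Pq v Av; rewrite mevalD Pp // Pq // addr0.
  + by move=> p q Pq v Av; rewrite mevalM Pq // mulr0.
- by move=> /(_ a Aa); rewrite meval1 => /eqP; rewrite oner_eq0.
move=> p q pq; apply: contrapT => /not_orP[/existsNP[v /not_implyP[Av /eqP pv]] /existsNP[w /not_implyP[Aw /eqP qw]]].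
have [||u [[Au pu] qu]] := irrA _ _ (affine_open_neq0 p) (affine_open_neq0 q).
- by exists v.
- by exists w.
by move: (pq u Au); rewrite mevalM => /eqP; rewrite mulf_eq0 (negPf pu) (negPf qu).
Qed.

Lemma prime_zeros_irreducible n (J : set {mpoly K[n]}) : is_prime J ->
  irreducible_set [set v : affine_space K n | forall q, J q -> q.@[(v : 'rV[K]_n) 0] = 0].
Proof.
move=> pJ; have [iJ J1 JP] := pJ.
have NS p : ~ J p -> exists v : 'rV[K]_n, (forall q, J q -> q.@[v 0] = 0) /\ p.@[v 0] != 0.
  move=> /(nullstellensatz K_unc pJ)[v [Jv pv]]; exists (\row_i v i).
  have e (q : {mpoly K[n]}) : q.@[(\row_i v i) 0] = q.@[v] by apply: meval_eq => i; rewrite mxE.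
  by split=> [q Jq|]; rewrite e //; apply: Jv.
have NS0 p : (forall v : 'rV[K]_n, (forall q, J q -> q.@[v 0] = 0) -> p.@[v 0] = 0) -> J p.
  by move=> h; apply: contrapT => /NS[v [Jv]]; rewrite h // eqxx.
split; first by have [v [Jv _]] := NS _ J1; exists v.
move=> F G cF cG JFG; apply: contrapT => /not_orP[].
move=> /existsNP[v /not_implyP[Jv nFv]] /existsNP[w /not_implyP[Jw nGw]].
have [p [pv pF]] := affine_closedP cF nFv; have [q [qw qG]] := affine_closedP cG nGw.
have /JP[Jp|Jq] : J (p * q).
  apply: NS0 => u Ju; rewrite mevalM; have [/pF->|/qG->] := JFG u Ju; by rewrite ?mul0r ?mulr0.
  by rewrite Jv ?eqxx in pv.
by rewrite Jw ?eqxx in qw.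
Qed.

(* The last hypothesis says that [A] has dimension at most 1. *)
Lemma curve_algebraic n (A : set (affine_space K n)) (f g : {mpoly K[n]}) :
  closed A -> irreducible_set A ->
  (forall Z : set (affine_space K n), closed Z -> irreducible_set Z -> Z `<=` A ->
     (exists v w, [/\ Z v, Z w & v <> w]) -> A `<=` Z) ->
  exists2 H : {poly {poly K}}, H != 0 & vanishing_ideal (A : set 'rV[K]_n) (map_poly (horner_alg g) H).[f].
Proof.
move=> cA irrA dimA; apply: contrapT => nH.
have pA := vanishing_ideal_prime irrA.
(* Independence of f and g would give a closed irreducible Z inside A with f = c on Z and g
   transcendental, hence nonconstant, there. Having two points, Z is all of A; then f = c on A, and
   this is itself an algebraic relation. *)
have [|c [J [pJ AJ Jf Jg]]] := independent_prime K_unc pA (f := f) (g := g).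
  by move=> H H0 hH; apply: nH; exists H.
pose Z := [set v : affine_space K n | forall q, J q -> q.@[(v : 'rV[K]_n) 0] = 0].
have NS0 p : (forall v : 'rV[K]_n, Z v -> p.@[v 0] = 0) -> J p.
  move=> h; apply: contrapT => /(nullstellensatz K_unc pJ)[v [Jv /eqP]]; apply.
  have e (q : {mpoly K[n]}) : q.@[(\row_i v i) 0] = q.@[v] by apply: meval_eq => i; rewrite mxE.
  by rewrite -e; apply: h => q Jq; rewrite e; apply: Jv.
have ZA : Z `<=` A.
  move=> v Zv; apply: contrapT => /(affine_closedP cA)[q [qv qA]].
  by move: qv; rewrite (Zv q) ?eqxx //; apply: AJ.
have irrZ := prime_zeros_irreducible pJ.
have AZ : A `<=` Z.
  apply: (dimA Z (@affine_closed_eq0 n J) irrZ ZA).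
  have [[v Zv] _] := irrZ; apply: contrapT => nex.
  have eqv w : Z w -> w = v by move=> Zw; apply: contrapT => nwv; apply: nex; exists w, v.
  pose r := g.@[(v : 'rV[K]_n) 0].
  apply: (Jg ('X - r%:P)); first by rewrite polyXsubC_eq0.
  apply: NS0 => w Zw; rewrite rmorphB /= horner_algX horner_alg_mpolyC mevalB mevalC.
  by rewrite (eqv w Zw) subrr.
apply: nH; exists ('X - c%:P%:P); first by rewrite polyXsubC_eq0.
move=> v Av; rewrite rmorphB /= map_polyX map_polyC /= hornerXsubC horner_alg_mpolyC.
exact: (AZ v Av _ Jf).
Qed.

Lemma coordinate_transcendental n (A : set (affine_space K n)) i (v w : 'rV[K]_n) :
  irreducible_set A -> A v -> A w -> v 0 i != w 0 i ->
  forall h : {poly K}, h != 0 -> ~ vanishing_ideal (A : set 'rV[K]_n) (horner_alg 'X_i h).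
Proof.
move=> irrA Av Aw ne h h0 /(prime_horner_root (vanishing_ideal_prime irrA) h0)[c hc].
move: ne; have := hc v Av; have := hc w Aw; rewrite !mevalB !mevalC !mevalXU.
by move/eqP; rewrite subr_eq0 => /eqP -> /eqP; rewrite subr_eq0 => /eqP ->; rewrite eqxx.
Qed.

Lemma meval_horner_alg n (v : 'rV[K]_n) (x : {mpoly K[n]}) (h : {poly K}) :
  (horner_alg x h).@[v 0] = h.[x.@[v 0]].
Proof.
elim/poly_ind: h => [|h c IH]; first by rewrite rmorph0 meval0 horner0.
by rewrite rmorphD rmorphM /= horner_algX horner_alg_mpolyC mevalD mevalM mevalC IH hornerMXaddC.
Qed.

Lemma meval_horner_alg2 n (v : 'rV[K]_n) (x y : {mpoly K[n]}) (q : {poly {poly K}}) :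
  ((map_poly (horner_alg x) q).[y]).@[v 0] = q.[(y.@[v 0])%:P].[x.@[v 0]].
Proof.
elim/poly_ind: q => [|q c IH]; first by rewrite rmorph0 !horner0 meval0.
rewrite rmorphD rmorphM /= map_polyX map_polyC /= hornerD hornerMX hornerC mevalD mevalM IH.
by rewrite meval_horner_alg hornerMXaddC hornerD hornerM hornerC.
Qed.

(** [plane_model] for the ideal of A, read at points: (M, N) maps A to the plane, and where D does
    not vanish [pc] and [ps] recover the point and S from its image. *)
Lemma affine_plane_model n (A : set (affine_space K n)) (eps : K) :
  [pchar K] =i pred0 -> closed A -> irreducible_set A ->
  (forall Z : set (affine_space K n), closed Z -> irreducible_set Z -> Z `<=` A ->
     (exists v w, [/\ Z v, Z w & v <> w]) -> A `<=` Z) ->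
  (exists v w, [/\ A v, A w & v <> w]) ->
  exists (m s : {mpoly K[n]}) (D : {poly K}) (ps : {poly {poly K}}) (pc : 'I_n -> {poly {poly K}}),
    let M (v : 'rV[K]_n) := m.@[v 0] in let S (v : 'rV[K]_n) := s.@[v 0] in
    let N v := - (S v ^+ 2 + eps * (S v * M v)) in
    [/\ D != 0, forall c, exists2 v : 'rV[K]_n, A v & M v != c,
        forall v : 'rV[K]_n, A v -> forall i, D.[M v] * v 0 i = (pc i).[(N v)%:P].[M v],
        forall v : 'rV[K]_n, A v -> D.[M v] * S v = ps.[(N v)%:P].[M v] &
        exists2 v : 'rV[K]_n, A v & S v *+ 2 + eps * M v != 0].
Proof.
move=> char0 cA irrA dimA [v [w [Av Aw vw]]].
have [i vwi] : exists i, (v : 'rV[K]_n) 0 i != (w : 'rV[K]_n) 0 i.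
  by apply: contrapT => /forallNP h; apply: vw; apply/rowP => i; apply/eqP/negPn/negP/(h i).
have pA := vanishing_ideal_prime irrA.
have trX := coordinate_transcendental irrA Av Aw vwi.
have [s [D [ps [pc [D0 hc hs nd]]]]] := plane_model char0 pA trX (fun p => curve_algebraic p 'X_i cA irrA dimA) eps.
exists 'X_i, s, D, ps, pc => M S N.
have NE (u : 'rV[K]_n) : (- (s ^+ 2 + eps *: (s * 'X_i))).@[u 0] = N u.
  by rewrite mevalN mevalD mevalZ !expr2 !mevalM /N /S /M !expr2.
split=> //.
- move=> c; have [->|] := eqVneq c (M v); last by exists v; rewrite // eq_sym.
  by exists w; rewrite // /M !mevalXU eq_sym.
- move=> u Au j; have := hc j u Au; rewrite mevalB mevalM meval_horner_alg meval_horner_alg2 mevalXU NE.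
  by move/eqP; rewrite subr_eq0 => /eqP.
- move=> u Au; have := hs u Au; rewrite mevalB mevalM meval_horner_alg meval_horner_alg2 NE.
  by move/eqP; rewrite subr_eq0 => /eqP.
have /existsNP[u /not_implyP[Au /eqP ne]] := nd.
by exists u => //; move: ne; rewrite mevalD mevalMn mevalZ.
Qed.


Lemma chain2 (T : topologicalType) (Z0 Z1 Z2 : set T) :
  closed Z0 -> irreducible_set Z0 -> closed Z1 -> irreducible_set Z1 -> closed Z2 -> irreducible_set Z2 ->
  Z0 `<` Z1 -> Z1 `<` Z2 -> exists Z : 'I_3 -> set T, irreducible_chain Z.
Proof.
move=> c0 i0 c1 i1 c2 i2 l01 l12.
exists (fun i : 'I_3 => if (i : nat) is j.+1 then if j is _.+1 then Z2 else Z1 else Z0); split.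
  by move=> [[|[|[|]]] //= _].
have l02 : Z0 `<` Z2.
  split; first exact: subset_trans l01.1 l12.1.
  by move=> s; apply: l12.2; apply: subset_trans s l01.1.
by move=> [[|[|[|]]] //= _] [[|[|[|]]] //= _].
Qed.

Lemma affine_closed1 n (v : affine_space K n) : closed [set v].
Proof.
pose I : set {mpoly K[n]} := [set q | exists i, q = 'X_i - ((v : 'rV[K]_n) 0 i)%:MP].
have -> : [set v] = [set w : affine_space K n | forall q, I q -> q.@[(w : 'rV[K]_n) 0] = 0].
  apply/seteqP; split=> [w -> _ [i ->]|w h]; first by rewrite mevalB mevalXU mevalC subrr.
  apply/rowP => i; apply/eqP; rewrite -subr_eq0; apply/eqP.
  by rewrite -[LHS](_ : ('X_i - ((v : 'rV[K]_n) 0 i)%:MP).@[(w : 'rV[K]_n) 0] = _); [apply: h; exists i | rewrite mevalB mevalXU mevalC].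
exact: affine_closed_eq0.
Qed.

Lemma morphism_continuous (X Y : funSpace K) (f : X -> Y) : (forall x, morphism_at f x) -> continuous f.
Proof. by move=> mf x; exact: (mf x).1. Qed.

Lemma closed_preimage_val (X : funSpace K) (A F : set X) :
  closed F -> closed (set_val @^-1` F : set (sub_space A)).
Proof. by move=> cF; apply: (continuous_closedP _).1 cF; exact: continuous_val. Qed.

Lemma curve_affine_chart (Gamma : funSpace K) : is_irreducible_curve Gamma ->
  exists n (A : set (affine_space K n)) (U : set Gamma),
    [/\ open U /\ U !=set0, closed A /\ irreducible_set A, isomorphic (sub_space U) (sub_space A),
      forall Z : set (affine_space K n), closed Z -> irreducible_set Z -> Z `<=` A ->
        (exists v w, [/\ Z v, Z w & v <> w]) -> A `<=` Z &
      exists v w, [/\ A v, A w & v <> w]].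
Proof.
move=> [[[r [W [hW cov]]] _] irrG [dimG [Ch [irrCh ltCh]]]].
have [[g0 _] _] := irrG; have [i0 W0] := cov g0.
have [oU [n [A [cA [f [g [mf mg fg gf]]]]]]] := hW i0.
set U := W i0 in oU f g mf mg fg gf W0.
have cf := morphism_continuous mf; have cg := morphism_continuous mg.
have irrU : irreducible_set [set: sub_space U].
  apply: (irreducible_sub U).1; have := irreducible_open irrG oU; rewrite setTI; apply.
  by exists g0.
have irrA' : irreducible_set [set: sub_space A].
  have -> : [set: sub_space A] = f @` [set: sub_space U].
    by apply/seteqP; split=> // y _; exists (g y).
  by apply: irreducible_image irrU _ => x _; apply: cf.
have irrA : irreducible_set A by apply: (irreducible_sub A).2.
pose j (a : sub_space A) : Gamma := set_val (g a).
have cj : continuous j by move=> a; apply: continuous_comp; [exact: cg | exact: continuous_val].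
have dimA : dim_le (sub_space A) 1.
  apply: (dim_le_embedding cj) dimG => Z u cZ cl; apply: contrapT => nZu.
  have : nbhs (g u) (f @^-1` (~` Z)).
    apply: cf; rewrite gf; apply: open_nbhs_nbhs; split=> //; exact: closed_openC.
  move=> /nbhs_subP[V [nV VZ]].
  have nU : nbhs (j u) U by apply: open_nbhs_nbhs; split=> //; exact: set_valP.
  have [_ [[a Za <-] [Vy Uy]]] := cl _ (filterI nV nU).
  by apply: (VZ (g a) Vy); rewrite gf.
have closure_pt (X : funSpace K) (x : X) : irreducible_set (closure [set x]).
  exact: irreducible_closure (irreducible_set1 x).
exists n, A, U; split=> //; first by split=> //; exists g0.
- by exists f, g.
- move=> Z cZ iZ ZA [v [w [Zv Zw vw]]]; apply: contrapT => nAZ.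
  pose Z' : set (sub_space A) := set_val @^-1` Z.
  pose v' : sub_space A := exist _ v (mem_set (ZA v Zv)).
  pose w' : sub_space A := exist _ w (mem_set (ZA w Zw)).
  have iZ' : irreducible_set Z'.
    apply/irreducible_openP; split; first by exists v'.
    move=> _ _ [V1 oV1 <-] [V2 oV2 <-] [a [Za Va]] [b [Zb Vb]].
    have /irreducible_openP[_ h] := iZ.
    have [||c [[Zc c1] c2]] := h V1 V2 oV1 oV2; [by exists (set_val a)|by exists (set_val b)|].
    by exists (exist _ c (mem_set (ZA c Zc))).
  have c1 : closed ([set v'] : set (sub_space A)).
    have e : (set_val @^-1` ([set v] : set (affine_space K n)) : set (sub_space A)) = [set v'].
      by apply/seteqP; split=> [a /= av|_ ->//]; apply: val_inj.
    rewrite -e; apply: closed_preimage_val; exact: affine_closed1.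
  have [||C irrC] := @chain2 _ [set v'] Z' [set: sub_space A] c1 (irreducible_set1 v') (closed_preimage_val cZ) iZ' closedT irrA'.
  + split; first by move=> _ ->.
    by move=> /(_ w' Zw) /(congr1 val) /esym.
  + split=> // s; apply: nAZ => a Aa.
    exact: (s (exist _ a (mem_set Aa))).
  by have := dimA _ _ irrC.
(* If A were one point, U would be a single dense point g0. As points are closed in the affine
   charts, every point of the first member of a chain of length 1 would be g0, and that closed set
   would be all of Gamma, leaving no room for the second member. *)
apply: contrapT => nA.
have eqA (a b : sub_space A) : a = b.
  apply: val_inj; apply: contrapT => ne; apply: nA; exists (val a), (val b).
  by split=> //; exact: set_valP.
have [cC0 [[z Cz] _]] := irrCh ord0.
have lt := ltCh ord0 ord_max isT.
have eqU x : U x -> x = g0.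
  move=> Ux; have : f (exist _ x (mem_set Ux)) = f (exist _ g0 (mem_set W0)) by exact: eqA.
  by move/(congr1 g); rewrite !fg => /(congr1 val).
have denseU : dense U by apply: irreducible_dense => //; exists g0.
have [k Wz] := cov z; have [oW [n' [A' [cA' [f' [g' [mf' mg' fg' gf']]]]]]] := hW k.
have [x [Wx Ux]] := denseU (W k) (ex_intro _ z Wz) oW.
rewrite (eqU x Ux) in Wx.
pose z' : sub_space (W k) := exist _ z (mem_set Wz).
pose y' : sub_space (W k) := exist _ g0 (mem_set Wx).
have zg0 : z = g0.
  apply: contrapT => ne.
  have nf : f' z' <> f' y' by move=> /(congr1 g'); rewrite !fg' => /(congr1 val).
  have : nbhs z' (f' @^-1` (~` (set_val @^-1` [set set_val (f' y')]))).
    apply: (morphism_continuous mf'); apply: open_nbhs_nbhs; split.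
      apply: closed_openC; apply: closed_preimage_val; exact: affine_closed1.
    by move=> e; apply: nf; apply: val_inj.
  move=> /nbhs_subP[V [nV VZ]].
  have : nbhs z (V `&` W k).
    by apply: filterI; [exact: nV | apply: open_nbhs_nbhs; split].
  rewrite nbhsE => -[O [oO Oz] sO].
  have [x1 [Ox Ux1]] := denseU O (ex_intro _ z Oz) oO.
  rewrite (eqU x1 Ux1) in Ox.
  have [Vg Wg] := sO _ Ox.
  by apply: (VZ y').
apply: lt.2 => x2 _; apply: cC0 => B; rewrite nbhsE => -[O [oO Ox] OB].
have [y [Oy Uy]] := denseU O (ex_intro _ x2 Ox) oO.
by exists y; split; [rewrite (eqU y Uy) -zg0 | apply: OB].
Qed.

End Curve.

(** * Cubic forms *)

Section PolynomialFun.
Variable K : closedFieldType.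

Definition polynomial_fun (f : K -> K) := exists P : {poly K}, forall t, f t = P.[t].

Lemma polyfunC c : polynomial_fun (fun=> c).
Proof. by exists c%:P => t; rewrite hornerC. Qed.

Lemma polyfun_id : polynomial_fun id.
Proof. by exists 'X => t; rewrite hornerX. Qed.

Lemma polyfunD f g : polynomial_fun f -> polynomial_fun g -> polynomial_fun (fun t => f t + g t).
Proof. by move=> [P hP] [Q hQ]; exists (P + Q) => t; rewrite hornerD hP hQ. Qed.

Lemma polyfunM f g : polynomial_fun f -> polynomial_fun g -> polynomial_fun (fun t => f t * g t).
Proof. by move=> [P hP] [Q hQ]; exists (P * Q) => t; rewrite hornerM hP hQ. Qed.

Lemma polyfun_sum (I : Type) (r : seq I) (F : I -> K -> K) :
  (forall i, polynomial_fun (F i)) -> polynomial_fun (fun t => \sum_(i <- r) F i t).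
Proof.
move=> hF; elim: r => [|i r [Q hQ]]; first by exists 0 => t; rewrite big_nil horner0.
have [P hP] := hF i; exists (P + Q) => t; by rewrite big_cons hornerD hP hQ.
Qed.

Lemma polyfun_horner2 (h : {poly {poly K}}) f g : polynomial_fun f -> polynomial_fun g ->
  polynomial_fun (fun t => h.[(g t)%:P].[f t]).
Proof.
move=> [P hP] [Q hQ]; exists ((map_poly (fun c => c \Po P) h).[Q]) => t.
elim/poly_ind: h => [|h c IH]; first by rewrite horner0 map_poly0 !horner0.
rewrite rmorphD rmorphM /= map_polyX map_polyC /= !hornerMXaddC !(hornerD, hornerM) hornerC IH hQ.
by rewrite horner_comp hP.
Qed.

(* The value at infinity of a binary form of positive degree without affine
   roots is 0. *)
Lemma binary_form_root (f : K -> K -> K) k : (0 < k)%N ->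
  polynomial_fun (fun t => f t 1) -> polynomial_fun (fun t => f 1 t) ->
  (forall c a b, f (c * a) (c * b) = c ^+ k * f a b) ->
  exists a b, ((a != 0) || (b != 0)) /\ f a b = 0.
Proof.
move=> k0 [P hP] [Q hQ] hom.
have [/closed_rootP[t /rootP Pt]|] := boolP (size P != 1%N).
  by exists t, 1; rewrite oner_neq0 orbT hP Pt.
rewrite negbK => /size_poly1P[c c0 Pc].
have Qc t : t != 0 -> (Q - c *: 'X^k).[t] = 0.
  move=> t0; rewrite hornerD hornerN hornerZ hornerXn -hQ.
  have := hom t t^-1 1; rewrite mulfV // mulr1 hP Pc hornerC => ->.
  by rewrite mulrC subrr.
have Q0 : Q - c *: 'X^k = 0.
  apply/eqP/negPn/negP => nz.
  have [|t] := @poly_nonroot _ ((Q - c *: 'X^k) * 'X); first by rewrite mulf_neq0 ?polyX_eq0.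
  rewrite hornerM hornerX mulf_eq0 negb_or => /andP[Qt t0].
  by rewrite Qc ?eqxx in Qt.
exists 1, 0; rewrite oner_neq0; split=> //; rewrite hQ.
move/eqP: Q0; rewrite subr_eq0 => /eqP ->.
by rewrite hornerZ hornerXn expr0n eqn0Ngt k0 mulr0.
Qed.

End PolynomialFun.

Section Trilinear.
Variables (K : closedFieldType) (n : nat) (T : 'I_n -> 'I_n -> 'I_n -> K).
Implicit Types u v w : 'rV[K]_n.

Definition tri u v w := \sum_i \sum_j \sum_k T i j k * u 0 i * v 0 j * w 0 k.

Hypothesis T12 : forall i j k, T i j k = T j i k.
Hypothesis T23 : forall i j k, T i j k = T i k j.

Lemma triC12 u v w : tri u v w = tri v u w.
Proof.
rewrite /tri exchange_big; apply: eq_bigr => i _; apply: eq_bigr => j _.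
by apply: eq_bigr => k _; rewrite T12; ring.
Qed.

Lemma triC23 u v w : tri u v w = tri u w v.
Proof.
rewrite /tri; apply: eq_bigr => i _; rewrite exchange_big; apply: eq_bigr => j _.
by apply: eq_bigr => k _; rewrite T23; ring.
Qed.

Lemma tri1 u u' v w a : tri (a *: u + u') v w = a * tri u v w + tri u' v w.
Proof.
rewrite /tri mulr_sumr -big_split; apply: eq_bigr => i _ /=.
rewrite mulr_sumr -big_split; apply: eq_bigr => j _ /=.
rewrite mulr_sumr -big_split; apply: eq_bigr => k _ /=.
by rewrite !mxE; ring.
Qed.

Lemma triDl u u' v w : tri (u + u') v w = tri u v w + tri u' v w.
Proof. by have := tri1 u u' v w 1; rewrite scale1r mul1r. Qed.

Lemma triZl a u v w : tri (a *: u) v w = a * tri u v w.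
Proof.
have := tri1 u 0 v w a; rewrite addr0 => ->.
have := tri1 0 0 v w 1; rewrite scale1r addr0 mul1r => /eqP.
by rewrite -subr_eq0 opprD addNKr oppr_eq0 => /eqP ->; rewrite addr0.
Qed.

Lemma triDm u v v' w : tri u (v + v') w = tri u v w + tri u v' w.
Proof. by rewrite triC12 triDl !(triC12 _ u). Qed.
Lemma triZm a u v w : tri u (a *: v) w = a * tri u v w.
Proof. by rewrite triC12 triZl (triC12 _ u). Qed.
Lemma triDr u v w w' : tri u v (w + w') = tri u v w + tri u v w'.
Proof. by rewrite triC23 triDm !(triC23 u _ v). Qed.
Lemma triZr a u v w : tri u v (a *: w) = a * tri u v w.
Proof. by rewrite triC23 triZm (triC23 u _ v). Qed.

Definition triE := (triDl, triDm, triDr, triZl, triZm, triZr).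

Lemma tri0r u v : tri u v 0 = 0.
Proof. by rewrite -(scale0r 0) triZr mul0r. Qed.

Lemma tri_delta u v w : tri u v w = \sum_k tri u v (delta_mx 0 k) * w 0 k.
Proof.
rewrite {1}(row_sum_delta w).
elim: (index_enum _) => [|k r IH]; first by rewrite !big_nil tri0r.
by rewrite !big_cons triDr triZr IH mulrC.
Qed.

Lemma tri_cube a b u v : let p := a *: u + b *: v in
  tri p p p = a ^+ 3 * tri u u u + 3%:R * a ^+ 2 * b * tri u u v
              + 3%:R * a * b ^+ 2 * tri u v v + b ^+ 3 * tri v v v.
Proof.
rewrite /= !triE (triC12 v u u) (triC23 u v u) (triC12 v u v) (triC23 v v u) (triC12 v u v).
by ring.
Qed.

Lemma polyfun_tri (u v w : K -> 'rV[K]_n) :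
  (forall i, polynomial_fun (fun t => u t 0 i)) -> (forall i, polynomial_fun (fun t => v t 0 i)) ->
  (forall i, polynomial_fun (fun t => w t 0 i)) -> polynomial_fun (fun t => tri (u t) (v t) (w t)).
Proof.
move=> hu hv hw; do 3![apply: polyfun_sum => ?].
by apply: polyfunM => //; apply: polyfunM => //; apply: polyfunM => //; apply: polyfunC.
Qed.

Lemma regular_tri (X : funSpace K) (rX : ring_space X) (x : X) (u v w : X -> 'rV[K]_n) :
  (forall i, regular_at x (fun y => u y 0 i)) -> (forall i, regular_at x (fun y => v y 0 i)) ->
  (forall i, regular_at x (fun y => w y 0 i)) -> regular_at x (fun y => tri (u y) (v y) (w y)).
Proof.
move=> hu hv hw; do 3![apply: (regular_sum rX) => ?].
by apply: (regularM rX) => //; apply: (regularM rX) => //; apply: (regularM rX) => //; apply: (regularC rX).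
Qed.

Lemma cubic_root_span u v : exists a b, ((a != 0) || (b != 0)) /\
  tri (a *: u + b *: v) (a *: u + b *: v) (a *: u + b *: v) = 0.
Proof.
apply: (@binary_form_root _ (fun a b => tri (a *: u + b *: v) (a *: u + b *: v) (a *: u + b *: v)) 3) => //.
- have h i : polynomial_fun (fun t : K => (t *: u + 1 *: v) 0 i).
    exists ((u 0 i) *: 'X + (v 0 i)%:P) => t; rewrite !mxE !hornerE; ring.
  exact: polyfun_tri.
- have h i : polynomial_fun (fun t : K => (1 *: u + t *: v) 0 i).
    exists ((v 0 i) *: 'X + (u 0 i)%:P) => t; rewrite !mxE !hornerE; ring.
  exact: polyfun_tri.
- by move=> c a b; rewrite -!scalerA -scalerDr !triE; ring.
Qed.

End Trilinear.

Section Euler.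
Variables (K : closedFieldType) (n : nat).

Lemma mderiv_homog d i (p : {mpoly K[n]}) : p \is d.+1.-homog -> p^`M(i) \is d.-homog.
Proof.
move=> /dhomogP hp; rewrite [p]mpolyE raddf_sum /= big_seq; apply: rpred_sum => m /hp hm.
rewrite linearZ /= mderivX rpredZ //.
have [->|mi] := eqVneq (m i) 0%N; first by rewrite scale0r rpred0.
rewrite rpredZ // dhomogX; apply/eqP.
have im : (U_(i) <= m)%MM by rewrite lep1mP.
by have := congr1 mdeg (submK im); rewrite mdegD mdeg1 hm addn1 => [[]].
Qed.

Lemma euler d (p : {mpoly K[n]}) (v : 'I_n -> K) : p \is d.-homog ->
  \sum_i v i * (p^`M(i)).@[v] = d%:R * p.@[v].
Proof.
move=> /dhomogP hp.
have -> : \sum_i v i * (p^`M(i)).@[v]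
    = \sum_(m <- msupp p) \sum_i v i * ((p@_m *: 'X_[m])^`M(i)).@[v].
  rewrite exchange_big /=; apply: eq_bigr => i _.
  have -> : p^`M(i) = \sum_(m <- msupp p) (p@_m *: 'X_[m])^`M(i) by rewrite {1}[p]mpolyE linear_sum.
  by rewrite rmorph_sum mulr_sumr.
rewrite [in RHS](mpolyE p) raddf_sum mulr_sumr big_seq [RHS]big_seq; apply: eq_bigr => m /hp hm.
under eq_bigr => i _.
  have -> : v i * ((p@_m *: 'X_[m])^`M(i)).@[v] = (m i)%:R * (p@_m * ('X_[m]).@[v]).
    rewrite linearZ /= mderivX !mevalZ.
    have [->|mi] := eqVneq (m i) 0%N; first by rewrite mul0r !mulr0 mul0r.
    have Em : m = (m - U_(i) + U_(i))%MM by rewrite submK // lep1mP.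
    rewrite [in RHS]Em mpolyXD mevalM mevalXU -Em; ring.
  over.
by rewrite -mulr_suml -natr_sum -mdegE hm /= mevalZ.
Qed.

End Euler.

Section CubicTensor.
Variables (K : closedFieldType) (n : nat).
Hypothesis char0 : [pchar K] =i pred0.

Lemma dhomog0_meval (p : {mpoly K[n]}) (v w : 'I_n -> K) : p \is 0.-homog -> p.@[v] = p.@[w].
Proof.
move=> /dhomogP hp; rewrite [p]mpolyE !rmorph_sum big_seq [RHS]big_seq.
apply: eq_bigr => m /hp /eqP; rewrite mdeg_eq0 => /eqP ->.
by rewrite /= !mevalZ mpolyX0 !meval1.
Qed.

Lemma char0_natS_neq0 k : k.+1%:R != 0 :> K.
Proof. by have /pcharf0P -> := char0. Qed.

Lemma cubic_tensor (F : {mpoly K[n]}) : F \is 3.-homog ->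
  exists T : 'I_n -> 'I_n -> 'I_n -> K,
  [/\ forall i j k, T i j k = T j i k, forall i j k, T i j k = T i k j,
      forall v : 'rV_n, F.@[v 0] = tri T v v v &
      forall (v : 'rV_n) i, (F^`M(i)).@[v 0] = 3%:R * tri T v v (delta_mx 0 i)].
Proof.
move=> hF; pose D i j k := (((F^`M(i))^`M(j))^`M(k)).@[fun=> 0 : K].
have hF1 i : F^`M(i) \is 2.-homog by apply: mderiv_homog.
have hF2 i j : (F^`M(i))^`M(j) \is 1.-homog by apply: mderiv_homog.
have hF3 i j k : ((F^`M(i))^`M(j))^`M(k) \is 0.-homog by apply: mderiv_homog.
have h2 := char0_natS_neq0 1; have h3 := char0_natS_neq0 2; have h6 := char0_natS_neq0 5.
have e1 (v : 'rV_n) : \sum_i v 0 i * (F^`M(i)).@[v 0] = 3%:R * F.@[v 0] by apply: euler.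
have e2 (v : 'rV_n) i : \sum_j v 0 j * ((F^`M(i))^`M(j)).@[v 0] = 2%:R * (F^`M(i)).@[v 0].
  exact: euler.
have e3 (v : 'rV_n) i j : \sum_k v 0 k * D i j k = ((F^`M(i))^`M(j)).@[v 0].
  rewrite -[RHS]mul1r -(euler (v 0) (hF2 i j)); apply: eq_bigr => k _.
  by congr (_ * _); apply: dhomog0_meval.
have Dij i j k : D i j k = D j i k by rewrite /D (mderiv_comm i j).
have Djk i j k : D i j k = D i k j by rewrite /D (mderiv_comm j k).
have e4 (v : 'rV_n) i : \sum_j \sum_k D i j k * v 0 j * v 0 k = 2%:R * (F^`M(i)).@[v 0].
  rewrite -e2; apply: eq_bigr => j _; rewrite -e3 mulr_sumr; apply: eq_bigr => k _; ring.
exists (fun i j k => 6%:R^-1 * D i j k); split=> [i j k|i j k|v|v i].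
- by rewrite Dij.
- by rewrite Djk.
- apply: (mulfI h3); rewrite -e1; apply: (mulfI h2); rewrite /tri mulr_sumr.
  rewrite mulrA mulr_sumr; apply: eq_bigr => i _.
  rewrite mulrCA -e4 !mulr_sumr; apply: eq_bigr => j _.
  rewrite !mulr_sumr; apply: eq_bigr => k _; field; exact: h6.
- apply: (mulfI h2); rewrite -e4 mulrA /tri mulr_sumr; apply: eq_bigr => j _.
  rewrite mulr_sumr; apply: eq_bigr => k _.
  rewrite (bigD1 i) //= big1 => [|l li]; last by rewrite mxE (negPf li) andbF mulr0.
  by rewrite (Djk j k) (Dij j i) mxE !eqxx /=; field; exact: h6.
Qed.

End CubicTensor.

(** * Lines on cubics *)

Section LineOnCubic.
Variables (K : closedFieldType) (n : nat) (T : 'I_n -> 'I_n -> 'I_n -> K).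
Hypothesis T12 : forall i j k, T i j k = T j i k.
Hypothesis T23 : forall i j k, T i j k = T i k j.
Hypothesis char0 : [pchar K] =i pred0.
Local Notation tri := (tri T).
Let triE := (triDl T, triDm T12, triDr T12 T23, triZl T, triZm T12, triZr T12 T23).
Let C12 := triC12 T12.
Let C23 := triC23 T23.
Implicit Types u v w : 'rV[K]_n.

Lemma polyfun_comb (f g : K -> K) u v i : polynomial_fun f -> polynomial_fun g ->
  polynomial_fun (fun t => (f t *: u + g t *: v) 0 i).
Proof.
move=> hf hg; rewrite [X in polynomial_fun X](_ : _ = fun t => f t * u 0 i + g t * v 0 i).
  by apply: polyfunD; apply: polyfunM => //; apply: polyfunC.
by apply/funext => t; rewrite !mxE.
Qed.

(* The point of the conic [tri e x x = 0] on the line through its point [u] and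
   [d = s p + t q] is [tri e d d *: u - 2 tri e u d *: d]; it lies on the cubic when a
   form of degree 6 in [(s, t)] vanishes. *)
Lemma conic_cubic_through e u p q : tri e u u = 0 -> exists a b c,
  [|| a != 0, b != 0 | c != 0] /\ let x := a *: u + b *: p + c *: q in
  tri e x x = 0 /\ tri x x x = 0.
Proof.
move=> euu; pose d s t := s *: p + t *: q.
have pid := @polyfun_id K; have pc := @polyfunC K.
pose r s t := tri e (d s t) (d s t) *: u + (- 2%:R * tri e u (d s t)) *: d s t.
have err s t : tri e (r s t) (r s t) = 0.
  by rewrite /r; move: (d s t) => D; rewrite !triE euu (C23 e D u); ring.
have pd1 i : polynomial_fun (fun t => d t 1 0 i) by apply: polyfun_comb.
have pd2 i : polynomial_fun (fun t => d 1 t 0 i) by apply: polyfun_comb.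
have pr (D : K -> 'rV[K]_n) : (forall i, polynomial_fun (fun t => D t 0 i)) ->
    forall i, polynomial_fun (fun t => (tri e (D t) (D t) *: u + (- 2%:R * tri e u (D t)) *: D t) 0 i).
  move=> hD i.
  rewrite [X in polynomial_fun X](_ : _ = fun t => tri e (D t) (D t) * u 0 i
      + (- 2%:R * tri e u (D t)) * D t 0 i); last by apply/funext => t; rewrite !mxE.
  apply: polyfunD; (apply: polyfunM; last by []).
    by apply: polyfun_tri => // j; apply: polyfunC.
  by apply: polyfunM => //; apply: polyfun_tri => // j; apply: polyfunC.
have [||||s [t [st0 Prst]]] := @binary_form_root _ (fun s t => tri (r s t) (r s t) (r s t)) 6.
- by [].
- by apply: polyfun_tri; apply: pr.
- by apply: polyfun_tri; apply: pr.
- move=> c s t; have -> : r (c * s) (c * t) = c ^+ 2 *: r s t.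
    have dE : d (c * s) (c * t) = c *: d s t by rewrite /d scalerDr !scalerA.
    rewrite /r dE [in RHS]scalerDr !scalerA !triE; congr (_ *: _ + _ *: _); rewrite ?expr2; ring.
  by rewrite !triE; ring.
set x := tri e (d s t) (d s t) in r err pr Prst *; set y := tri e u (d s t).
(* The coefficients in u, p, q must not all vanish. If those of [r s t] do, then [tri e d d] and
   [tri e u d] are zero, so the conic contains the whole line through u and d, and a root of the
   cubic on that line serves instead. *)
have [rnz|] := boolP [|| x != 0, - 2%:R * y * s != 0 | - 2%:R * y * t != 0].
  exists x, (- 2%:R * y * s), (- 2%:R * y * t); split=> //=.
  have <- : r s t = x *: u + (- 2%:R * y * s) *: p + (- 2%:R * y * t) *: q.
    by rewrite /r /d scalerDr !scalerA addrA.
  by [].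
have n2 : (- 2%:R == 0 :> K) = false by rewrite oppr_eq0 (negPf (char0_natS_neq0 char0 1%N)).
rewrite !negb_or !negbK !mulf_eq0 n2 /=.

move=> /and3P[/eqP x0 ys yt].
have y0 : y = 0.
  by apply/eqP; move: st0 ys yt; case: (y == 0) => //=; case: (s == 0) => //=; case: (t == 0).
have [a [b [ab0 Pab]]] := cubic_root_span T12 T23 u (d s t).
exists a, (b * s), (b * t); split.
  have [a0|//] := eqVneq a 0; rewrite a0 eqxx /= in ab0.
  by rewrite !mulf_eq0 !negb_or ab0.
have -> /= : a *: u + (b * s) *: p + (b * t) *: q = a *: u + b *: d s t.
  by rewrite /d scalerDr !scalerA addrA.
split=> //; have := x0; have := y0; rewrite /x /y; move: (d s t) => D yD xD.
by rewrite !triE (C23 e D u) euu xD yD; ring.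
Qed.

Lemma conic_cubic e u p q : exists a b c,
  [|| a != 0, b != 0 | c != 0] /\ let x := a *: u + b *: p + c *: q in
  tri e x x = 0 /\ tri x x x = 0.
Proof.
have pid := @polyfun_id K; have pc := @polyfunC K.
have [||||a [b [ab0 Bab]]] := @binary_form_root _
    (fun a b => tri e (a *: u + b *: p) (a *: u + b *: p)) 2.
- by [].
- by apply: polyfun_tri => i; [exact: pc|apply: polyfun_comb|apply: polyfun_comb].
- by apply: polyfun_tri => i; [exact: pc|apply: polyfun_comb|apply: polyfun_comb].
- by move=> c a b; rewrite -!scalerA -scalerDr !triE; ring.
(* The point found on the conic takes the place of p if a = 0 and of u otherwise, so that the final
   coefficients are still not all zero. *)
have [a0|a0] := eqVneq a 0.
  rewrite a0 eqxx /= in ab0; have [x [y [z [xyz h]]]] := conic_cubic_through u q Bab.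
  exists y, (x * b), z; split; first by rewrite mulf_eq0 (negPf ab0) orbF; case/or3P: xyz => ->; rewrite ?orbT.
  by rewrite -scalerA [_ + _ *: (_ *: _)]addrC; rewrite a0 scale0r add0r in h.
have [x [y [z [xyz h]]]] := conic_cubic_through p q Bab.
exists (x * a), (x * b + y), z; split.
  rewrite mulf_eq0 (negPf a0) orbF; have [x0|//] := eqVneq x 0.
  by rewrite x0 eqxx /= in xyz; rewrite x0 mul0r add0r.
suff -> : (x * a) *: u + (x * b + y) *: p = x *: (a *: u + b *: p) + y *: p by [].
by rewrite scalerDr scalerDl !scalerA addrA.
Qed.

Lemma mulmx_comb3 (M : 'M[K]_(3, n)) (a b c : K) :
  exists x : 'rV_3, [|| a != 0, b != 0 | c != 0] = (x != 0) /\
  x *m M = a *: row 0 M + b *: row 1 M + c *: row 2%:R M.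
Proof.
exists (a *: delta_mx 0 0 + b *: delta_mx 0 1 + c *: delta_mx 0 2%:R); split.
  apply/idP/idP; apply: contraTT; last first.
    rewrite !negb_or !negbK => /and3P[/eqP -> /eqP -> /eqP ->].
    by rewrite !scale0r !addr0.
  rewrite negbK => /eqP/rowP h; move: (h 0) (h 1) (h 2%:R); rewrite !mxE /=.
  by rewrite !mulr0 !mulr1 !addr0 !add0r => -> -> ->; rewrite eqxx.
by rewrite !mulmxDl -!scalemxAl -!rowE.
Qed.

Lemma row_free_subspace k m (A : 'M[K]_(m, n)) : (k <= \rank A)%N ->
  exists M : 'M[K]_(k, n), row_free M /\ (M <= A)%MS.
Proof.
move=> kA; exists (pid_mx k *m row_base A); split.
  by rewrite /row_free mxrankMfree ?row_base_free // rank_pid_mx.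
by rewrite mulmx_sub // eq_row_base.
Qed.

Definition indep u v := forall a b : K, a *: u + b *: v = 0 -> a = 0 /\ b = 0.

(** Fix a point e0 of the cubic. The line from e0 to x lies on it when the polars e0 e0 x, e0 x x
    and x x x vanish. The first is linear in x; together with a hyperplane missing e0 it leaves room
    for a plane as soon as n is at least 5, and in that plane the other two are a conic and a
    cubic. *)
Lemma line_on_cubic : (4 < n)%N -> exists e0 e1 : 'rV[K]_n,
  [/\ indep e0 e1, tri e0 e0 e0 = 0, tri e0 e0 e1 = 0, tri e0 e1 e1 = 0 & tri e1 e1 e1 = 0].
Proof.
move=> n5.
have n0 : (0 < n)%N by apply: leq_trans n5.
have n1 : (1 < n)%N by apply: leq_trans n5.
have [a [b [ab F0]]] := cubic_root_span T12 T23 (delta_mx 0 (Ordinal n0)) (delta_mx 0 (Ordinal n1)).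
set e0 := _ + _ in F0.
have [i ei] : exists i, e0 0 i != 0.
  have [a0|a0] := eqVneq a 0; last by exists (Ordinal n0); rewrite /e0 !mxE !eqxx /= mulr1 mulr0 addr0.
  by exists (Ordinal n1); rewrite a0 eqxx /= in ab; rewrite /e0 !mxE !eqxx /= mulr1 mulr0 add0r.
clearbody e0.
(* Column 0 is the tangent hyperplane at e0; column 1 is the hyperplane x_i = 0, which misses e0 and
   ensures independence. *)
pose L : 'M[K]_(n, 2) := \matrix_(k, j) if j == 0 then tri e0 e0 (delta_mx 0 k) else (k == i)%:R.
have [|M [Mf ML]] := @row_free_subspace 3 _ (kermx L).
  by rewrite mxrank_ker; have := rank_leq_col L; lia.
have ker (x : 'rV_3) : tri e0 e0 (x *m M) = 0 /\ (x *m M) 0 i = 0.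
  have : (x *m M <= kermx L)%MS by rewrite mulmx_sub.
  move/sub_kermxP/rowP => h; split.
    have := h 0; rewrite !mxE tri_delta // => {2}<-.
    by apply: eq_bigr => k _; rewrite !mxE mulrC.
  have := h 1; rewrite mxE (bigD1 i) //= big1 => [|k ki]; last by rewrite [L _ _]mxE /= (negPf ki) mulr0.
  by rewrite !mxE eqxx /= mulr1 addr0.
have [a' [b' [c' [abc [Be Fe]]]]] := conic_cubic e0 (row 0 M) (row 1 M) (row 2%:R M).
have [x [xE xM]] := mulmx_comb3 M a' b' c'; rewrite -xM in Be Fe.
exists e0, (x *m M); split=> //; try by have [] := ker x.
move=> s t h; have := congr1 (fun v : 'rV_n => v 0 i) h; rewrite !mxE.
have [_] := ker x; rewrite mxE => ->; rewrite mulr0 addr0 => /eqP.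
rewrite mulf_eq0 (negPf ei) orbF => /eqP s0; split=> //.
move/eqP: h; rewrite s0 scale0r add0r scaler_eq0 => /orP[/eqP//|/eqP].
rewrite -[RHS](mul0mx _ M) => /(row_free_inj Mf) x0.
by rewrite abc x0 eqxx in xE.
Qed.


Lemma binary_quadratic_factor (a b c : K) : exists p q r t : K,
  [/\ (p != 0) || (q != 0), a = p * r, b = p * t + q * r & c = q * t].
Proof.
have [|||| x [y [xy0 h]]] := @binary_form_root _ (fun x y => a * x ^+ 2 + b * x * y + c * y ^+ 2) 2.
- by [].
- exists (a *: 'X^2 + b *: 'X + c%:P) => t; rewrite !hornerE /=; ring.
- exists (c *: 'X^2 + b *: 'X + a%:P) => t; rewrite !hornerE /=; ring.
- by move=> k x y; ring.
have [y0|y0] := eqVneq y 0; last first.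
  exists y, (- x), (a / y), (b / y + a * x / y ^+ 2); rewrite y0; split=> //.
  - by field.
  - by field.
  - apply: (mulIf (expf_neq0 2 y0)); move/eqP: h; rewrite addrC addr_eq0 => /eqP ->.
    by field.
move: h; rewrite y0 expr0n /= !mulr0 !addr0 => /eqP; rewrite mulf_eq0 expf_eq0 /=.
rewrite y0 eqxx orbF in xy0; rewrite (negPf xy0) orbF => /eqP a0.
by exists 0, 1, b, c; rewrite oner_neq0 orbT a0; split=> //; ring.
Qed.

Lemma sqrt_closed (a : K) : exists s, s ^+ 2 = a.
Proof.
have /closed_rootP[s] : size ('X^2 - a%:P) != 1%N by rewrite size_XnsubC.
by rewrite rootE !hornerE subr_eq0 => /eqP <-; exists s.
Qed.

(* A linear relation between the three polars is a binary quadratic form; its two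
   linear factors [u] and [v] are independent, since a square would give a singular
   point. *)
Lemma line_conics e0 e1 : indep e0 e1 ->
  (forall a b, (a != 0) || (b != 0) ->
     exists w, tri (a *: e0 + b *: e1) (a *: e0 + b *: e1) w != 0) ->
  exists u v, [/\ indep u v,
    exists a b, u = a *: e0 + b *: e1, exists a b, v = a *: e0 + b *: e1 &
    (forall a b c, (forall w, a * tri u u w + b * tri u v w + c * tri v v w = 0) ->
       [/\ a = 0, b = 0 & c = 0]) \/
    (forall w, tri u v w = 0) /\
    (forall a c, (forall w, a * tri u u w + c * tri v v w = 0) -> a = 0 /\ c = 0)].
Proof.
move=> e01 sm.
have [free|] := pselect (forall a b c, (forall w, a * tri e0 e0 w + b * tri e0 e1 w
    + c * tri e1 e1 w = 0) -> [/\ a = 0, b = 0 & c = 0]).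
  exists e0, e1; split=> //; last by left.
  - by exists 1, 0; rewrite scale1r scale0r addr0.
  - by exists 0, 1; rewrite scale1r scale0r add0r.
move=> /existsNP[a /existsNP[b /existsNP[c /not_implyP[dep abc]]]].
have [p [q [r [t [pq aE bE cE]]]]] := binary_quadratic_factor a b c.
have rt : (r != 0) || (t != 0).
  apply/negPn/negP; rewrite negb_or !negbK => /andP[/eqP r0 /eqP t0].
  by apply: abc; rewrite aE bE cE r0 t0 !mulr0 addr0.
pose u := p *: e0 + q *: e1; pose v := r *: e0 + t *: e1.
have uv w : tri u v w = 0.
  by rewrite -(dep w) aE bE cE /u /v !triE (C12 e1 e0); ring.
have iuv : indep u v.
  move=> s k suv.
  have h x w : s * tri x u w + k * tri x v w = 0.
    have := congr1 (fun y => tri x y w) suv; rewrite !triE => ->.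
    by rewrite -(scale0r 0) !triE mul0r.
  split; apply/eqP/negPn/negP => nz.
    have [w /negP[]] := sm _ _ pq; apply/eqP; apply: (mulfI nz).
    by have := h u w; rewrite uv !mulr0 addr0.
  have [w /negP[]] := sm _ _ rt; apply/eqP; apply: (mulfI nz).
  by have := h v w; rewrite (C12 v u) uv !mulr0 add0r.
exists u, v; split=> //; [by exists p, q|by exists r, t|right; split=> // a' c' h].
 (* As the polar of u and v is zero, a' (u u w) + c' (v v w) is the polar of the square of s u + k
    v; smoothness forces this vector to vanish. *)
 have [s sE] := sqrt_closed a'; have [k kE] := sqrt_closed c'.
suff [s0 k0] : s = 0 /\ k = 0 by rewrite -sE -kE s0 k0 expr0n.
have E : s *: u + k *: v = (s * p + k * r) *: e0 + (s * q + k * t) *: e1.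
  by rewrite /u /v !scalerDr !scalerDl !scalerA addrACA.
clearbody u v.
have [nz|] := boolP ((s * p + k * r != 0) || (s * q + k * t != 0)).
  have [w /negP[]] := sm _ _ nz; rewrite -E !triE (C12 v u) uv; apply/eqP.
  by rewrite -[RHS](h w) -sE -kE; ring.
rewrite negb_or !negbK => /andP[/eqP h1 /eqP h2].
by apply: iuv; rewrite E h1 h2 !scale0r addr0.
Qed.

End LineOnCubic.

(** * Coordinates adapted to a line on the cubic *)

Section CoordinatesOfLine.
Variables (K : closedFieldType).
Implicit Types u v w g : 'rV[K]_5.

Definition i2 : 'I_5 := @Ordinal 5 2 isT.
Definition i3 : 'I_5 := @Ordinal 5 3 isT.
Definition i4 : 'I_5 := @Ordinal 5 4 isT.

Lemma row_free_indep m (M : 'M[K]_(m, 5)) : (forall x : 'rV_m, x *m M = 0 -> x = 0) -> row_free M.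
Proof.
move=> h; rewrite -kermx_eq0; apply/eqP/row_matrixP => i; rewrite row0; apply: h.
by apply/sub_kermxP; exact: row_sub.
Qed.

Lemma basis_completion u v g0 g1 g2 : indep u v ->
  (forall a b c, a *: g0 + b *: g1 + c *: g2 = 0 -> [/\ a = 0, b = 0 & c = 0]) ->
  (forall g, g \in [:: g0; g1; g2] -> \sum_k g 0 k * u 0 k = 0 /\ \sum_k g 0 k * v 0 k = 0) ->
  exists C : 'M[K]_5, [/\ C \in unitmx, u *m C = delta_mx 0 0, v *m C = delta_mx 0 1 &
    forall w, [/\ (w *m C) 0 i2 = \sum_k g0 0 k * w 0 k,
      (w *m C) 0 i3 = \sum_k g1 0 k * w 0 k & (w *m C) 0 i4 = \sum_k g2 0 k * w 0 k]].
Proof.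
move=> iuv free kill.
pose M : 'M[K]_(3, 5) := \matrix_(i < 3) [:: g0; g1; g2]`_i.
pose E : 'M[K]_(2, 5) := \matrix_(i < 2) [:: u; v]`_i.
have Mf : row_free M.
  apply: row_free_indep => x; rewrite mulmx_sum_row !big_ord_recl big_ord0 addr0 !rowK /= addrA.
  move=> /free[x0 x1 x2]; apply/rowP; case=> [[|[|[|//]]] lt]; rewrite mxE.
  - by rewrite -[RHS]x0; congr (x 0 _); apply: val_inj.
  - by rewrite -[RHS]x1; congr (x 0 _); apply: val_inj.
  - by rewrite -[RHS]x2; congr (x 0 _); apply: val_inj.
have Ef : row_free E.
  apply: row_free_indep => x; rewrite mulmx_sum_row !big_ord_recl big_ord0 addr0 !rowK /=.
  move=> /iuv[x0 x1]; apply/rowP; case=> [[|[|//]] lt]; rewrite mxE.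
  - by rewrite -[RHS]x0; congr (x 0 _); apply: val_inj.
  - by rewrite -[RHS]x1; congr (x 0 _); apply: val_inj.
have wM w (i : 'I_3) : (w *m M^T) 0 i = \sum_k ([:: g0; g1; g2]`_i) 0 k * w 0 k.
  by rewrite mxE; apply: eq_bigr => k _; rewrite !mxE mulrC.
have EM : E *m M^T = 0.
  apply/row_matrixP => i; rewrite row_mul row0 rowK; apply/rowP => j; rewrite wM mxE.
  have /kill[ku kv] : [:: g0; g1; g2]`_j \in [:: g0; g1; g2] by rewrite mem_nth.
  by case: i => [[|[|//]] lt].
pose C : 'M[K]_5 := row_mx (pinvmx E) M^T.
have wC w (j : 'I_3) : (w *m C) 0 (rshift 2 j) = \sum_k ([:: g0; g1; g2]`_j) 0 k * w 0 k.
  have -> : w *m C = row_mx (w *m pinvmx E) (w *m M^T) by exact: (@mul_mx_row K 1 5 2 3 w (pinvmx E) M^T).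
  by rewrite -wM; exact: (@row_mxEr K 1 2 3).
have EC (x : 'rV_2) : x *m E *m C = row_mx x 0.
  have -> : x *m E *m C = row_mx (x *m E *m pinvmx E) (x *m E *m M^T).
    by exact: (@mul_mx_row K 1 5 2 3).
  by rewrite -!mulmxA mulmxVp // mulmx1 EM mulmx0.
have row2 (j : 'I_2) (k : 'I_5) : nat_of_ord j = k -> row_mx (delta_mx 0 j) 0 = delta_mx 0 k :> 'rV[K]_5.
  move=> jk; apply/rowP => i; rewrite mxE; case: splitP => l lE; rewrite !mxE ?eqxx /= -!val_eqE /= lE -jk //.
  by have := ltn_ord j; case: eqP => // <-; lia.
exists C; split.
- rewrite -row_free_unit; apply: row_free_indep => w.
have -> : w *m C = row_mx (w *m pinvmx E) (w *m M^T).
    by exact: (@mul_mx_row K 1 5 2 3).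
  move=> h.
  have [w1 w2] : w *m pinvmx E = 0 /\ w *m M^T = 0 by apply: eq_row_mx; rewrite row_mx0.
  have : (w <= E)%MS.
    have EM' : (E <= kermx M^T)%MS by apply/sub_kermxP.
    have /andP[_ h'] : (E == kermx M^T)%MS.
      by rewrite -(geq_leqif (mxrank_leqif_eq EM')) mxrank_ker mxrank_tr (eqP Mf) (eqP Ef).
    by apply: submx_trans h'; apply/sub_kermxP.
  by move/submxP => [x xE]; move: w1; rewrite xE -mulmxA mulmxVp // mulmx1 => ->; rewrite mul0mx.
- have -> : u = delta_mx 0 (0 : 'I_2) *m E by rewrite -rowE rowK.
  by rewrite EC; apply: row2.
- have -> : v = delta_mx 0 (1 : 'I_2) *m E by rewrite -rowE rowK.
  by rewrite EC; apply: row2.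
- move=> w; split.
  + by rewrite -[RHS](wC w (@Ordinal 3 0 isT)); congr (_ 0 _); apply: val_inj.
  + by rewrite -[RHS](wC w (@Ordinal 3 1 isT)); congr (_ 0 _); apply: val_inj.
  + by rewrite -[RHS](wC w (@Ordinal 3 2 isT)); congr (_ 0 _); apply: val_inj.
Qed.

Variable T : 'I_5 -> 'I_5 -> 'I_5 -> K.
Hypothesis T12 : forall i j k, T i j k = T j i k.
Hypothesis T23 : forall i j k, T i j k = T i k j.
Hypothesis char0 : [pchar K] =i pred0.
Local Notation tri := (tri T).
Let triE := (triDl T, triDm T12, triDr T12 T23, triZl T, triZm T12, triZr T12 T23).

(** If the three polars on the line are independent they serve as coordinates, with eps = 1.
    Otherwise [line_conics] provides u, v whose mixed polar is zero; then eps = 0, and the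
    coordinate of index [i3] is any form vanishing on the line and independent of the other two. *)
Lemma cubic_line_normal_form :
  (forall u, u != 0 -> tri u u u = 0 -> exists w, tri u u w != 0) ->
  exists e0 e1 eps (C : 'M[K]_5),
  [/\ C \in unitmx, e0 *m C = delta_mx 0 0, e1 *m C = delta_mx 0 1 &
    forall w, [/\ tri e0 e0 w = (w *m C) 0 i2, 2%:R * tri e0 e1 w = eps * (w *m C) 0 i3 &
      tri e1 e1 w = (w *m C) 0 i4]].
Proof.
move=> sm; have [//|e0 [e1 [e01 t000 t001 t011 t111]]] := line_on_cubic T12 T23 char0.
have line x y z : (exists a b, x = a *: e0 + b *: e1) -> (exists a b, y = a *: e0 + b *: e1) ->
    (exists a b, z = a *: e0 + b *: e1) -> tri x y z = 0.
  move=> [a [b ->]] [a' [b' ->]] [a2 [b2 ->]].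
  rewrite !triE !(triC12 T12 e1 e0) !(triC23 T23 e0 e1 e0) t000 t001.
  by rewrite (triC23 T23 e1 e1 e0) (triC12 T12 e1 e0) t011 t111; ring.
have [a b ab|u [v [iuv lu lv alt]]] := line_conics T12 e01.
  apply: sm; last by apply: line; exists a, b.
  by apply: contraTneq ab => /e01[-> ->]; rewrite eqxx.
have h2 := char0_natS_neq0 char0 1%N.
pose cov x y : 'rV[K]_5 := \row_k tri x y (delta_mx 0 k).
have covP x y w : \sum_k cov x y 0 k * w 0 k = tri x y w.
  by rewrite [RHS]tri_delta //; apply: eq_bigr => k _; rewrite mxE.
have covD x y a x' y' b : (forall w, a * tri x y w + b * tri x' y' w = 0) <->
    a *: cov x y + b *: cov x' y' = 0.
  split=> [h|h w]; first by apply/rowP => k; rewrite !mxE h.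
  rewrite -!covP !mulr_sumr -big_split big1 // => k _ /=; rewrite !mulrA -mulrDl.
  by have := congr1 (fun y : 'rV_5 => y 0 k) h; rewrite !mxE => ->; rewrite mul0r.
case: alt => [free|[uv free]].
  have [|g|C [Cu uC vC wC]] := @basis_completion u v (cov u u) (2%:R *: cov u v) (cov v v) iuv.
  - move=> a b c h; have [|-> /eqP b2 ->] := free a (b * 2%:R) c; last first.
      by split=> //; move: b2; rewrite mulf_eq0 (negPf h2) orbF => /eqP.
    move=> w; rewrite -!covP !mulr_sumr -!big_split big1 // => k _ /=.
    have := congr1 (fun y : 'rV_5 => y 0 k * w 0 k) h; rewrite !mxE mul0r => <-; ring.
  - have z (x y w : 'rV_5) a : tri x y w = 0 -> \sum_k (a *: cov x y) 0 k * w 0 k = 0.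
      move=> h; transitivity (a * tri x y w); last by rewrite h mulr0.
      rewrite -covP mulr_sumr; apply: eq_bigr => k _.
      by rewrite !mxE mulrA.
    by rewrite !inE => /or3P[] /eqP ->; rewrite ?(covP, z) ?line.
  exists u, v, 1, C; split=> // w; have [-> -> ->] := wC w; rewrite !covP mul1r; split=> //.
  by rewrite -covP mulr_sumr; apply: eq_bigr => k _; rewrite !mxE mulrA.
pose E : 'M[K]_(2, 5) := \matrix_(i < 2) [:: u; v]`_i.
pose P : 'M[K]_(2, 5) := \matrix_(i < 2) [:: cov u u; cov v v]`_i.
(* The forms vanishing on u and v have dimension at least 3, so the two pure polars do not span
   them. *)
have /row_subPn [i yP] : ~~ (kermx E^T <= P)%MS.
  apply/negP => /mxrankS; rewrite mxrank_ker mxrank_tr.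
  by have := rank_leq_row E; have := rank_leq_row P; lia.
set y := row i _ in yP.
have yE : \sum_k y 0 k * u 0 k = 0 /\ \sum_k y 0 k * v 0 k = 0.
  have /sub_kermxP/rowP yE : (y <= kermx E^T)%MS by apply: row_sub.
  split; [have := yE 0|have := yE 1]; rewrite !mxE => h; rewrite -[RHS]h;
    by apply: eq_bigr => k _; rewrite !mxE.
have [|g|C [Cu uC vC wC]] := @basis_completion u v (cov u u) y (cov v v) iuv.
- move=> a b c h; have b0 : b = 0.
    apply/eqP/negPn/negP => b0; move/negP: yP; apply.
    have -> : y = (- (a / b)) *: cov u u + (- (c / b)) *: cov v v.
      apply: (scalerI b0); rewrite scalerDr !scalerA !mulrN ![b * (_ / _)]mulrC !divfK //.
      move/eqP: h; rewrite addrAC addr_eq0 eq_sym => /eqP h.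
      by rewrite !scaleNr -opprD -h opprK.
    rewrite addmx_sub // scalemx_sub //.
      by have := row_sub 0 P; rewrite rowK.
    by have := row_sub 1 P; rewrite rowK.
  rewrite b0 scale0r addr0 in h; have [|-> ->//] := free a c.
  by apply/covD.
- by rewrite !inE => /or3P[] /eqP ->; rewrite ?covP ?line.
exists u, v, 0, C; split=> // w; have [-> _ ->] := wC w.
by rewrite !covP uv mulr0 mul0r.
Qed.

End CoordinatesOfLine.

(** * Dense subsets of a cubic *)

Section TwoVariables.
Variable K : closedFieldType.

Lemma horner2_map (h : {poly {poly K}}) m n : h.[n%:P].[m] = (map_poly (horner_eval m) h).[n].
Proof.
have {2}-> : n = horner_eval m n%:P by rewrite horner_evalE hornerC.
by rewrite horner_map.
Qed.

Lemma poly2_nonroot (h : {poly {poly K}}) : h != 0 -> exists m n, h.[n%:P].[m] != 0.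
Proof.
rewrite -lead_coef_eq0 => /poly_nonroot[m hm].
have [|n hn] := @poly_nonroot _ (map_poly (horner_eval m) h).
  by apply: contraNneq hm => /polyP/(_ (size h).-1); rewrite coef_map coef0 -lead_coefE /= horner_evalE => ->.
by exists m, n; rewrite horner2_map.
Qed.

Lemma bivar_poly n (q : {mpoly K[n]}) (u v w : 'rV[K]_n) :
  exists P : {poly {poly K}}, forall s x, P.[x%:P].[s] = q.@[(u + s *: v + x *: w) 0].
Proof.
exists (mmap (fun a => a%:P%:P) (fun i => ((u 0 i)%:P + (v 0 i) *: 'X)%:P + (w 0 i)%:P *: 'X) q) => s x.
rewrite horner2_map -horner_evalE.
pose e : {rmorphism {poly {poly K}} -> K} := horner_eval x \o map_poly (horner_eval s).
rewrite -[LHS]/(e _) mmap_eval; last first.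
  by move=> a; rewrite /e /= map_polyC /= horner_evalE hornerC horner_evalE hornerC.
apply: meval_eq => i; rewrite /e /=.
rewrite horner_evalE rmorphD /= map_polyC /= linearZ /= map_polyX !hornerE /=.
by rewrite !horner_evalE !hornerE !mxE; ring.
Qed.

Lemma prod_XsubC_dvdp_exp (p : {poly K}) rs : all (root p) rs ->
  \prod_(z <- rs) ('X - z%:P) %| p ^+ size rs.
Proof.
elim: rs => [|z rs IH] /=; first by rewrite big_nil expr0.
by move=> /andP[pz /IH h]; rewrite big_cons exprS dvdp_mul // dvdp_XsubCl.
Qed.

(* If [g] vanished at all the roots of [f] over [h != 0], then the remainder of
   [g ^ k] by the monic polynomial [f] would vanish identically. *)
Lemma monic_curve_dense k (a : nat -> K -> K) (g : {poly {poly K}}) (h : {poly K}) s0 x0 :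
  (forall i, polynomial_fun (a i)) -> h != 0 ->
  x0 ^+ k + \sum_(i < k) a i s0 * x0 ^+ i = 0 -> g.[x0%:P].[s0] != 0 ->
  exists s x, [/\ h.[s] != 0, x ^+ k + \sum_(i < k) a i s * x ^+ i = 0 & g.[x%:P].[s] != 0].
Proof.
move=> /choice[A aA] h0 fx0 gx0; apply: contrapT => no.
pose f : {poly {poly K}} := 'X^k + \poly_(i < k) A i.
have szl : (size (\poly_(i < k) A i) < size ('X^k : {poly {poly K}}))%N.
  by rewrite size_polyXn ltnS size_poly.
have fm : f \is monic by rewrite monicE lead_coefDl // lead_coefXn.
have sf : size f = k.+1 by rewrite size_polyDl // size_polyXn.
have fE s x : f.[x%:P].[s] = x ^+ k + \sum_(i < k) a i s * x ^+ i.
  rewrite /f hornerD hornerXn horner_poly hornerD -rmorphXn hornerC; congr (_ + _).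
  rewrite horner_sum; apply: eq_bigr => i _.
  by rewrite hornerM -rmorphXn hornerC aA.
pose r := Pdiv.Ring.rmodp (g ^+ k) f.
pose q := Pdiv.Ring.rdivp (g ^+ k) f.
have gqr : g ^+ k = q * f + r := Pdiv.RingMonic.rdivp_eq fm (g ^+ k).
have szr : (size r < k.+1)%N by rewrite -sf; rewrite Pdiv.Ring.ltn_rmodpN0 ?monic_neq0.
suff r0 : r = 0.
  have := congr1 (fun p : {poly {poly K}} => p.[x0%:P].[s0]) gqr.
  rewrite r0 addr0 !hornerM fE fx0 mulr0 => /eqP.
  by rewrite (horner_exp g) (horner_exp g.[_]) expf_eq0 (negPf gx0) andbF.
have rs s : h.[s] != 0 -> map_poly (horner_eval s) r = 0.
  move=> hs; pose e := map_poly (horner_eval s).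
  have em : e f \is monic by exact: monic_map fm.
  have se : size (e f) = k.+1 by rewrite size_map_poly_id0 ?sf // (monicP fm) rmorph1 oner_neq0.
  have [rs rsE] : exists rs, e f = \prod_(z <- rs) ('X - z%:P).
    have [rs rsE] := closed_field_poly_normal (e f).
    by exists rs; rewrite {1}rsE (monicP em) scale1r.
  have szrs : size rs = k by move: se; rewrite rsE size_prod_XsubC => -[].
  have dv : e f %| e g ^+ k.
    rewrite rsE -szrs; apply: prod_XsubC_dvdp_exp; apply/allP => z zrs.
    apply: contrapT => gz; apply: no; exists s, z; split=> //.
      rewrite -fE horner2_map -/(e f) rsE; apply/eqP.
      by rewrite -rootE root_prod_XsubC.
    by rewrite horner2_map; apply/negP => gz0; apply: gz; rewrite rootE.
  have er : e f %| e r.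
    by rewrite -(dvdp_addr _ (dvdp_mull (e q) (dvdpp (e f)))) -rmorphM -rmorphD -gqr rmorphXn.
  apply/eqP/negPn/negP => nz; have := dvdp_leq nz er; rewrite se leqNgt.
  by rewrite (leq_ltn_trans (size_poly _ _) szr).
apply/polyP => i; rewrite coef0; apply/eqP/negPn/negP => ri.
have [|s] := @poly_nonroot _ (h * r`_i); first by rewrite mulf_neq0.
rewrite hornerM mulf_eq0 negb_or => /andP[hs]; apply/negP; rewrite negbK.
by have := congr1 (fun p : {poly K} => p`_i) (rs s hs); rewrite coef_map coef0 => /= <-.
Qed.

End TwoVariables.

Section CubicDensity.
Variables (K : closedFieldType) (T : 'I_5 -> 'I_5 -> 'I_5 -> K) (C : 'M[K]_5) (eps : K).
Hypothesis char0 : [pchar K] =i pred0.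
Hypothesis T12 : forall i j k, T i j k = T j i k.
Hypothesis T23 : forall i j k, T i j k = T i k j.
Hypothesis C_unit : C \in unitmx.
Local Notation tri := (tri T).
Let triE := (triDl T, triDm T12, triDr T12 T23, triZl T, triZm T12, triZr T12 T23).
Implicit Types v w : 'rV[K]_5.

Definition lcoord v i := (v *m C) 0 i.
Definition lbasis i : 'rV[K]_5 := delta_mx 0 i *m invmx C.
Local Notation y := lcoord.
Local Notation f := lbasis.

Lemma lcoordD v w i : y (v + w) i = y v i + y w i.
Proof. by rewrite /y mulmxDl mxE. Qed.
Lemma lcoordZ a v i : y (a *: v) i = a * y v i.
Proof. by rewrite /y -scalemxAl mxE. Qed.
Lemma lcoord_basis i j : y (f i) j = (i == j)%:R.
Proof. by rewrite /y /f mulmxKV // mxE eqxx eq_sym. Qed.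
Lemma lcoord_inj v w : (forall i, y v i = y w i) -> v = w.
Proof.
move=> h; rewrite -(mulmxK C_unit v) -(mulmxK C_unit w); congr (_ *m _).
by apply/rowP => i; exact: h.
Qed.

Hypothesis polar00 : forall w, tri (f 0) (f 0) w = y w i2.
Hypothesis polar01 : forall w, 2%:R * tri (f 0) (f 1) w = eps * y w i3.
Hypothesis polar11 : forall w, tri (f 1) (f 1) w = y w i4.

Lemma polyfun_comb3 (u v w : 'rV[K]_5) a i : polynomial_fun (fun s => (u + s *: v + a *: w) 0 i).
Proof.
rewrite [X in polynomial_fun X](_ : _ = fun s => (u 0 i + s * v 0 i) + a * w 0 i); last first.
  by apply/funext => s; rewrite !mxE.
by apply: polyfunD; [apply: polyfunD; [exact: polyfunC|apply: polyfunM; [exact: polyfun_id|exact: polyfunC]]|exact: polyfunC].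
Qed.

(** By [polar11], the cubic at f_1 + t f_4 is t times a polynomial in t with constant term 3, so it
    is nonzero for some t. *)
Lemma exists_off_cone : exists2 e, y e i2 = 0 & tri e e e != 0.
Proof.
pose P : {poly K} := 'X * ((tri (f i4) (f i4) (f i4)) *: 'X^2 + (3%:R * tri (f 1) (f i4) (f i4)) *: 'X
   + (3%:R)%:P).
have P0 : P != 0.
  rewrite mulf_neq0 ?polyX_eq0 //; apply/eqP => /polyP/(_ 0%N).
  rewrite !coefE /= !mulr0 !add0r => /eqP; apply/negP; exact: (char0_natS_neq0 char0 2%N).
have [t Pt] := poly_nonroot P0.
exists (1 *: f 1 + t *: f i4); first by rewrite lcoordD !lcoordZ !lcoord_basis /= !mulr0 addr0.
rewrite (tri_cube T12 T23) polar11 polar11 !lcoord_basis /=.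
by apply: contraNneq Pt => <-; rewrite /P !hornerE /=; apply/eqP; ring.
Qed.

(** On the plane p + s f_2 + x e the cubic is monic in x up to the factor F(e), and y_2 depends on s
    alone: [monic_curve_dense] moves p to a zero of the cubic with y_2 nonzero and G still
    nonzero. *)
Lemma cubic_approx_chart (G : {mpoly K[5]}) p : tri p p p = 0 -> G.@[p 0] != 0 ->
  exists q, [/\ tri q q q = 0, G.@[q 0] != 0 & y q i2 != 0].
Proof.
move=> Fp Gp; have [e e2 Fe] := exists_off_cone.
pose P s := p + s *: f i2 + 0 *: f i2.
have hP i : polynomial_fun (fun s => P s 0 i) by apply: polyfun_comb3.
have hc (v : 'rV[K]_5) i : polynomial_fun (fun s : K => v 0 i) by apply: polyfunC.
pose a i s := match i with 0%N => tri (P s) (P s) (P s) / tri e e e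
  | 1%N => 3%:R * tri (P s) (P s) e / tri e e e | _ => 3%:R * tri (P s) e e / tri e e e end.
have ha i : polynomial_fun (a i).
  have c1 := polyfunC (tri e e e)^-1; have c3 := polyfunC (3%:R : K).
  by case: i => [|[|i]]; rewrite /a; do ?[apply: polyfunM => //]; apply: polyfun_tri.
have [g gE] := bivar_poly G p (f i2) e.
have aE s x : tri (p + s *: f i2 + x *: e) (p + s *: f i2 + x *: e) (p + s *: f i2 + x *: e)
   = tri e e e * (x ^+ 3 + \sum_(i < 3) a i s * x ^+ i).
  have -> : p + s *: f i2 = 1 *: P s by rewrite /P scale0r addr0 scale1r.
  rewrite (tri_cube T12 T23) !big_ord_recl big_ord0 /= /bump /=; field; exact: Fe.
have [|||s [x [hs Fx Gx]]] := @monic_curve_dense _ 3 a g ((y p i2)%:P + 'X) 0 0 ha.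
- rewrite -size_poly_eq0 addrC size_XaddC //.
- by apply: (mulfI Fe); rewrite -aE !scale0r !addr0 mulr0.
- by rewrite gE !scale0r !addr0.
exists (p + s *: f i2 + x *: e); split; [by rewrite aE Fx mulr0|by rewrite -gE|].
by rewrite !lcoordD !lcoordZ lcoord_basis e2 eqxx mulr1 mulr0 addr0; rewrite !hornerE in hs.
Qed.

(** With y_2 = b fixed and nonzero, s moves the parameters (y_3 / y_2, y_4 / y_2) along a line,
    reaching a point where h is nonzero at s = 1. In the direction x of f_0, the cubic is quadratic
    with leading coefficient 3 b, because f_0 is on the cubic and its polar is y_2. *)
Lemma cubic_approx (G : {mpoly K[5]}) (h : {poly {poly K}}) p : h != 0 ->
  tri p p p = 0 -> G.@[p 0] != 0 ->
  exists q, [/\ tri q q q = 0, G.@[q 0] != 0, y q i2 != 0 &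
    h.[(y q i4 / y q i2)%:P].[y q i3 / y q i2] != 0].
Proof.
move=> h0 Fp0 Gp0; have [{Fp0 Gp0}p' [Fp Gp yp]] := cubic_approx_chart Fp0 Gp0.
clear p; rename p' into p.
have [m [n hmn]] := poly2_nonroot h0.
pose b := y p i2; rewrite -/b in yp.
pose c := (b * m - y p i3) *: f i3 + (b * n - y p i4) *: f i4.
pose P s := p + s *: c + 0 *: c.
have hP i : polynomial_fun (fun s => P s 0 i) by apply: polyfun_comb3.
have hc (v : 'rV[K]_5) i : polynomial_fun (fun s : K => v 0 i) by apply: polyfunC.
have c2 : y c i2 = 0 by rewrite lcoordD !lcoordZ !lcoord_basis /= !mulr0 addr0.
have P2 s : y (P s) i2 = b by rewrite /P !lcoordD !lcoordZ c2 !mulr0 !addr0.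
have h3 := char0_natS_neq0 char0 2%N.
pose a i s := match i with 0%N => tri (P s) (P s) (P s) / (3%:R * b)
  | _ => 3%:R * tri (P s) (P s) (f 0) / (3%:R * b) end.
have ha i : polynomial_fun (a i).
  have c1 := polyfunC (3%:R * b)^-1; have c3 := polyfunC (3%:R : K).
  by case: i => [|i]; rewrite /a; do ?[apply: polyfunM => //]; apply: polyfun_tri.
have [g gE] := bivar_poly G p c (f 0).
have aE s x : tri (p + s *: c + x *: f 0) (p + s *: c + x *: f 0) (p + s *: c + x *: f 0)
   = 3%:R * b * (x ^+ 2 + \sum_(i < 2) a i s * x ^+ i).
  have -> : p + s *: c = 1 *: P s by rewrite /P scale0r addr0 scale1r.
  rewrite (tri_cube T12 T23) !big_ord_recl big_ord0 /= /bump /=.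
  rewrite (triC12 T12 (P s)) (triC23 T23 (f 0)) !polar00 P2 lcoord_basis /=.
  by field; rewrite yp h3.
have [H HE] : exists H : {poly K}, forall s, H.[s]
    = h.[((y p i4 + s * (b * n - y p i4)) / b)%:P].[(y p i3 + s * (b * m - y p i3)) / b].
  have [||H HE] := @polyfun_horner2 _ h (fun s => (y p i3 + s * (b * m - y p i3)) / b)
      (fun s => (y p i4 + s * (b * n - y p i4)) / b).
  - by apply: polyfunM; [apply: polyfunD; [|apply: polyfunM; [exact: polyfun_id|]]|]; exact: polyfunC.
  - by apply: polyfunM; [apply: polyfunD; [|apply: polyfunM; [exact: polyfun_id|]]|]; exact: polyfunC.
  by exists H.
have [|||s [x [hs Fx Gx]]] := @monic_curve_dense _ 2 a g H 0 0 ha.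
- apply: contraNneq hmn => H0; have := HE 1; rewrite H0 horner0 !mul1r ![_ + (_ - _)]addrC !subrK.
  by rewrite ![b * _]mulrC !mulfK // => <-.
- by apply: (mulfI (mulf_neq0 h3 yp)); rewrite -aE !scale0r !addr0 mulr0.
- by rewrite gE !scale0r !addr0.
exists (p + s *: c + x *: f 0); split; [by rewrite aE Fx mulr0|by rewrite -gE| |].
  by rewrite !lcoordD !lcoordZ c2 lcoord_basis /= !mulr0 !addr0.
rewrite HE in hs; rewrite !lcoordD !lcoordZ c2 !lcoordD !lcoordZ !lcoord_basis /=.
by rewrite !mulr0 !mulr1 !addr0 !add0r.
Qed.

End CubicDensity.

(** * Residual points on a cubic *)

Section CubicMaps.
Variables (K : closedFieldType) (T : 'I_5 -> 'I_5 -> 'I_5 -> K) (C : 'M[K]_5) (eps : K).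
Hypothesis char0 : [pchar K] =i pred0.
Hypothesis T12 : forall i j k, T i j k = T j i k.
Hypothesis T23 : forall i j k, T i j k = T i k j.
Hypothesis C_unit : C \in unitmx.
Local Notation tri := (tri T).
Let triE := (triDl T, triDm T12, triDr T12 T23, triZl T, triZm T12, triZr T12 T23).
Let C12 := triC12 T12.
Let C23 := triC23 T23.
Local Notation y := (lcoord C).
Local Notation f := (lbasis C).
Let yE := (lcoordD, lcoordZ, lcoord_basis C_unit).
Hypothesis polar00 : forall w, tri (f 0) (f 0) w = y w i2.
Hypothesis polar01 : forall w, 2%:R * tri (f 0) (f 1) w = eps * y w i3.
Hypothesis polar11 : forall w, tri (f 1) (f 1) w = y w i4.
Variables (D : {poly K}) (ps : {poly {poly K}}).
Implicit Types (u v w : 'rV[K]_5) (M N S m n l : K).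

Lemma lcoordB v w i : y (v - w) i = y v i - y w i.
Proof. by rewrite -scaleN1r !yE mulN1r. Qed.

Lemma tri_line a b v : let w := a *: f 0 + b *: f 1 in
  tri v w w = a ^+ 2 * y v i2 + eps * a * b * y v i3 + b ^+ 2 * y v i4.
Proof.
rewrite /= !triE -polar00 -polar11 !(C12 v (f _)) !(C23 _ v) (C12 (f 1) (f 0)).
have -> : eps * a * b * y v i3 = a * b * (2%:R * tri (f 0) (f 1) v) by rewrite polar01; ring.
by ring.
Qed.

Lemma tri_line0 a b : let w := a *: f 0 + b *: f 1 in tri w w w = 0.
Proof. by rewrite /= tri_line !yE /=; ring. Qed.

(** For v and w on the cubic, F(a v + b w) = 3 a b (a (v v w) + b (v w w)). *)
Lemma cube_residual v w : tri v v v = 0 -> tri w w w = 0 ->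
  let x := tri v w w *: v - tri v v w *: w in tri x x x = 0.
Proof.
move=> Fv Fw; rewrite /= -scaleNr (tri_cube T12 T23) Fv Fw; ring.
Qed.

Definition wvec m n := ps.[n%:P].[m] *: f 0 + D.[m] *: f 1.

Definition Qpoly : {poly {poly K}} := ps ^+ 2 + (eps *: (D * 'X))%:P * ps + (D ^+ 2)%:P * 'X.

Lemma Qpoly_eval m n : Qpoly.[n%:P].[m]
  = ps.[n%:P].[m] ^+ 2 + eps * ps.[n%:P].[m] * D.[m] * m + D.[m] ^+ 2 * n.
Proof. by rewrite /Qpoly !hornerE /=; ring. Qed.

(* [4 Q] is [(2 ps + eps D m) ^ 2] minus a polynomial of degree 1 in [n]. *)
Lemma Qpoly_neq0 : D != 0 -> Qpoly != 0.
Proof.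
move=> D0; apply/eqP => Q0.
have h2 : (2%:R : {poly {poly K}}) != 0.
  by rewrite -!polyC_natr !polyC_eq0 (char0_natS_neq0 char0 1%N).
have h4 : (4%:R : K) != 0 := char0_natS_neq0 char0 3%N.
pose P : {poly {poly K}} := 2%:R * ps + (eps *: (D * 'X))%:P.
have PE : P ^+ 2 = (- (4%:R *: D ^+ 2))%:P * 'X + ((eps *: (D * 'X)) ^+ 2)%:P.
  apply/eqP; rewrite -subr_eq0; apply/eqP.
  transitivity (4%:R * Qpoly); last by rewrite Q0 mulr0.
  by rewrite /P /Qpoly -!mul_polyC !(polyCN, polyCM, polyC_natr, expr2); ring.
have sz : size (P ^+ 2) = 2%N.
  rewrite PE size_MXaddC polyC_eq0 oppr_eq0 scaler_eq0 (negPf h4) expf_eq0 (negPf D0) /=.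
  by rewrite size_polyC oppr_eq0 scaler_eq0 (negPf h4) expf_eq0 (negPf D0).
by have := size_exp P 2; rewrite sz /= muln2 => /(congr1 odd); rewrite odd_double.
Qed.

(* The third point of the cubic on the line through [v] and [w]. *)
Definition Phi v := let w := wvec (y v i3) (y v i4) in tri v w w *: v - tri v v w *: w.

Lemma Phi_cubic v : tri v v v = 0 -> tri (Phi v) (Phi v) (Phi v) = 0.
Proof. by move=> Fv; apply: cube_residual => //; apply: tri_line0. Qed.

Lemma tri_wvec v : y v i2 = 1 -> let w := wvec (y v i3) (y v i4) in
  tri v w w = Qpoly.[(y v i4)%:P].[y v i3].
Proof. by move=> v2; rewrite /= tri_line v2 Qpoly_eval; ring. Qed.

Lemma wvec_coord m n : [/\ y (wvec m n) i2 = 0, y (wvec m n) i3 = 0, y (wvec m n) i4 = 0 &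
  y (wvec m n) 1 = D.[m]].
Proof. by split; rewrite !yE /=; ring. Qed.

Lemma Phi_coord2 v : y v i2 = 1 -> y (Phi v) i2 = Qpoly.[(y v i4)%:P].[y v i3].
Proof.
move=> v2; have [w2 _ _ _] := wvec_coord (y v i3) (y v i4).
by rewrite /Phi lcoordB !lcoordZ w2 v2 tri_wvec //; ring.
Qed.

(** The image differs from a multiple of v by a multiple of w, whose coordinates y_2, y_3, y_4 are
    zero. So both points have the same parameters (m, n), hence the same w, and the construction
    runs twice on one line. *)
Lemma Phi_involution v : y v i2 = 1 -> y (Phi v) i2 != 0 ->
  Phi ((y (Phi v) i2)^-1 *: Phi v) = y (Phi v) i2 *: v.
Proof.
move=> v2; rewrite Phi_coord2 //; set q := _.[_] => q0.
have [w2 w3 w4 _] := wvec_coord (y v i3) (y v i4).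
have [u uE] : exists u, u = q^-1 *: Phi v by exists (q^-1 *: Phi v).
have www : tri (wvec (y v i3) (y v i4)) (wvec (y v i3) (y v i4)) (wvec (y v i3) (y v i4)) = 0.
  exact: tri_line0.
rewrite -uE; have [w wE] : exists w, w = wvec (y v i3) (y v i4) by exists (wvec (y v i3) (y v i4)).
rewrite -wE in w2 w3 w4 www.
have qE : tri v w w = q by rewrite wE tri_wvec.
have {}uE : u = v + (- (tri v v w / q)) *: w.
  rewrite uE /Phi -wE qE scalerBr !scalerA mulVf // scale1r scaleNr.
  by rewrite [q^-1 * _]mulrC.
have u3 : y u i3 = y v i3 by rewrite uE !yE w3 mulr0 addr0.
have u4 : y u i4 = y v i4 by rewrite uE !yE w4 mulr0 addr0.
rewrite /Phi u3 u4 -wE.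
have {}wE : tri u w w = q by rewrite uE triDl triZl qE www; ring.
have uuw : tri u u w = - tri v v w.
  rewrite uE !triE www (C12 w v) qE; field; exact: q0.
rewrite wE uuw scaleNr opprK {1}uE scalerDr scalerA mulrN mulrC divfK // scaleNr.
by rewrite subrK.
Qed.

(** On the curve this is [wvec] divided by D, as S = ps / D there; see [wvec_curve]. *)
Definition wS S := S *: f 0 + f 1.
Definition nval M S := - (S ^+ 2 + eps * (S * M)).
Definition dvec M S l := f i2 + M *: f i3 + nval M S *: f i4 + l *: f 0.
(* Parametrises by [l] the conic through [w] residual to the line in the plane of
   [dvec M S l], projected from [w]. *)
Definition psi M S l := let d := dvec M S l in let w := wS S in
  (3%:R * tri d d w) *: d - tri d d d *: w.

Lemma tri_wS v M S : y v i3 = M * y v i2 -> y v i4 = nval M S * y v i2 -> tri v (wS S) (wS S) = 0.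
Proof.
move=> v3 v4; have -> : wS S = S *: f 0 + 1 *: f 1 by rewrite scale1r.
by rewrite tri_line v3 v4 /nval; ring.
Qed.

Lemma wS_coord S : [/\ y (wS S) i2 = 0, y (wS S) i3 = 0, y (wS S) i4 = 0, y (wS S) 0 = S & y (wS S) 1 = 1].
Proof. by split; rewrite !yE /=; ring. Qed.

Lemma tri_wSS S : tri (wS S) (wS S) (wS S) = 0.
Proof. by have [w2 w3 w4 _ _] := wS_coord S; apply: (@tri_wS _ 0); rewrite ?w2 ?w3 ?w4 mulr0. Qed.

Lemma dvec_coord M S l : let d := dvec M S l in
  [/\ y d i2 = 1, y d i3 = M, y d i4 = nval M S, y d 0 = l & y d 1 = 0].
Proof. by split; rewrite !yE /=; ring. Qed.

Lemma tri_dww M S l : tri (dvec M S l) (wS S) (wS S) = 0.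
Proof. by have [d2 d3 d4 _ _] := dvec_coord M S l; apply: (@tri_wS _ M); rewrite ?d2 ?d3 ?d4 mulr1. Qed.

(** Since d w w = w w w = 0, F(a d + b w) = a^2 (a (d d d) + 3 b (d d w)), and the coefficients of
    [psi] cancel the second factor. *)
Lemma psi_cubic M S l : tri (psi M S l) (psi M S l) (psi M S l) = 0.
Proof.
rewrite /psi -scaleNr (tri_cube T12 T23) tri_dww tri_wSS; ring.
Qed.

Lemma psi_coord M S l : let d := dvec M S l in let A := 3%:R * tri d d (wS S) in
  [/\ y (psi M S l) i2 = A, y (psi M S l) i3 = A * M, y (psi M S l) i4 = A * nval M S &
      y (psi M S l) 0 - S * y (psi M S l) 1 = A * l].
Proof.
have [d2 d3 d4 d0 d1] := dvec_coord M S l; have [w2 w3 w4 w0 w1] := wS_coord S.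
by split; rewrite /psi !lcoordB !lcoordZ ?d2 ?d3 ?d4 ?d0 ?d1 ?w2 ?w3 ?w4 ?w0 ?w1; ring.
Qed.

(** The denominator of [psi] is affine in l with slope 2 S + eps M; this is the origin of the
    nondegeneracy condition in [plane_model]. *)
Lemma tri_ddw M S l : let w := wS S in
  tri (dvec M S l) (dvec M S l) w = tri (dvec M S 0) (dvec M S 0) w + l * (S *+ 2 + eps * M).
Proof.
have -> : dvec M S l = dvec M S 0 + l *: f 0 by rewrite /dvec scale0r addr0.
have [d2 d3 _ _ _] := dvec_coord M S 0; have [w2 _ _ _ _] := wS_coord S.
move: (dvec M S 0) d2 d3 => d d2 d3 /=.
have : tri (f 0) d (wS S) = S + tri (f 0) (f 1) d.
  by rewrite /wS C23 !triE polar00 d2 mulr1.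
move: (wS S) w2 => w w2 wE; rewrite !triE polar00 w2 (C12 d (f 0)) wE.
have -> : eps * M = 2%:R * tri (f 0) (f 1) d by rewrite polar01 d3.
rewrite -mulr_natr; ring.
Qed.

(* With these parameters, [dvec M S l] is [v - y_1(v) w]. *)
Lemma psi_inverse v M S : y v i2 = 1 -> y v i3 = M -> y v i4 = nval M S -> tri v v v = 0 ->
  let l := y v 0 - S * y v 1 in
  tri (dvec M S l) (dvec M S l) (wS S) = tri v v (wS S) /\
  psi M S l = (3%:R * tri v v (wS S)) *: v.
Proof.
move=> v2 v3 v4 Fv l.
have vw : tri v (wS S) (wS S) = 0 by apply: (@tri_wS _ M); rewrite v2 mulr1.
have [w2 w3 w4 w0 w1] := wS_coord S; have ww := tri_wSS S.
have dE : dvec M S l = 1 *: v + (- y v 1) *: wS S.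
  apply: (lcoord_inj C_unit) => i.
  have [d2 d3 d4 d0 d1] := dvec_coord M S l.
  rewrite [in RHS]lcoordD [in RHS]lcoordZ [y (_ *: wS S) i]lcoordZ mul1r; case: i => [[|[|[|[|[|//]]]]] lt].
  - by rewrite (_ : Ordinal lt = 0) ?d0 ?w0 /l; [ring|exact: val_inj].
  - by rewrite (_ : Ordinal lt = 1) ?d1 ?w1 /l; [ring|exact: val_inj].
  - by rewrite (_ : Ordinal lt = i2) ?d2 ?w2 ?v2; [ring|exact: val_inj].
  - by rewrite (_ : Ordinal lt = i3) ?d3 ?w3 ?v3; [ring|exact: val_inj].
  - by rewrite (_ : Ordinal lt = i4) ?d4 ?w4 ?v4; [ring|exact: val_inj].
have ddw : tri (dvec M S l) (dvec M S l) (wS S) = tri v v (wS S).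
  rewrite dE; move: (wS S) (y v 1) vw ww => w t vw ww.
  by rewrite !triE (C12 w v) vw ww; ring.
split=> //; rewrite /psi ddw; move: dE; move: (dvec M S l) (wS S) vw ww {w2 w3 w4 w0 w1 ddw} => d w vw ww dE.
rewrite {2 3 4}dE (tri_cube T12 T23) Fv vw ww.
rewrite {1}dE scalerDr !scalerA -addrA -scaleNr -scalerDl.
rewrite [X in _ + X *: _](_ : _ = 0) ?scale0r ?addr0 ?mulr1 //; ring.
Qed.

(** Serves to see that the involution is defined at general points of the surface: there [Phi v] is
    -(v v w) times a nonzero multiple of [wS S], and v v w is nonzero by this equality. *)
Lemma psi_tri M S l : let d := dvec M S l in let A := 3%:R * tri d d (wS S) in A != 0 ->
  tri (A^-1 *: psi M S l) (A^-1 *: psi M S l) (wS S) = tri d d (wS S).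
Proof.
move=> d A A0; have ww := tri_wSS S; have dw := tri_dww M S l.
have -> : A^-1 *: psi M S l = d + (- (tri d d d / A)) *: wS S.
  by rewrite /psi -/d -/A scalerBr !scalerA mulVf // scale1r scaleNr [A^-1 * _]mulrC.
move: (- _) => t; rewrite -/d in dw; move: {A A0} d (wS S) dw ww => d w dw ww.
by rewrite !triE (C12 w d) dw ww; ring.
Qed.

Lemma wvec_curve M S : D.[M] * S = ps.[(nval M S)%:P].[M] -> wvec M (nval M S) = D.[M] *: wS S.
Proof. by move=> h; rewrite /wvec -h /wS scalerDr scalerA. Qed.

Lemma Qpoly_curve M S : D.[M] * S = ps.[(nval M S)%:P].[M] -> Qpoly.[(nval M S)%:P].[M] = 0.
Proof. by move=> h; rewrite Qpoly_eval -h /nval; ring. Qed.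

Definition lform i : {mpoly K[5]} := \sum_j C j i *: 'X_j.

Lemma lform_homog i : lform i \is 1.-homog.
Proof. by apply: rpred_sum => j _; rewrite rpredZ // dhomogX /= mdeg1. Qed.

Lemma lformE i v : (lform i).@[v 0] = y v i.
Proof.
rewrite rmorph_sum /= /lcoord mxE; apply: eq_bigr => j _.
by rewrite mevalZ mevalXU mulrC.
Qed.

Lemma homogenize (q : {poly {poly K}}) : exists k (g : {mpoly K[5]}), forall v, y v i2 != 0 ->
  g.@[v 0] = y v i2 ^+ k * q.[(y v i4 / y v i2)%:P].[y v i3 / y v i2].
Proof.
pose H (h : 'rV[K]_5 -> K) := exists k (g : {mpoly K[5]}), forall v, y v i2 != 0 ->
  g.@[v 0] = y v i2 ^+ k * h v.
have HD h h' : H h -> H h' -> H (fun v => h v + h' v).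
  move=> [k [g hg]] [k' [g' hg']].
  exists (k + k')%N, (lform i2 ^+ k' * g + lform i2 ^+ k * g') => v v2.
  by rewrite mevalD !mevalM !rmorphXn /= lformE hg // hg' // exprD; ring.
have HM h h' : H h -> H h' -> H (fun v => h v * h' v).
  move=> [k [g hg]] [k' [g' hg']]; exists (k + k')%N, (g * g') => v v2.
  by rewrite mevalM hg // hg' // exprD; ring.
have HC c : H (fun=> c) by exists 0%N, c%:MP => v _; rewrite mevalC mul1r.
have Hl i : H (fun v => y v i / y v i2).
  by exists 1%N, (lform i) => v v2; rewrite lformE; field.
have H1 (p : {poly K}) : H (fun v => p.[y v i3 / y v i2]).
  elim/poly_ind: p => [|p c IH].
    by have [k [g hg]] := HC 0; exists k, g => v /hg ->; rewrite horner0.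
  have [k [g hg]] := HD _ _ (HM _ _ IH (Hl i3)) (HC c).
  by exists k, g => v /hg ->; rewrite !hornerE.
elim/poly_ind: q => [|q c [k [g hg]]].
  by have [k [g hg]] := HC 0; exists k, g => v /hg ->; rewrite !horner0.
have [k' [g' hg']] := HD _ _ (HM _ _ (ex_intro _ k (ex_intro _ g hg)) (Hl i4)) (H1 c).
exists k', g' => v /hg' ->; rewrite hornerMXaddC hornerD hornerM hornerC.
by [].
Qed.

End CubicMaps.

(** * The birational involution *)

Section Corestriction.
Variables (K : closedFieldType) (X Z : funSpace K) (A : set Z).
Variables (d : X -> sub_space A) (h : X -> Z).

(** Rational maps are total functions, so where h leaves A a value is borrowed from d. *)
Definition corestr (x : X) : sub_space A :=
  if pselect (A (h x)) is left p then exist _ (h x) (mem_set p) else d x.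

Lemma corestrE x : A (h x) -> set_val (corestr x) = h x.
Proof. by rewrite /corestr => Ax; case: pselect. Qed.

Lemma morphism_corestr x : morphism_at h x -> (\forall y \near x, A (h y)) ->
  morphism_at corestr x.
Proof.
move=> hx Ah; apply: morphism_sub; apply: morphism_near_eq hx _.
by apply: filterS Ah => y Ay /=; rewrite corestrE.
Qed.

End Corestriction.

Section RegularVectors.
Variables (K : closedFieldType) (X : funSpace K) (rX : ring_space X) (n : nat).
Implicit Types (x : X) (u v : X -> 'rV[K]_n).

Definition vregular x u := forall i, regular_at x (fun y => u y 0 i).

Lemma vregularC x (c : 'rV_n) : vregular x (fun=> c).
Proof. by move=> i; apply: regularC. Qed.

Lemma vregularD x u v : vregular x u -> vregular x v -> vregular x (fun y => u y + v y).
Proof.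
move=> hu hv i; have := regularD rX (hu i) (hv i).
by move/regular_near_eq; apply; apply: nearW => y; rewrite mxE.
Qed.

Lemma vregularZ x f u : regular_at x f -> vregular x u -> vregular x (fun y => f y *: u y).
Proof.
move=> hf hu i; have := regularM rX hf (hu i).
by move/regular_near_eq; apply; apply: nearW => y; rewrite mxE.
Qed.

Lemma vregularB x u v : vregular x u -> vregular x v -> vregular x (fun y => u y - v y).
Proof.
move=> hu hv i; have := regularB rX (hu i) (hv i).
by move/regular_near_eq; apply; apply: nearW => y; rewrite !mxE.
Qed.

Lemma vregular_neq0 x u : vregular x u -> u x != 0 -> \forall y \near x, u y != 0.
Proof.
move=> hu /rV0Pn[i ui]; apply: filterS (regular_neq0 rX (hu i) ui) => y uy.
by apply/rV0Pn; exists i.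
Qed.

End RegularVectors.

Section HyperplaneChart.
Variables (K : closedFieldType) (C : 'M[K]_5).
Local Notation P4 := (projective_space K 4).
Local Notation y := (lcoord C).

Definition hat (x : P4) := (y (hvec x) i2)^-1 *: hvec x.

Lemma hat_coord2 (x : P4) : y (hvec x) i2 != 0 -> y (hat x) i2 = 1.
Proof. by move=> x2; rewrite lcoordZ mulVf. Qed.

Lemma pt_hat (x : P4) : y (hvec x) i2 != 0 -> pt (hat x) = x.
Proof. by move=> x2; rewrite pt_scale ?invr_eq0 // pt_hvec. Qed.

Lemma lcoord0 i : y 0 i = 0.
Proof. by rewrite /lcoord mul0mx mxE. Qed.

Lemma lcoord_neq0 v i : y v i != 0 -> v != 0.
Proof. by apply: contraNneq => ->; rewrite lcoord0. Qed.

Lemma hvec_pt_coord2 v : y v i2 != 0 -> y (hvec (pt v)) i2 != 0.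
Proof.
move=> v2; have [a a0 ->] := hvec_pt (lcoord_neq0 v2).
by rewrite lcoordZ mulf_neq0.
Qed.

Lemma hat_pt v : y v i2 != 0 -> hat (pt v) = (y v i2)^-1 *: v.
Proof.
move=> v2; have [a a0 e] := hvec_pt (lcoord_neq0 v2).
by rewrite /hat e lcoordZ scalerA; congr (_ *: v); field; rewrite a0 v2.
Qed.

Lemma open_coord2 : open [set x : P4 | y (hvec x) i2 != 0].
Proof.
rewrite [X in open X](_ : _ = [set x : P4 | (lform C i2).@[hcoord x] != 0]).
  exact: open_homog_neq0 (lform_homog C i2).
by apply/seteqP; split=> x /=; rewrite hcoordE lformE.
Qed.

Lemma vregular_hat (x : P4) : y (hvec x) i2 != 0 -> vregular x hat.
Proof.
move=> x2 i.
have hX : ('X_i : {mpoly K[5]}) \is 1.-homog by rewrite dhomogX /= mdeg1.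
have q0 : (lform C i2).@[hcoord x] != 0 by rewrite hcoordE lformE.
have h : @regular_at K P4 x (fun z : P4 => ('X_i).@[hcoord z] / (lform C i2).@[hcoord z]).
  exact: (regular_proj_fraction hX (lform_homog C i2) q0).
apply: (regular_near_eq h); apply: (@nearW _ (nbhs (x : P4))) => z.
by rewrite hcoordE lformE mevalXU /hat mxE mulrC.
Qed.

Lemma regular_lcoord (X : funSpace K) (rX : ring_space X) (x : X) (u : X -> 'rV[K]_5) i :
  vregular x u -> regular_at x (fun z => y (u z) i).
Proof.
move=> hu; apply: regular_near_eq (regular_meval rX (lform C i) hu) _.
by apply: nearW => z; rewrite lformE.
Qed.

End HyperplaneChart.

Section CubicInvolution.
Variables (K : closedFieldType) (T : 'I_5 -> 'I_5 -> 'I_5 -> K) (C : 'M[K]_5) (eps : K).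
Hypothesis char0 : [pchar K] =i pred0.
Hypothesis T12 : forall i j k, T i j k = T j i k.
Hypothesis T23 : forall i j k, T i j k = T i k j.
Hypothesis C_unit : C \in unitmx.
Local Notation tri := (tri T).
Local Notation y := (lcoord C).
Local Notation f := (lbasis C).
Hypothesis polar00 : forall w, tri (f 0) (f 0) w = y w i2.
Hypothesis polar01 : forall w, 2%:R * tri (f 0) (f 1) w = eps * y w i3.
Hypothesis polar11 : forall w, tri (f 1) (f 1) w = y w i4.
Variables (D : {poly K}) (ps : {poly {poly K}}).
Hypothesis D_neq0 : D != 0.
Variables (F : {mpoly K[5]}).
Hypothesis F_homog : F \is 3.-homog.
Hypothesis FE : forall v : 'rV[K]_5, F.@[v 0] = tri v v v.

Local Notation P4 := (projective_space K 4).
Local Notation Y := ([set x : P4 | F.@[hcoord x] = 0]).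
Let rP : ring_space P4 := proj_ring_space K 4.
Let rY : ring_space (sub_space Y) := sub_ring_space Y rP.

Lemma cubic_pt v : v != 0 -> tri v v v = 0 -> Y (pt v).
Proof. by move=> v0 Fv; apply/eqP; rewrite (meval_pt F_homog v0) FE Fv. Qed.

Lemma cubic_hat (x : sub_space Y) : tri (hat C (set_val x)) (hat C (set_val x)) (hat C (set_val x)) = 0.
Proof.
have /= := set_valP x; rewrite hcoordE => h.
by rewrite -FE /hat (meval_homog _ _ F_homog) h mulr0.
Qed.

Lemma vregular_hatY (x : sub_space Y) : y (hvec (set_val x)) i2 != 0 ->
  vregular x (fun z : sub_space Y => hat C (set_val z)).
Proof. by move=> x2 i; exact: ((morphism_val x).2 _ (vregular_hat x2 i)). Qed.

Lemma near_coord2 (x : sub_space Y) : y (hvec (set_val x)) i2 != 0 ->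
  \forall z \near x, y (hvec (set_val (z : sub_space Y))) i2 != 0.
Proof.
move=> x2; apply/nbhs_subP; exists [set x : P4 | y (hvec x) i2 != 0]; split=> //.
by apply: open_nbhs_nbhs; split=> //; exact: open_coord2.
Qed.

Lemma vregular_Phi (X : funSpace K) (rX : ring_space X) (x : X) (u : X -> 'rV[K]_5) :
  vregular x u -> vregular x (fun z => Phi T C D ps (u z)).
Proof.
move=> hu.
have h3 := regular_lcoord C rX i3 hu; have h4 := regular_lcoord C rX i4 hu.
have hw : vregular x (fun z => wvec C D ps (y (u z) i3) (y (u z) i4)).
  apply: (vregularD rX); apply: (vregularZ rX) => //; try exact: vregularC.
    exact: (regular_horner2 rX).
  exact: (regular_horner rX).
by apply: (vregularB rX); apply: (vregularZ rX) => //; apply: (regular_tri T rX).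
Qed.

Definition phi : sub_space Y -> sub_space Y :=
  corestr (fun x => x) (fun x : sub_space Y => pt (Phi T C D ps (hat C (set_val x))) : P4).

(** Larger than the locus Q != 0 on which the map is inverted: it must also contain general points
    of the contracted surface, where Q = 0. *)
Definition phi_dom : set (sub_space Y) :=
  [set x | y (hvec (set_val x)) i2 != 0 /\ Phi T C D ps (hat C (set_val x)) != 0].

Lemma near_phi_dom x : phi_dom x -> \forall z \near x, phi_dom z.
Proof.
move=> [x2 Px]; have hx := vregular_Phi rY (vregular_hatY x2).
by apply: filterS2 (near_coord2 x2) (vregular_neq0 rY hx Px).
Qed.

Lemma phi_dom_Y (x : sub_space Y) : phi_dom x -> Y (pt (Phi T C D ps (hat C (set_val x)))).
Proof.
move=> [_ Px]; apply: cubic_pt Px _.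
exact: (Phi_cubic T12 T23 C_unit polar00 polar01 polar11 _ _ (cubic_hat x)).
Qed.

Lemma phiE (x : sub_space Y) : phi_dom x -> set_val (phi x) = pt (Phi T C D ps (hat C (set_val x))).
Proof. by move=> /phi_dom_Y; exact: corestrE. Qed.

Lemma phi_morphism x : phi_dom x -> morphism_at phi x.
Proof.
move=> dx; apply: morphism_corestr.
  by have [x2 Px] := dx; apply: (morphism_proj rY) => //; apply: (vregular_Phi rY); exact: vregular_hatY.
by apply: filterS (near_phi_dom dx) => z; exact: phi_dom_Y.
Qed.

Lemma phi_dom_open : open phi_dom.
Proof. by rewrite openE => x; exact: near_phi_dom. Qed.

Definition phi_inv_dom : set (sub_space Y) := [set x | y (hvec (set_val x)) i2 != 0 /\
  (Qpoly eps D ps).[(y (hat C (set_val x)) i4)%:P].[y (hat C (set_val x)) i3] != 0].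

Lemma phi_inv_dom_sub : phi_inv_dom `<=` phi_dom.
Proof.
move=> x [x2 Qx]; split=> //; apply: (@lcoord_neq0 _ C _ i2).
by rewrite (Phi_coord2 T12 T23 C_unit polar00 polar01 polar11) // hat_coord2.
Qed.

Lemma phi_inv_dom_open : open phi_inv_dom.
Proof.
rewrite openE => x [x2 Qx]; have hx := vregular_hatY x2.
apply: filterS2 (near_coord2 x2) (regular_neq0 rY (regular_horner2 rY _
  (regular_lcoord C rY i3 hx) (regular_lcoord C rY i4 hx)) Qx) => z z2 Qz.
by split.
Qed.

(** A basic open set is G != 0 for a form G, so [cubic_approx] with h = Q finds the required point
    in it. *)
Lemma phi_inv_dom_dense : dense phi_inv_dom.
Proof.
move=> O [x Ox] oO; have /nbhs_subP[V [/nbhs_projP[d [G [hG Gx GV]]] VO]] : nbhs x O.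
  by apply: open_nbhs_nbhs; split.
have Fx : tri (hvec (set_val x)) (hvec (set_val x)) (hvec (set_val x)) = 0.
  by rewrite -FE -hcoordE; exact: (set_valP x).
have [q [Fq Gq q2 Qq]] := cubic_approx char0 T12 T23 C_unit polar00 polar11
  (Qpoly_neq0 eps char0 ps D_neq0) Fx Gx.
have q0 := lcoord_neq0 q2.
exists (exist _ (pt q) (mem_set (cubic_pt q0 Fq))); split.
  apply: VO; apply: GV; change (G.@[hcoord (pt q)] != 0).
  by rewrite (meval_pt hG q0).
split; rewrite /= ?hat_pt ?hvec_pt_coord2 //.
by rewrite !lcoordZ ![_^-1 * _]mulrC.
Qed.

Lemma phi_involution x : phi_inv_dom x -> phi_dom (phi x) /\ phi (phi x) = x.
Proof.
move=> dx; have [x2 Qx] := dx; have dx' := phi_inv_dom_sub dx.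
have xh2 := hat_coord2 x2.
have P2 : y (Phi T C D ps (hat C (set_val x))) i2 != 0.
  by rewrite (Phi_coord2 T12 T23 C_unit polar00 polar01 polar11).
have inv := Phi_involution T12 T23 C_unit polar00 polar01 polar11 xh2 P2.
have hE : hat C (set_val (phi x)) = (y (Phi T C D ps (hat C (set_val x))) i2)^-1
    *: Phi T C D ps (hat C (set_val x)) by rewrite phiE // hat_pt.
have dp : phi_dom (phi x).
  split; first by rewrite phiE // hvec_pt_coord2.
  by rewrite hE inv scaler_eq0 negb_or P2 (@lcoord_neq0 _ C _ i2) // xh2 oner_neq0.
split=> //; apply: val_inj; rewrite [LHS]phiE // hE inv pt_scale // pt_hat //.
Qed.

Definition phi_ratMap : ratMap (sub_space Y) (sub_space Y) := RatMap phi_dom_open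
  (fun O O0 oO => let: ex_intro x (conj Ox dx) := phi_inv_dom_dense O0 oO in
     ex_intro _ x (conj Ox (phi_inv_dom_sub dx))) phi_morphism.

Lemma phi_Bir : Bir (sub_space Y) phi_ratMap.
Proof.
have h : rat_cancel phi_ratMap phi_ratMap.
  exists phi_inv_dom; split; [exact: phi_inv_dom_open|exact: phi_inv_dom_dense| |].
    by move=> x dx; split; [exact: phi_inv_dom_sub|exact: (phi_involution dx).1].
  by move=> x dx; exact: (phi_involution dx).2.
by exists phi_ratMap.
Qed.

End CubicInvolution.

(** * The contracted surface *)

Section ProjectiveLine.
Variable K : closedFieldType.
Local Notation P1 := (projective_space K 1).

Definition lam (z : P1) : K := hvec z 0 0 / hvec z 0 1.
Definition row2 (l : K) : 'rV[K]_2 := l *: delta_mx 0 0 + delta_mx 0 1.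

Lemma row2_0 l : row2 l 0 0 = l.
Proof. by rewrite !mxE /= mulr1 addr0. Qed.
Lemma row2_1 l : row2 l 0 1 = 1.
Proof. by rewrite !mxE /= mulr0 add0r. Qed.
Lemma row2_neq0 l : row2 l != 0.
Proof. by apply/eqP => /rowP/(_ 1)/eqP; rewrite row2_1 mxE oner_eq0. Qed.

Lemma hvec_pt_row2 l : hvec (pt (row2 l)) 0 1 != 0.
Proof. by have [a a0 ->] := hvec_pt (row2_neq0 l); rewrite mxE row2_1 mulr1. Qed.

Lemma lam_pt l : lam (pt (row2 l)) = l.
Proof.
have [a a0 e] := hvec_pt (row2_neq0 l).
have E i : (a *: row2 l) 0 i = a * row2 l 0 i by rewrite mxE.
by rewrite /lam e !E row2_0 row2_1; field.
Qed.

Lemma pt_lam (z : P1) : hvec z 0 1 != 0 -> pt (row2 (lam z)) = z.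
Proof.
move=> z1; have -> : row2 (lam z) = (hvec z 0 1)^-1 *: hvec z.
  apply/rowP => i; rewrite [RHS]mxE; case: i => [[|[|//]] lt].
    by rewrite (_ : Ordinal lt = 0) ?row2_0 1?mulrC //; apply: val_inj.
  by rewrite (_ : Ordinal lt = 1) ?row2_1 ?mulVf //; apply: val_inj.
by rewrite pt_scale ?invr_eq0 // pt_hvec.
Qed.

Lemma X1_homog n (i : 'I_n) : ('X_i : {mpoly K[n]}) \is 1.-homog.
Proof. by rewrite dhomogX /= mdeg1. Qed.

Lemma open_lam : open [set z : P1 | hvec z 0 1 != 0].
Proof.
rewrite [X in open X](_ : _ = [set z : P1 | ('X_1 : {mpoly K[2]}).@[hcoord z] != 0]).
  exact: open_homog_neq0 (X1_homog _).
by apply/seteqP; split=> x /=; rewrite mevalXU.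
Qed.

Lemma regular_lam (z : P1) : hvec z 0 1 != 0 -> regular_at z lam.
Proof.
move=> z1; have q0 : ('X_1 : {mpoly K[2]}).@[hcoord z] != 0 by rewrite mevalXU.
have h : @regular_at K P1 z (fun x : P1 => ('X_0 : {mpoly K[2]}).@[hcoord x] / ('X_1 : {mpoly K[2]}).@[hcoord x]).
  exact: (regular_proj_fraction (X1_homog 0) (X1_homog 1) q0).
apply: (regular_near_eq h); apply: (@nearW _ (nbhs (z : P1))) => x.
by rewrite !mevalXU.
Qed.

End ProjectiveLine.

Section CurvePoints.
Variables (K : closedFieldType) (k : nat) (A : set (affine_space K k)).
Hypothesis irrA : irreducible_set A.

Lemma irreducible_prime_vanishing : prime_vanishing (A : set 'rV[K]_k).
Proof.
move=> p q pq; have [_ _ h] := vanishing_ideal_prime irrA.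
by apply: (h p q) => v Av; rewrite mevalM pq.
Qed.

Lemma irreducible_neq0M (p q : {mpoly K[k]}) :
  (exists2 v : 'rV[K]_k, A v & p.@[v 0] != 0) -> (exists2 v : 'rV[K]_k, A v & q.@[v 0] != 0) ->
  exists2 v : 'rV[K]_k, A v & (p * q).@[v 0] != 0.
Proof.
move=> [v Av pv] [w Aw qw]; apply: contrapT => no.
have [u Au|h|h] := @irreducible_prime_vanishing p q.
- by apply/eqP/negPn/negP => pq; apply: no; exists u => //; rewrite mevalM.
- by rewrite h ?eqxx in pv.
- by rewrite h ?eqxx in qw.
Qed.

Lemma nonconstant_horner (m : {mpoly K[k]}) (D : {poly K}) : D != 0 ->
  (forall c, exists2 v : 'rV[K]_k, A v & m.@[v 0] != c) ->
  exists2 q : {mpoly K[k]}, forall v : 'rV[K]_k, q.@[v 0] = D.[m.@[v 0]] &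
    exists2 v : 'rV[K]_k, A v & q.@[v 0] != 0.
Proof.
move=> D0 nc; have [rs ->] := closed_field_poly_normal D.
have [v0 Av0 _] := nc 0; rewrite -lead_coef_eq0 in D0.
suff [q qE qn] : exists2 q : {mpoly K[k]},
    forall v : 'rV[K]_k, q.@[v 0] = (\prod_(z <- rs) ('X - z%:P)).[m.@[v 0]] &
    exists2 v : 'rV[K]_k, A v & q.@[v 0] != 0.
  exists (lead_coef D *: q) => [v|]; first by rewrite mevalZ qE hornerZ.
  by have [v Av qv] := qn; exists v => //; rewrite mevalZ mulf_neq0.
elim: rs => [|z rs [q qE qn]].
  exists 1 => [v|]; first by rewrite big_nil hornerC meval1.
  by exists v0 => //; rewrite meval1 oner_neq0.
exists ((m - z%:MP) * q) => [v|].
  by rewrite big_cons hornerM mevalM qE mevalB mevalC !hornerE.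
apply: irreducible_neq0M => //; have [v Av mv] := nc z; exists v => //.
by rewrite mevalB mevalC subr_eq0.
Qed.

End CurvePoints.

Section RuledSurface.
Variables (K : closedFieldType) (T : 'I_5 -> 'I_5 -> 'I_5 -> K) (C : 'M[K]_5) (eps : K).
Hypothesis char0 : [pchar K] =i pred0.
Hypothesis T12 : forall i j k, T i j k = T j i k.
Hypothesis T23 : forall i j k, T i j k = T i k j.
Hypothesis C_unit : C \in unitmx.
Local Notation tri := (tri T).
Local Notation y := (lcoord C).
Local Notation f := (lbasis C).
Hypothesis polar00 : forall w, tri (f 0) (f 0) w = y w i2.
Hypothesis polar01 : forall w, 2%:R * tri (f 0) (f 1) w = eps * y w i3.
Hypothesis polar11 : forall w, tri (f 1) (f 1) w = y w i4.
Variables (D : {poly K}) (ps : {poly {poly K}}).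
Hypothesis D_neq0 : D != 0.
Variables (F : {mpoly K[5]}).
Hypothesis F_homog : F \is 3.-homog.
Hypothesis FE : forall v : 'rV[K]_5, F.@[v 0] = tri v v v.

Local Notation P4 := (projective_space K 4).
Local Notation P1 := (projective_space K 1).
Local Notation Y := ([set x : P4 | F.@[hcoord x] = 0]).
Let rP : ring_space P4 := proj_ring_space K 4.
Let rY : ring_space (sub_space Y) := sub_ring_space Y rP.

Variables (k : nat) (A : set (affine_space K k)).
Hypothesis A_closed : closed A.
Hypothesis A_irr : irreducible_set A.
Variables (Gamma : funSpace K) (rG : ring_space Gamma).
Hypothesis G_irr : irreducible_set [set: Gamma].
Variables (U : set Gamma) (fi : sub_space U -> sub_space A) (gi : sub_space A -> sub_space U).
Hypothesis U_open : open U.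
Hypothesis fi_morphism : forall x, morphism_at fi x.
Hypothesis gi_morphism : forall x, morphism_at gi x.
Hypothesis fK : cancel fi gi.
Hypothesis gK : cancel gi fi.
Variables (m s : {mpoly K[k]}) (pc : 'I_k -> {poly {poly K}}).
Local Notation M v := (m.@[v 0]).
Local Notation S v := (s.@[v 0]).
Local Notation N v := (nval eps (M v) (S v)).
Hypothesis M_nonconst : forall c, exists2 v : 'rV[K]_k, A v & M v != c.
Hypothesis pcE : forall v : 'rV[K]_k, A v -> forall i, D.[M v] * v 0 i = (pc i).[(N v)%:P].[M v].
Hypothesis psE : forall v : 'rV[K]_k, A v -> D.[M v] * S v = ps.[(N v)%:P].[M v].
Hypothesis nondeg : exists2 v : 'rV[K]_k, A v & S v *+ 2 + eps * M v != 0.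

Local Notation GP := (prod_space Gamma P1).
Let rP1 : ring_space P1 := proj_ring_space K 1.
Let rGP : ring_space GP := prod_ring_space rG rP1.

Definition av (g : Gamma) : 'rV[K]_k :=
  if pselect (U g) is left p then set_val (fi (exist _ g (mem_set p))) else 0.

Lemma avE (u : sub_space U) : av (set_val u) = set_val (fi u).
Proof.
rewrite /av; case: pselect => [p|]; last by have := set_valP u.
by congr (set_val (fi _)); apply: val_inj.
Qed.

Lemma av_A g : U g -> A (av g).
Proof. by rewrite /av => Ug; case: pselect => // p; exact: set_valP. Qed.

Lemma av_gi (b : sub_space A) : av (set_val (gi b)) = set_val b.
Proof. by rewrite avE gK. Qed.

Lemma vregular_av g : U g -> vregular g av.
Proof.
move=> Ug i; pose u : sub_space U := exist _ g (mem_set Ug).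
apply: (@regular_open_sub _ Gamma U u (fun g => av g 0 i) U_open).
have h : regular_at u (fun x : sub_space U => (set_val (fi x) : 'rV[K]_k) 0 i).
  have h1 : morphism_at ((set_val : sub_space A -> affine_space K k) \o fi) u.
    by apply: morphism_comp; [exact: fi_morphism | exact: morphism_val].
  exact: (h1.2 _ (regular_affine_coord _ i)).
apply: (regular_near_eq h); apply: (@nearW _ (nbhs (u : sub_space U))) => x.
by rewrite /= avE.
Qed.

Definition psiv (z : GP) : 'rV[K]_5 := psi T C eps (M (av z.1)) (S (av z.1)) (lam z.2).

Definition psi_dom : set GP :=
  [set z | [/\ U z.1, D.[M (av z.1)] != 0, hvec z.2 0 1 != 0 & y (psiv z) i2 != 0]].

Lemma vregular_avfst (z : GP) : U z.1 -> vregular z (fun x : GP => av x.1).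
Proof. by move=> Uz i; exact: ((morphism_fst rG rP1 z).2 _ (vregular_av Uz i)). Qed.

Lemma vregular_psi (z : GP) : U z.1 -> hvec z.2 0 1 != 0 -> vregular z psiv.
Proof.
move=> Uz z1; have ha := vregular_avfst Uz.
have hm := regular_meval rGP m ha; have hs := regular_meval rGP s ha.
have hl : regular_at z (fun x : GP => lam x.2) := (morphism_snd rG rP1 z).2 _ (regular_lam z1).
have hn : regular_at z (fun x : GP => N (av x.1)).
  apply: (regularN rGP); apply: (regularD rGP); first exact: (regularX rGP).
  by apply: (regularM rGP); [exact: (regularC rGP)|exact: (regularM rGP)].
have hw : vregular z (fun x : GP => wS C (S (av x.1))).
  by apply: (vregularD rGP); [apply: (vregularZ rGP) => //|]; exact: (vregularC rGP).
have hd : vregular z (fun x : GP => dvec C eps (M (av x.1)) (S (av x.1)) (lam x.2)).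
  do 3?[apply: (vregularD rGP)]; try exact: (vregularC rGP);
    by apply: (vregularZ rGP) => //; exact: (vregularC rGP).
apply: (vregularB rGP); apply: (vregularZ rGP) => //.
  by apply: (regularM rGP); [exact: (regularC rGP)|exact: (regular_tri T rGP)].
exact: (regular_tri T rGP).
Qed.

Lemma near_psi_dom z : psi_dom z -> \forall x \near z, psi_dom x.
Proof.
move=> [Uz Dz z1 Az].
have nU : \forall x \near z, U (x : GP).1.
  by apply: (morphism_fst rG rP1 z).1; apply: open_nbhs_nbhs; split.
have n1 : \forall x \near z, hvec (x : GP).2 0 1 != 0.
  exact: (morphism_snd rG rP1 z).1 (open_nbhs_nbhs (conj (@open_lam K) z1)).
have nD := regular_neq0 rGP (regular_horner rGP D (regular_meval rGP m (vregular_avfst Uz))) Dz.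
have nA := regular_neq0 rGP (regular_lcoord C rGP i2 (vregular_psi Uz z1)) Az.
by apply: filterS2 (filterI nU n1) (filterI nD nA) => x [Ux x1] [Dx Ax].
Qed.

Lemma psi_dom_open : open psi_dom.
Proof. by rewrite openE => z; exact: near_psi_dom. Qed.

Lemma GP_irr : irreducible_set [set: GP].
Proof. by apply: irreducible_prod => //; exact: irreducible_proj. Qed.

Lemma psiv_coord z : let v := av z.1 in
  [/\ y (psiv z) i3 = y (psiv z) i2 * M v, y (psiv z) i4 = y (psiv z) i2 * N v &
      y (psiv z) 0 - S v * y (psiv z) 1 = y (psiv z) i2 * lam z.2].
Proof. have [e2 e3 e4 e0] := psi_coord T eps C_unit (M (av z.1)) (S (av z.1)) (lam z.2).
by rewrite /psiv; split; rewrite ?e0 ?e3 ?e4 e2. Qed.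

Lemma psi_Y z : psi_dom z -> Y (pt (psiv z)).
Proof.
move=> [_ _ _ Az]; apply: (cubic_pt F_homog FE) (lcoord_neq0 Az) _.
exact: (psi_cubic T12 T23 C_unit polar00 polar01 polar11).
Qed.

Lemma good_point c : exists v : 'rV[K]_k,
  [/\ A v, D.[M v] != 0, M v != c & S v *+ 2 + eps * M v != 0].
Proof.
have [q qE qn] := nonconstant_horner A_irr D_neq0 M_nonconst.
have mc : exists2 v : 'rV[K]_k, A v & (m - c%:MP).@[v 0] != 0.
  by have [v Av mv] := M_nonconst c; exists v => //; rewrite mevalB mevalC subr_eq0.
have ndE (v : 'rV[K]_k) : (s *+ 2 + eps *: m).@[v 0] = S v *+ 2 + eps * M v.
  by rewrite mevalD mevalMn mevalZ.
have nd : exists2 v : 'rV[K]_k, A v & (s *+ 2 + eps *: m).@[v 0] != 0.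
  by have [v Av nv] := nondeg; exists v => //; rewrite ndE.
have [v Av] := irreducible_neq0M A_irr (irreducible_neq0M A_irr qn mc) nd.
rewrite !mevalM mevalB mevalC qE ndE !mulf_eq0 !negb_or subr_eq0.
by move=> /andP[/andP[Dv mv] nv]; exists v.
Qed.

(** Two points over one point of the curve, which itself can avoid a given value of M: this supplies
    a base point and the strict inclusions point < fibre < surface. *)
Lemma psi_dom_exists c : exists z z' : GP,
  [/\ psi_dom z /\ psi_dom z', z.1 = z'.1, lam z.2 != lam z'.2 & M (av z.1) != c].
Proof.
have [v [Av Dv Mv nv]] := good_point c.
pose b : sub_space A := exist _ v (mem_set Av); pose g := set_val (gi b).
have gE : av g = v by rewrite /g av_gi.
have Ug : U g by exact: set_valP.
have h3 := char0_natS_neq0 char0 2%N.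
set t := tri (dvec C eps (M v) (S v) 0) (dvec C eps (M v) (S v) 0) (wS C (S v)).
have dom l : t + l * (S v *+ 2 + eps * M v) != 0 -> psi_dom (g, pt (row2 l)).
  move=> h; split; rewrite /= ?gE ?hvec_pt_row2 //.
  rewrite /psiv /= gE lam_pt; have [-> _ _ _] := psi_coord T eps C_unit (M v) (S v) l.
  by rewrite mulf_neq0 // (tri_ddw T12 T23 C_unit polar00 polar01).
(* By [tri_ddw] these parameters give [tri d d w] the values 1 and 2, both nonzero. *)
exists (g, pt (row2 ((1 - t) / (S v *+ 2 + eps * M v)))).
exists (g, pt (row2 ((2%:R - t) / (S v *+ 2 + eps * M v)))).
split; rewrite /= ?lam_pt ?gE //.
  split; apply: dom; rewrite divfK // addrC subrK ?oner_neq0 //.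
  exact: (char0_natS_neq0 char0 1%N).
rewrite -subr_eq0 -mulrBl mulf_neq0 ?invr_eq0 // opprB addrA subrK.
by rewrite -opprB oppr_eq0 (_ : 2%:R - 1 = 1) ?oner_neq0 //; ring.
Qed.

Variables (z0 : GP).
Hypothesis z0_dom : psi_dom z0.

Definition psiY0 : sub_space Y := exist _ (pt (psiv z0)) (mem_set (psi_Y z0_dom)).
Definition psiY : GP -> sub_space Y := corestr (fun _ => psiY0) (fun z => pt (psiv z) : P4).

Lemma psiYE z : psi_dom z -> set_val (psiY z) = pt (psiv z).
Proof. by move=> /psi_Y; exact: corestrE. Qed.

Lemma psiY_morphism z : psi_dom z -> morphism_at psiY z.
Proof.
move=> dz; apply: morphism_corestr.
  have [Uz _ z1 Az] := dz; apply: (morphism_proj rGP) (lcoord_neq0 Az).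
  exact: vregular_psi.
by apply: filterS (near_psi_dom dz) => x; exact: psi_Y.
Qed.

Definition surface : set (sub_space Y) := closure (psiY @` psi_dom).

Lemma surface_psi z : psi_dom z -> surface (psiY z).
Proof. by move=> dz; apply: subset_closure; exists z. Qed.

Lemma psi_dom_irr : irreducible_set psi_dom.
Proof.
have := irreducible_open GP_irr psi_dom_open; rewrite setTI; apply.
by exists z0.
Qed.

Lemma surface_irr : irreducible_set surface.
Proof.
apply: irreducible_closure; apply: irreducible_image psi_dom_irr _ => z dz.
exact: (psiY_morphism dz).1.
Qed.

Definition psiV0 : sub_space surface := exist _ (psiY z0) (mem_set (surface_psi z0_dom)).
Definition psiV : GP -> sub_space surface := corestr (fun _ => psiV0) psiY.

Lemma psiVE z : psi_dom z -> set_val (psiV z) = psiY z.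
Proof. by move=> /surface_psi; exact: corestrE. Qed.

Lemma psiV_morphism z : psi_dom z -> morphism_at psiV z.
Proof.
move=> dz; apply: morphism_corestr; first exact: psiY_morphism.
by apply: filterS (near_psi_dom dz) => x; exact: surface_psi.
Qed.

Local Notation xh x := (hat C (set_val (x : sub_space Y))).
Definition mx (x : sub_space Y) := y (xh x) i3.
Definition nx (x : sub_space Y) := y (xh x) i4.
(** The plane model inverted: the point of the curve as a function of the parameters (m, n) of x. *)
Definition vx (x : sub_space Y) : 'rV[K]_k := \row_i ((pc i).[(nx x)%:P].[mx x] / D.[mx x]).
Definition inv_dom : set (sub_space Y) := [set x | y (hvec (set_val x)) i2 != 0 /\ D.[mx x] != 0].

Lemma regular_mx (x : sub_space Y) : y (hvec (set_val x)) i2 != 0 -> regular_at x mx.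
Proof. by move=> x2; apply: (regular_lcoord C rY); exact: vregular_hatY. Qed.

Lemma regular_nx (x : sub_space Y) : y (hvec (set_val x)) i2 != 0 -> regular_at x nx.
Proof. by move=> x2; apply: (regular_lcoord C rY); exact: vregular_hatY. Qed.

Lemma near_inv_dom x : inv_dom x -> \forall z \near x, inv_dom z.
Proof.
move=> [x2 Dx]; apply: filterS2 (near_coord2 x2)
  (regular_neq0 rY (regular_horner rY D (regular_mx x2)) Dx) => z z2 Dz.
by split.
Qed.

Lemma vregular_vx x : inv_dom x -> vregular x vx.
Proof.
move=> [x2 Dx] i; have hm := regular_mx x2; have hn := regular_nx x2.
have h := regular_div rY (regular_horner2 rY (pc i) hm hn) (regular_horner rY D hm) Dx.
by apply: (regular_near_eq h); apply: (@nearW _ (nbhs (x : sub_space Y))) => z; rewrite mxE.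
Qed.

Lemma psiY_hat z : psi_dom z -> let v := av z.1 in
  [/\ inv_dom (psiY z), mx (psiY z) = M v, nx (psiY z) = N v, vx (psiY z) = v &
    y (xh (psiY z)) 0 - S v * y (xh (psiY z)) 1 = lam z.2].
Proof.
move=> dz v; have [Uz Dz z1 Az] := dz; have Av := av_A Uz.
have [c3 c4 c0] := psiv_coord z; rewrite -/v in c3 c4 c0 Dz.
have hE : xh (psiY z) = (y (psiv z) i2)^-1 *: psiv z by rewrite psiYE // hat_pt.
have mE : mx (psiY z) = M v by rewrite /mx hE lcoordZ c3 mulKf.
have nE : nx (psiY z) = N v by rewrite /nx hE lcoordZ c4 mulKf.
split=> //.
- by split; [rewrite psiYE // hvec_pt_coord2 | rewrite mE].
- by apply/rowP => i; rewrite mxE mE nE -pcE // mulrC mulKf.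
- by rewrite hE !lcoordZ mulrCA -mulrBr c0 mulKf.
Qed.

Lemma surface_vanish (h : sub_space Y -> K) x : surface x -> inv_dom x -> regular_at x h ->
  (forall z, psi_dom z -> h (psiY z) = 0) -> h x = 0.
Proof.
move=> Vx dx hx h0; apply/eqP/negPn/negP => hx0.
have [_ [[z dz <-] hz]] := Vx _ (regular_neq0 rY hx hx0).
by rewrite h0 ?eqxx in hz.
Qed.

(** Each claim amounts to the vanishing of regular functions which is known on the parametrised
    points by [psiY_hat], and passes to their closure. *)
Lemma surface_vx x : surface x -> inv_dom x ->
  [/\ A (vx x), M (vx x) = mx x & N (vx x) = nx x].
Proof.
move=> Vx dx; have [x2 Dx] := dx.
have hv := vregular_vx dx; have hm := regular_mx x2; have hn := regular_nx x2.
have hM := regular_meval rY m hv; have hS := regular_meval rY s hv.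
split.
- apply: contrapT => nA; have [q [qx qA]] := affine_closedP A_closed nA.
  move: qx; rewrite (@surface_vanish (fun x => q.@[vx x 0]) x) ?eqxx //.
    exact: (regular_meval rY).
  move=> z dz; have [_ _ _ -> _] := psiY_hat dz; apply: qA.
  by have [Uz _ _ _] := dz; exact: av_A.
- apply/eqP; rewrite -subr_eq0; apply/eqP.
  apply: (@surface_vanish (fun x => M (vx x) - mx x)) => //; first exact: (regularB rY).
  by move=> z dz; have [_ -> _ -> _] := psiY_hat dz; rewrite subrr.
- apply/eqP; rewrite -subr_eq0; apply/eqP.
  apply: (@surface_vanish (fun x => N (vx x) - nx x)) => //.
    apply: (regularB rY) => //; apply: (regularN rY); apply: (regularD rY); first exact: (regularX rY).
    by apply: (regularM rY); [exact: (regularC rY)|exact: (regularM rY)].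
  by move=> z dz; have [_ _ -> -> _] := psiY_hat dz; rewrite subrr.
Qed.

Let Uz0 : U z0.1. Proof. by have [] := z0_dom. Qed.
Definition gamma0 : sub_space U := exist _ z0.1 (mem_set Uz0).

Definition inv_a (x : sub_space surface) : sub_space A :=
  corestr (fun _ => fi gamma0)
    (fun x : sub_space surface => vx (set_val x) : affine_space K k) x.

(** Projection from w = S f_0 + f_1: the form y_0 - S y_1 vanishes at w, and its value on the
    normalised point is the parameter l. *)
Definition inv_l (x : sub_space surface) : K :=
  y (xh (set_val x)) 0 - S (vx (set_val x)) * y (xh (set_val x)) 1.

Definition inv (x : sub_space surface) : GP := (set_val (gi (inv_a x)), pt (row2 (inv_l x))).

Definition inv_domV : set (sub_space surface) := set_val @^-1` inv_dom.

Lemma inv_aE x : inv_domV x -> set_val (inv_a x) = vx (set_val x).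
Proof. by move=> dx; apply: corestrE; have [] := surface_vx (set_valP x) dx. Qed.

Lemma inv_domV_open : open inv_domV.
Proof.
rewrite openE => x dx; apply/nbhs_subP; exists inv_dom; split=> //; exact: near_inv_dom.
Qed.

Lemma inv_a_morphism x : inv_domV x -> morphism_at inv_a x.
Proof.
move=> dx; have rV := sub_ring_space surface rY.
apply: morphism_corestr.
  by apply: (morphism_affine rV) => i; exact: ((morphism_val x).2 _ (vregular_vx dx i)).
have : nbhs x inv_domV by apply: open_nbhs_nbhs; split=> //; exact: inv_domV_open.
by apply: filterS => w dw; have [] := surface_vx (set_valP w) dw.
Qed.

Lemma inv_morphism x : inv_domV x -> morphism_at inv x.
Proof.
move=> dx; have rV := sub_ring_space surface rY.
apply: (morphism_pair rG rP1 rV).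
  apply: morphism_comp; last exact: morphism_val.
  by apply: morphism_comp; [exact: inv_a_morphism | exact: gi_morphism].
apply: (morphism_proj rV) (row2_neq0 _) => i.
have [x2 Dx] := dx; have hx := vregular_hatY x2.
have hl : regular_at (set_val x) (fun x => y (xh x) 0 - S (vx x) * y (xh x) 1).
  apply: (regularB rY); first exact: (regular_lcoord C rY).
  apply: (regularM rY); last exact: (regular_lcoord C rY).
  exact: (regular_meval rY s (vregular_vx dx)).
have : vregular x (fun x => row2 (inv_l x)); last by apply.
apply: (vregularD rV); last exact: (vregularC rV).
apply: (vregularZ rV); last exact: (vregularC rV).
exact: ((morphism_val x).2 _ hl).
Qed.

Lemma inv_psi z : psi_dom z -> inv_domV (psiV z) /\ inv (psiV z) = z.
Proof.
move=> dz; have [Uz _ z1 _] := dz; have vE := psiVE dz.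
have [d1 mE nE aE lE] := psiY_hat dz.
have dV : inv_domV (psiV z) by rewrite /inv_domV /= vE.
split=> //; rewrite /inv /inv_l vE aE lE pt_lam //.
have -> : inv_a (psiV z) = fi (exist _ z.1 (mem_set Uz)).
  pose u : sub_space U := exist _ z.1 (mem_set Uz).
  by apply: val_inj; rewrite [LHS]inv_aE // vE aE; exact: (avE u).
by rewrite fK [RHS]surjective_pairing.
Qed.

Lemma psi_inv x : inv_domV x -> psi_dom (inv x) -> psiV (inv x) = x.
Proof.
move=> dx di; have [x2 Dx] := dx; have [Ax Mx Nx] := surface_vx (set_valP x) dx.
have aE : av (inv x).1 = vx (set_val x) by rewrite /= av_gi inv_aE.
have [_ h] := psi_inverse T12 T23 C_unit polar00 polar01 polar11
  (hat_coord2 x2) (esym Mx) (esym Nx) (cubic_hat C F_homog FE (set_val x)).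
have pE : psiv (inv x) = psi T C eps (M (vx (set_val x))) (S (vx (set_val x))) (inv_l x).
  by rewrite /psiv aE lam_pt.
rewrite -/(inv_l x) -pE in h.
have c0 : 3%:R * tri (xh (set_val x)) (xh (set_val x)) (wS C (S (vx (set_val x)))) != 0.
  have [_ _ _] := di; rewrite h lcoordZ => /eqP nz; apply/eqP => e; apply: nz.
  by rewrite e mul0r.
apply: val_inj; rewrite [LHS]psiVE //; apply: val_inj; rewrite [LHS]psiYE // h pt_scale // pt_hat //.
Qed.

Lemma irr_surface : irreducible_set [set: sub_space surface].
Proof. exact: (irreducible_sub surface).1 surface_irr. Qed.

Lemma inv_domV_dense : dense inv_domV.
Proof.
apply: irreducible_dense irr_surface inv_domV_open _.
by exists (psiV z0); exact: (inv_psi z0_dom).1.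
Qed.

Lemma psi_dom_dense : dense psi_dom.
Proof. by apply: irreducible_dense GP_irr psi_dom_open _; exists z0. Qed.

Definition inv_ratMap : ratMap (sub_space surface) GP :=
  RatMap inv_domV_open inv_domV_dense inv_morphism.
Definition psi_ratMap : ratMap GP (sub_space surface) :=
  RatMap psi_dom_open psi_dom_dense psiV_morphism.

Lemma surface_birational : birational (sub_space surface) GP.
Proof.
exists inv_ratMap, psi_ratMap; split.
  pose W := [set x | inv_domV x /\ psi_dom (inv x)].
  have oW : open W.
    rewrite openE => x [dx di]; apply: filterS2 (open_nbhs_nbhs (conj inv_domV_open dx))
      ((inv_morphism dx).1 _ (open_nbhs_nbhs (conj psi_dom_open di))) => w dw dv.
    by split.
  exists W; split=> //.
  - apply: irreducible_dense irr_surface oW _; exists (psiV z0).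
    by have [d e] := inv_psi z0_dom; split=> //; rewrite e.
  - by move=> x [dx di]; exact: psi_inv.
exists psi_dom; split; [exact: psi_dom_open|exact: psi_dom_dense| |].
  by move=> z dz; split=> //; exact: (inv_psi dz).1.
by move=> z dz; exact: (inv_psi dz).2.
Qed.

(** * Dimensions of the surface and of its image *)

Let hY : sub_space Y -> P4 := id \o set_val.
Let sep_hY : separating hY := separating_val Y (separating_id K 4).
Let hV : sub_space surface -> P4 := hY \o set_val.
Let sep_hV : separating hV := separating_val surface sep_hY.

Lemma prime_vanishing_all n : prime_vanishing [set: 'rV[K]_n].
Proof.
move=> p q pq; apply: contrapT => /not_orP[].
move=> /existsNP[u /not_implyP[_ /eqP pu]] /existsNP[v /not_implyP[_ /eqP qv]].
have [P PE] := line_poly p u (v - u); have [Q QE] := line_poly q u (v - u).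
have [|t] := @poly_nonroot _ (P * Q).
  rewrite mulf_neq0 //; first by apply: contraNneq pu => P0; have := PE 0; rewrite P0 horner0 scale0r addr0 => <-.
  by apply: contraNneq qv => Q0; have := QE 1; rewrite Q0 horner0 scale1r addrC subrK => <-.
by rewrite hornerM PE QE pq ?eqxx.
Qed.

Definition ruled_param (t : 'rV[K]_3) (a : 'rV[K]_k) : 'rV[K]_5 :=
  t 0 0 *: f 0 + t 0 1 *: f 1 + t 0 2%:R *: (f i2 + M a *: f i3 + N a *: f i4).

(** The union of the planes through the line that lie over the curve, as a cone in K^5. It
    interposes an irreducible set between K^5 and the cone over the surface, so that each of the two
    equations lowers the dimension by one. *)
Definition ruled : set 'rV[K]_5 := [set v | exists t a, A a /\ v = ruled_param t a].

Lemma ruled_param_coord t a : let v := ruled_param t a in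
  [/\ y v i2 = t 0 2%:R, y v i3 = t 0 2%:R * M a, y v i4 = t 0 2%:R * N a, y v 0 = t 0 0 &
    y v 1 = t 0 1].
Proof. by split; rewrite !(lcoordD, lcoordZ, lcoord_basis C_unit) /=; ring. Qed.

Lemma ruledP v a : A a -> y v i3 = y v i2 * M a -> y v i4 = y v i2 * N a -> ruled v.
Proof.
move=> Aa v3 v4; pose t : 'rV[K]_3 := \row_i [:: y v 0; y v 1; y v i2]`_i.
exists t, a; split=> //; have [c2 c3 c4 c0 c1] := ruled_param_coord t a.
apply: (lcoord_inj C_unit); case=> [[|[|[|[|[|//]]]]] lt].
- by rewrite (_ : Ordinal lt = 0) ?c0 ?mxE //; exact: val_inj.
- by rewrite (_ : Ordinal lt = 1) ?c1 ?mxE //; exact: val_inj.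
- by rewrite (_ : Ordinal lt = i2) ?c2 ?mxE //; exact: val_inj.
- by rewrite (_ : Ordinal lt = i3) ?c3 ?v3 ?mxE //; exact: val_inj.
- by rewrite (_ : Ordinal lt = i4) ?c4 ?v4 ?mxE //; exact: val_inj.
Qed.

Lemma ruled_prime : prime_vanishing ruled.
Proof.
apply: (prime_vanishing_image (irreducible_prime_vanishing A_irr)) => [t u a p|t p].
  have [P PE] := line_poly p (ruled_param t a) (ruled_param u a); exists P => c.
  rewrite PE; congr (p.@[fun_of_matrix _ 0]); apply: (lcoord_inj C_unit) => i.
  rewrite !(lcoordD, lcoordZ) !mxE; ring.
pose n : {mpoly K[k]} := - (s ^+ 2 + eps *: (s * m)).
pose c j : {mpoly K[k]} := (t 0 0 * f 0 0 j + t 0 1 * f 1 0 j + t 0 2%:R * f i2 0 j)%:MP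
  + (t 0 2%:R * f i3 0 j) *: m + (t 0 2%:R * f i4 0 j) *: n.
exists (mmap (@mpolyC k K) c p) => a.
rewrite (mmap_eval (e := meval (a 0))) /=; last by move=> ?; rewrite mevalC.
apply: meval_eq => j; rewrite /c /n !(mevalD, mevalZ, mevalC, mevalN, rmorphXn, mevalM) /=.
by rewrite /ruled_param /nval !mxE; ring.
Qed.

Lemma ruled_equation : exists g : {mpoly K[5]}, [/\ forall v, ruled v -> g.@[v 0] = 0,
  exists v : 'rV[K]_5, g.@[v 0] != 0 &
  forall v : 'rV[K]_5, g.@[v 0] = 0 -> y v i2 != 0 ->
    (Qpoly eps D ps).[(y v i4 / y v i2)%:P].[y v i3 / y v i2] = 0].
Proof.
have [r [g hg]] := homogenize C (Qpoly eps D ps).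
(* [homogenize] says nothing where y_2 = 0; the factor y_2 makes the product vanish there too. *)
exists (lform C i2 * g); split.
- move=> _ [t [a [Aa ->]]]; have [c2 c3 c4 _ _] := ruled_param_coord t a.
  rewrite mevalM lformE c2; have [->|t0] := eqVneq (t 0 2%:R) 0; first by rewrite mul0r.
  rewrite hg c2 // c3 c4 ![_ * _ / t 0 2%:R]mulrAC divff // !mul1r.
  by rewrite Qpoly_curve ?mulr0 // psE.
- have [a [b ab]] := poly2_nonroot (Qpoly_neq0 eps char0 ps D_neq0).
  exists (f i2 + a *: f i3 + b *: f i4).
  have e2 : y (f i2 + a *: f i3 + b *: f i4) i2 = 1 by rewrite !(lcoordD, lcoordZ, lcoord_basis C_unit) /=; ring.
  have e3 : y (f i2 + a *: f i3 + b *: f i4) i3 = a by rewrite !(lcoordD, lcoordZ, lcoord_basis C_unit) /=; ring.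
  have e4 : y (f i2 + a *: f i3 + b *: f i4) i4 = b by rewrite !(lcoordD, lcoordZ, lcoord_basis C_unit) /=; ring.
  by rewrite mevalM lformE hg e2 ?oner_neq0 // e3 e4 !divr1 expr1n !mul1r.
- move=> v gv v2; move/eqP: gv; rewrite mevalM lformE hg // !mulf_eq0 expf_eq0 (negPf v2).
  by rewrite andbF /= => /eqP.
Qed.

Lemma cone_psi : cone (hY @` (psiY @` psi_dom)) `<=` ruled.
Proof.
move=> _ [t [_ [[_ [z dz <-] <-] ->]]]; have [c3 c4 _] := psiv_coord z.
have [Uz _ _ Az] := dz; apply: (ruledP (av_A Uz));
  rewrite /hY /= psiYE //; have [a a0 ->] := hvec_pt (lcoord_neq0 Az); rewrite !lcoordZ ?c3 ?c4; ring.
Qed.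

(** Starting from [alg_dep 6] on K^5, the equation of [ruled] gives [alg_dep 5] and the cubic F
    gives [alg_dep 4], that is, a cone of dimension at most 3. *)
Lemma alg_dep_surface : alg_dep 4 (cone (hY @` surface)).
Proof.
apply: (alg_dep_closure sep_hY).
have [g [g0 gn _]] := ruled_equation.
have d5 : alg_dep 5 ruled.
  apply: (alg_dep_drop (@prime_vanishing_all 5) _ g0) (@alg_dep_all K 5) => //.
  by have [v gv] := gn; exists v.
apply: (alg_dep_drop ruled_prime cone_psi _ _ d5 (g := F)).
  move=> _ [t [_ [[x _ <-] ->]]]; rewrite (meval_homog _ _ F_homog).
  by have /= := set_valP x; rewrite hcoordE => ->; rewrite mulr0.
have [Uz _ z1 Az] := z0_dom; have Av := av_A Uz.
pose d := dvec C eps (M (av z0.1)) (S (av z0.1)) (lam z0.2); pose w := wS C (S (av z0.1)).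
have [d2 d3 d4 _ _] : let d := dvec C eps (M (av z0.1)) (S (av z0.1)) (lam z0.2) in _ := dvec_coord eps C_unit (M (av z0.1)) (S (av z0.1)) (lam z0.2).
have [w2 w3 w4 _ _] := wS_coord C_unit (S (av z0.1)).
have [e2 _ _ _] := psi_coord T eps C_unit (M (av z0.1)) (S (av z0.1)) (lam z0.2).
have A0 : 3%:R * tri d d w != 0 by rewrite -e2.
(* F must not vanish on all of [ruled]. If it vanishes at d, then at d + w it takes the value 3 (d d
   w), which is nonzero on [psi_dom]. *)
have [Fd|Fd] := eqVneq (tri d d d) 0; last first.
  exists d; last by rewrite FE.
  by apply: (ruledP Av); rewrite ?d2 ?d3 ?d4 mul1r.
exists (1 *: d + 1 *: w); last first.
  rewrite FE (tri_cube T12 T23) Fd (tri_dww T12 T23 C_unit polar00 polar01 polar11).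
  rewrite (tri_wSS T12 T23 C_unit polar00 polar01 polar11); apply: contraNneq A0 => <-.
  by apply/eqP; ring.
rewrite -/d in d2 d3 d4; rewrite -/w in w2 w3 w4.
move: d w d2 d3 d4 w2 w3 w4 {Fd A0 e2} => d w d2 d3 d4 w2 w3 w4.
by apply: (ruledP Av); rewrite !lcoordD !lcoordZ ?d2 ?d3 ?d4 ?w2 ?w3 ?w4; ring.
Qed.

Lemma surface_dim_le : dim_le (sub_space surface) 2.
Proof.
apply: (dim_le_cone sep_hV); apply: alg_dep_sub alg_dep_surface => _ [t [_ [[x _ <-] ->]]].
by exists t, (hV x); split=> //; exists (set_val x) => //; exact: set_valP.
Qed.

Lemma closed_surface_form (p : {mpoly K[5]}) d : p \is d.-homog ->
  closed [set x : sub_space surface | p.@[hcoord (hV x)] = 0].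
Proof.
move=> hp; rewrite -openC; rewrite [X in open X](_ : _ = [set x | p.@[hcoord (hV x)] != 0]).
  exact: (open_preimage_neq0 sep_hV hp).
by apply/seteqP; split=> x /= /eqP.
Qed.

Lemma fibre_irr z : psi_dom z ->
  irreducible_set (psiV @` [set z' | psi_dom z' /\ z'.1 = z.1]).
Proof.
move=> dz; pose j (u : P1) : GP := (z.1, u).
have mj u : morphism_at j u.
  by apply: (morphism_pair rG rP1 rP1); [exact: morphism_cst | exact: morphism_id].
have -> : [set z' | psi_dom z' /\ z'.1 = z.1] = j @` (j @^-1` psi_dom).
  apply/seteqP; split=> [[a u] /= [d e]|_ [u d <-]]; last by split.
  by exists u; rewrite /j -e.
rewrite image_comp; apply: irreducible_image.
  have := irreducible_open (irreducible_proj K 1) (_ : open (j @^-1` psi_dom)); rewrite setTI; apply.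
    by apply: open_comp psi_dom_open => u _; exact: (mj u).1.
  by exists z.2; rewrite /= /j -surjective_pairing.
move=> u du; apply: continuous_comp; [exact: (mj u).1 | exact: (psiV_morphism du).1].
Qed.

(** The lower bound is the chain formed by the closure of a point, the closure of its fibre over the
    curve, and the surface; one linear form shows that each inclusion is strict. *)
Lemma surface_has_dim : has_dim (sub_space surface) 2.
Proof.
split; first exact: surface_dim_le.
have [z [z' [[dz dz'] ez lz _]]] := psi_dom_exists 0.
have [z2 [_ [[dz2 _] _ _ Mz2]]] := psi_dom_exists (M (av z.1)).
pose Fb := psiV @` [set z' | psi_dom z' /\ z'.1 = z.1].
have valE w : psi_dom w -> hV (psiV w) = pt (psiv w) by move=> dw; rewrite /hV /hY /= psiVE // psiYE.
have ptE (p : {mpoly K[5]}) w : p \is 1.-homog -> psi_dom w ->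
    (p.@[hcoord (hV (psiV w))] == 0) = (p.@[psiv w 0] == 0).
  by move=> hp dw; rewrite valE // (meval_pt hp) // (lcoord_neq0 (i := i2) (C := C)) //; have [] := dw.
have hl i : lform C i \is 1.-homog := lform_homog C i.
apply: (@chain2 _ (closure [set psiV z]) (closure Fb) setT).
- exact: closed_closure.
- exact: irreducible_closure (irreducible_set1 _).
- exact: closed_closure.
- exact: irreducible_closure (fibre_irr dz).
- exact: closedT.
- exact: irr_surface.
- split; first by apply: closure_subset => _ ->; exists z.
  (* Within the fibre, this form vanishes exactly at the parameter of z. *)
  pose p := lform C 0 - S (av z.1) *: lform C 1 - lam z.2 *: lform C i2.
  have hp : p \is 1.-homog by rewrite !rpredB ?rpredZ.
  have pE w : psi_dom w -> w.1 = z.1 -> (p.@[psiv w 0] == 0) = (lam w.2 == lam z.2).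
    move=> dw ew; have [_ _ c] := psiv_coord w; rewrite ew in c; have [_ _ _ Aw] := dw.
    rewrite !mevalB !mevalZ !lformE c mulrC -mulrBl mulf_eq0 (negPf Aw) orbF.
    by rewrite subr_eq0.
  move=> /(_ (psiV z')) sub.
  have : closure [set psiV z] (psiV z') by apply: sub; apply: subset_closure; exists z'.
  have cl : closure [set psiV z] `<=` [set x | p.@[hcoord (hV x)] = 0].
    rewrite [X in _ `<=` X](closure_id _).1; last exact: closed_surface_form hp.
    by apply: closure_subset => _ ->; apply/eqP; rewrite ptE // pE.
  by move/cl/eqP; rewrite ptE // pE // eq_sym (negPf lz).
split=> // /(_ (psiV z2) I).
(* This form vanishes on the fibre of z but not at z2, where M has another value. *)
pose p := lform C i3 - M (av z.1) *: lform C i2.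
have hp : p \is 1.-homog by rewrite !rpredB ?rpredZ.
have pE w : psi_dom w -> (p.@[psiv w 0] == 0) = (M (av w.1) == M (av z.1)).
  move=> dw; have [c _ _] := psiv_coord w; have [_ _ _ Aw] := dw.
  rewrite mevalB mevalZ !lformE c mulrC -mulrBl mulf_eq0 (negPf Aw) orbF.
  by rewrite subr_eq0.
have cl : closure Fb `<=` [set x | p.@[hcoord (hV x)] = 0].
  rewrite [X in _ `<=` X](closure_id _).1; last exact: closed_surface_form hp.
  apply: closure_subset => _ [w [dw ew] <-]; apply/eqP.
  by rewrite ptE // pE // ew.
by move/cl/eqP; rewrite ptE // pE // (negPf Mz2).
Qed.

Lemma surface_Qpoly (x : sub_space Y) : surface x -> y (hvec (set_val x)) i2 != 0 ->
  (Qpoly eps D ps).[(nx x)%:P].[mx x] = 0.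
Proof.
move=> Vx x2; have [g [g0 _ gQ]] := ruled_equation.
have gx : g.@[hvec (set_val x) 0] = 0.
  apply: (vanishing_closure sep_hY (Z := psiY @` psi_dom)).
    by move=> v /cone_psi; exact: g0.
  by exists 1, (hY x); rewrite scale1r; split=> //; exists x.
by rewrite /nx /mx !lcoordZ ![_^-1 * _]mulrC gQ.
Qed.

(** Pulled back to K^2, where any three polynomials are dependent. *)
Lemma alg_dep_line : alg_dep 3 [set v | exists a b, v = a *: f 0 + b *: f 1].
Proof.
move=> q; pose c j : {mpoly K[2]} := (f 0 0 j) *: 'X_0 + (f 1 0 j) *: 'X_1.
have [P P0 hP] := @alg_dep_all K 2 (fun i => mmap (@mpolyC 2 K) c (q i)).
exists P => // _ [a [b ->]]; rewrite -[RHS](hP (a *: delta_mx 0 0 + b *: delta_mx 0 1) I).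
apply: meval_eq => i; rewrite (mmap_eval (e := meval _)) /=; last by move=> ?; rewrite mevalC.
by apply: meval_eq => j; rewrite /c mevalD !mevalZ !mevalXU !mxE /=; ring.
Qed.

Local Notation phi := (phi_ratMap char0 T12 T23 C_unit polar00 polar01 polar11 ps D_neq0 F_homog FE).

(** On the surface v w w equals Q = 0, so the residual point reduces to a multiple of w. *)
Lemma phi_surface_line : cone (hY @` (phi @` (surface `&` rat_dom phi)))
  `<=` [set v | exists a b, v = a *: f 0 + b *: f 1].
Proof.
move=> _ [t [_ [[_ [x [Vx dx] <-] <-] ->]]].
have [x2 Px] := dx; have := surface_Qpoly Vx x2.
have -> : hY (phi x) = pt (Phi T C D ps (xh x)).
  exact: (phiE T12 T23 C_unit polar00 polar01 polar11 F_homog FE dx).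
rewrite -(tri_wvec T12 T23 polar00 polar01 polar11) ?hat_coord2 // => q0.
have [a a0 ->] := hvec_pt Px; rewrite /Phi q0 scale0r sub0r -scaleNr !scalerA.
by rewrite /wvec scalerDr !scalerA; eexists; eexists.
Qed.

Lemma phi_contracts : contracts phi surface.
Proof.
split.
  by split; [exact: closed_closure | exact: surface_irr | exact: surface_has_dim].
exists phi; split.
- by exists (rat_dom phi); split; [exact: rat_dom_open | exact: rat_dom_dense | |].
- exists (psiY z0); split; first exact: surface_psi.
  have [[x2 Dx] mE nE _ _] := psiY_hat z0_dom; split=> //.
  have [Uz Dz z1 Az] := z0_dom; have Av := av_A Uz.
  have [e2 _ _ _] := psi_coord T eps C_unit (M (av z0.1)) (S (av z0.1)) (lam z0.2).
  have h := psi_tri T12 T23 C_unit polar00 polar01 polar11 (M := M (av z0.1)) (S := S (av z0.1)) (l := lam z0.2).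
  have hE : xh (psiY z0) = (y (psiv z0) i2)^-1 *: psiv z0 by rewrite psiYE // hat_pt.
  (* The coordinate y_1 of w is D, nonzero on [psi_dom]; so [Phi] is nonzero as soon as v v w is. *)
  apply: (@lcoord_neq0 _ C _ 1).
  have wE := wvec_curve C (psE Av).
  have := surface_Qpoly (surface_psi z0_dom) x2.
  rewrite -(tri_wvec T12 T23 polar00 polar01 polar11) ?hat_coord2 // => q0.
  have [_ _ _ w1] := wvec_coord C_unit D ps (mx (psiY z0)) (nx (psiY z0)).
  rewrite /Phi q0 scale0r sub0r -scaleNr lcoordZ w1.
  rewrite mulf_neq0 // oppr_eq0 -/(mx _) -/(nx _) mE nE wE triZr //.
  rewrite mulf_neq0 // hE /psiv e2 h; first by apply: contraNneq Az => t0; rewrite /psiv e2 t0 mulr0.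
  by rewrite -e2.
apply: (dim_le_cone (separating_val _ sep_hY)).
have := alg_dep_closure sep_hY (alg_dep_sub phi_surface_line alg_dep_line).
apply: alg_dep_sub => _ [t [_ [[x _ <-] ->]]].
by exists t, (hY (set_val x)); split=> //; exists (set_val x) => //; exact: set_valP.
Qed.

End RuledSurface.

(** * Assembly over an uncountable field of characteristic 0, and the complex case *)

Lemma smooth_cubic_contraction (K : closedFieldType) (Y : set (projective_space K 4)) (Gamma : funSpace K) :
  ~ countable [set: K] -> [pchar K] =i pred0 ->
  is_smooth_hypersurface 3 Y -> is_irreducible_curve Gamma ->
  exists2 phi : ratMap (sub_space Y) (sub_space Y), Bir (sub_space Y) phi &
    exists2 V : set (sub_space Y), contracts phi V &
      birational (sub_space V) (prod_space Gamma (projective_space K 1)).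
Proof.
move=> K_unc char0 [F [_ Fh -> sm]] curveG.
have [T [T12 T23 FE grad]] := cubic_tensor char0 Fh.
have smooth (u : 'rV[K]_5) : u != 0 -> tri T u u u = 0 -> exists w, tri T u u w != 0.
  move=> u0 Fu; have [j nz] := sm (pt u) (cubic_pt Fh FE u0 Fu).
  have [a a0 e] := hvec_pt u0; rewrite hcoordE e grad in nz.
  exists (delta_mx 0 j); apply: contraNneq nz => t0.
  by rewrite !triZl triZm // t0 !mulr0.
have [e0 [e1 [eps [C [Cu e0C e1C h]]]]] := cubic_line_normal_form T12 T23 char0 smooth.
have e0E : e0 = lbasis C 0 by rewrite /lbasis -e0C mulmxK.
have e1E : e1 = lbasis C 1 by rewrite /lbasis -e1C mulmxK.
rewrite e0E e1E in h.
have p00 w : tri T (lbasis C 0) (lbasis C 0) w = lcoord C w i2 by have [] := h w.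
have p01 w : 2%:R * tri T (lbasis C 0) (lbasis C 1) w = eps * lcoord C w i3 by have [] := h w.
have p11 w : tri T (lbasis C 1) (lbasis C 1) w = lcoord C w i4 by have [] := h w.
have [n [A [U [[oU _] [cA irrA] [fi [gi [mf mg fK gK]]] dimA twoA]]]] := curve_affine_chart curveG.
have [m [s [D [ps [pc [D0 Mnc pcE psE nd]]]]]] :=
  affine_plane_model K_unc eps char0 cA irrA dimA twoA.
have [varG irrG _] := curveG; have rG := variety_ring_space varG.
(* Only a point of the domain is wanted here; the value 0 that M avoids is arbitrary. *)
have [z0 [_ [[dz0 _] _ _ _]]] := psi_dom_exists char0 T12 T23 Cu p00 p01 D0 irrA gK Mnc nd 0.
exists (phi_ratMap char0 T12 T23 Cu p00 p01 p11 ps D0 Fh FE); first exact: phi_Bir.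
exists (surface T12 T23 Cu p00 p01 p11 Fh FE dz0).
  apply: (phi_contracts); eassumption.
apply: surface_birational; eassumption.
Qed.

Lemma complex_pchar0 (R : realType) : [pchar R[i]] =i pred0.
Proof.
apply/pcharf0P => k; rewrite -(rmorph_nat (real_complex R)) fmorph_eq0.
by rewrite Num.Theory.pnatr_eq0.
Qed.

Theorem propositionB (R : realType) (Y : set (projective_space R[i] 4))
    (smooth_cubic_Y : is_smooth_hypersurface 3 Y)
    (Gamma : funSpace R[i]) (curve_Gamma : is_irreducible_curve Gamma) :
  exists2 phi : ratMap (sub_space Y) (sub_space Y),
    Bir (sub_space Y) phi &
    exists2 V : set (sub_space Y),
      contracts phi V &
      birational (sub_space V)
        (prod_space Gamma (projective_space R[i] 1)).
Proof.
exact: smooth_cubic_contraction (@complex_uncountable R) (@complex_pchar0 R) smooth_cubic_Y curve_Gamma.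
Qed.
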